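(* Let $T=\{T(x),\ x\in\mathbb{S}^2\}$ be a centered isotropic $\mathbb{H}$-valued spherical random field with autocovariance operators $\mathscr{R}_{\langle\cdot,\cdot\rangle}$ and power spectrum operators $\mathscr{F}_\ell$, $\ell\ge 0$. Then $T$ admits the representation $$T(x)=\sum_{\ell=0}^\infty\sum_{m=-\ell}^{\ell}a_{\ell,m}Y_{\ell,m}(x),$$ where, for each fixed $(\ell,m)$, $a_{\ell,m}$ is a zero-mean $\mathbb{H}$-valued random variable with $\mathbb{E}[a_{\ell,m}\otimes a_{\ell,m}]=\mathscr{F}_\ell$, and $$\mathbb{E}[a_{\ell,m}\otimes a_{\ell',m'}]=0\qquad\text{for } (\ell,m)\neq(\ell',m').$$ The convergence of the infinite series holds both in $L^2(\Omega\times\mathbb{S}^2;\mathbb{H})$ and in $L^2(\Omega;\mathbb{H})$ for every fixed $x\in\mathbb{S}^2$, that is, $$\mathbb{E}\int_{\mathbb{S}^2}\Big\|T(x)-\sum_{\ell=0}^L\sum_{m=-\ell}^{\ell}a_{\ell,m}Y_{\ell,m}(x)\Big\|_{\mathbb{H}}^2dx\to0,\qquad L\to\infty,$$ and, for every fixed $x\in\mathbb{S}^2$, $$\mathbb{E}\Big\|T(x)-\sum_{\ell=0}^L\sum_{m=-\ell}^{\ell}a_{\ell,m}Y_{\ell,m}(x)\Big\|_{\mathbb{H}}^2\to0,\qquad L\to\infty.$$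
   Context: $\mathbb{H}$ is a separable real Hilbert space with inner product $\langle\cdot,\cdot\rangle_{\mathbb{H}}$ and norm $\|\cdot\|_{\mathbb{H}}$. For $u,v\in\mathbb{H}$, $u\otimes v$ is the operator $f\mapsto u\langle f,v\rangle_{\mathbb{H}}$. $\mathbb{S}^2$ is the unit sphere of $\mathbb{R}^3$, $dx$ is its surface (Lebesgue) measure of total mass $4\pi$, and $\langle\cdot,\cdot\rangle$ is the Euclidean inner product of $\mathbb{R}^3$. For each integer $\ell\ge0$, $\{Y_{\ell,m},\ m=-\ell,\dots,\ell\}$ is the standard orthonormal basis of real-valued fully normalized spherical harmonics of the eigenspace of the spherical Laplacian with eigenvalue $-\ell(\ell+1)$ in $L^2(\mathbb{S}^2;\mathbb{R})$. A (centered) $\mathbb{H}$-valued spherical random field is a collection $T=\{T(x),\ x\in\mathbb{S}^2\}$ of centered $\mathbb{H}$-valued random variables on a common probability space $(\Omega,\mathfrak{F},\operatorname{P})$ such that $\mathbb{E}\|T(x)\|_{\mathbb{H}}^2<\infty$ for all $x$ and the map $T:\Omega\times\mathbb{S}^2\to\mathbb{H}$ is jointly measurable. Its autocovariance operators are the Bochner integrals $\mathscr{R}_{x,y}=\mathbb{E}[T(x)\otimes T(y)]$. $T$ is isotropic if $\mathscr{R}_{x,y}=\mathscr{R}_{\rho x,\rho y}$ for all $x,y\in\mathbb{S}^2$ and $\rho\in SO(3)$; then $\mathscr{R}_{x,y}$ depends only on $\langle x,y\rangle$ and is written $\mathscr{R}_{\langle x,y\rangle}$. The power spectrum operator is the Bochner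 integral (in the space of Hilbert–Schmidt operators on $\mathbb{H}$) $\mathscr{F}_\ell=\int_{\mathbb{S}^2\times\mathbb{S}^2}\mathscr{R}_{\langle x,y\rangle}Y_{\ell,0}(x)Y_{\ell,0}(y)\,dx\,dy$, $\ell\ge0$. *)

(* Defs.v *)
From HB Require Import structures.
From mathcomp Require Import all_boot all_order all_algebra.
From mathcomp Require Import complex.
From mathcomp Require Import all_classical all_reals all_analysis.
From mathcomp Require Import measurable_realfun.
From mathcomp Require Import ring lra.

Set Implicit Arguments.
Unset Strict Implicit.
Unset Printing Implicit Defensive.

Import Order.TTheory GRing.Theory Num.Theory.
Import numFieldNormedType.Exports.

Local Open Scope classical_set_scope.
Local Open Scope ring_scope.

HB.mixin Record CompleteNormedModule_isHilbert (R : realType) H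
    & CompleteNormedModule R H := {
  inner : H -> H -> R ;
  innerC : forall u v, inner u v = inner v u ;
  innerDl : forall u v w, inner (u + v) w = inner u w + inner v w ;
  innerZl : forall (c : R) u v, inner (c *: u) v = c * inner u v ;
  innerxx : forall u, inner u u = `|u| ^+ 2
}.

#[short(type="hilbertType")]
HB.structure Definition Hilbert (R : realType) :=
  {H of CompleteNormedModule R H & CompleteNormedModule_isHilbert R H}.

Definition separable_space (T : topologicalType) : Prop :=
  exists2 D : set T, countable D & dense D.

Definition borel (T : ptopologicalType) := g_sigma_algebraType (@open T).

Section bochner.
Context d (X : measurableType d) (R : realType) (V : normedModType R).
Variable mu : {measure set X -> \bar R}.

Definition is_simple (s : X -> V) : Prop :=
  [/\ finite_set (range s),
      forall v, measurable (s @^-1` [set v]) &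
      forall v, v != 0 -> (mu (s @^-1` [set v]) < +oo)%E].

(* The fibre over 0 may have infinite mass, but contributes [_ *: 0 = 0]. *)
Definition simple_integral (s : X -> V) : V :=
  \sum_(v \in range s) fine (mu (s @^-1` [set v])) *: v.

Definition is_bochner (f : X -> V) (I : V) : Prop :=
  exists s : nat -> X -> V,
    [/\ forall n, is_simple (s n),
        {ae mu, forall x, s n x @[n --> \oo] --> f x},
        (\int[mu]_x (`|f x - s n x|)%:E)%E @[n --> \oo] --> 0%E &
        simple_integral (s n) @[n --> \oo] --> I].

(* Total operator: 0 when f is not Bochner integrable. *)
Definition bochner (f : X -> V) : V := xget 0 [set I | is_bochner f I].

End bochner.

Section hilbert_schmidt.
Context (R : realType) (H : hilbertType R).
Implicit Types (A B : H -> H) (s : seq H) (u v : H).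

Definition orthonormal_seq s : Prop :=
  forall i j, (i < size s)%N -> (j < size s)%N ->
    inner (nth 0 s i) (nth 0 s j) = (i == j)%:R.

(* For a linear A, this is finite exactly when A is Hilbert-Schmidt, and it is
   then the sum of |A e|^2 over any orthonormal basis. *)
Definition hs_sqnorm A : \bar R :=
  ereal_sup [set (\sum_(e <- s) `|A e| ^+ 2)%:E | s in orthonormal_seq].

Definition hs_pred : {pred (H -> H)} :=
  mem [set A | linear A /\ (hs_sqnorm A < +oo)%E].

Record hs_op := HSOp { hs_fun :> H -> H ; hs_funP : hs_fun \in hs_pred }.

HB.instance Definition _ := [isSub for hs_fun].
HB.instance Definition _ := [Choice of hs_op by <:].

Lemma hs_sqnorm_ub A s : orthonormal_seq s ->
  ((\sum_(e <- s) `|A e| ^+ 2)%:E <= hs_sqnorm A)%E.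
Proof. by move=> os; apply: ereal_sup_ubound; exists s. Qed.

Lemma hs_sqnorm_ge0 A : (0 <= hs_sqnorm A)%E.
Proof.
have /(hs_sqnorm_ub A) : orthonormal_seq [::] by move=> i j.
by rewrite big_nil.
Qed.

Lemma hs_predP A : reflect (linear A /\ (hs_sqnorm A < +oo)%E) (A \in hs_pred).
Proof. by apply: (iffP idP) => [/set_mem|/mem_set]. Qed.

Fact hs_submod_closed : submod_closed hs_pred.
Proof.
split.
  apply/hs_predP; split; first by move=> c u v /=; rewrite scaler0 addr0.
  apply: (@le_lt_trans _ _ 0%E) => //.
  apply: ge_ereal_sup => _ [s _ <-].
  by rewrite big1// => e _; rewrite normr0 expr0n.
move=> c A B /hs_predP[lA fA] /hs_predP[lB fB]; apply/hs_predP; split.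
  move=> k u v /=.
  change (c *: A (k *: u + v) + B (k *: u + v)
    = k *: (c *: A u + B u) + (c *: A v + B v)).
  rewrite lA lB !scalerDr !scalerA (mulrC c k) -!addrA; congr (_ + _).
  by rewrite addrCA.
apply: (@le_lt_trans _ _
  ((2 * c ^+ 2)%:E * hs_sqnorm A + 2%:E * hs_sqnorm B)%E); last first.
  move: fA fB (hs_sqnorm_ge0 A) (hs_sqnorm_ge0 B).
  by case: (hs_sqnorm A) => [a||]//; case: (hs_sqnorm B) => [b||]// *;
    rewrite -!EFinM -EFinD ltry.
apply: ge_ereal_sup => _ [s os <-].
apply: (@le_trans _ _ ((2 * c ^+ 2) * (\sum_(e <- s) `|A e| ^+ 2)
   + 2 * (\sum_(e <- s) `|B e| ^+ 2))%:E).
  rewrite lee_fin !mulr_sumr -big_split/=; apply: ler_sum => e _.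
  change (`|c *: A e + B e| ^+ 2 <= 2 * c ^+ 2 * `|A e| ^+ 2 + 2 * `|B e| ^+ 2).
  have h : `|c *: A e + B e| <= `|c| * `|A e| + `|B e|.
    by rewrite (le_trans (ler_normD _ _))// normrZ.
  rewrite (@le_trans _ _ ((`|c| * `|A e| + `|B e|) ^+ 2))//.
    by rewrite ler_sqr ?nnegrE// addr_ge0// mulr_ge0.
  rewrite -(real_normK (num_real c)).
  have := sqr_ge0 (`|c| * `|A e| - `|B e|); nra.
rewrite EFinD; apply: leeD.
  rewrite EFinM; apply: lee_wpmul2l; last exact: hs_sqnorm_ub.
  by rewrite lee_fin mulr_ge0// sqr_ge0.
by rewrite EFinM; apply: lee_wpmul2l; [rewrite lee_fin|exact: hs_sqnorm_ub].
Qed.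

HB.instance Definition _ := GRing.isSubmodClosed.Build R (H -> H) hs_pred
  hs_submod_closed.
HB.instance Definition _ := [SubChoice_isSubLmodule of hs_op by <:].

Definition hs_norm (A : hs_op) : R := Num.sqrt (fine (hs_sqnorm A)).

Lemma hs_sqnormE (A : hs_op) : hs_sqnorm A = (hs_norm A ^+ 2)%:E.
Proof.
have [_ fA] := hs_predP _ (hs_funP A); have := hs_sqnorm_ge0 A.
rewrite /hs_norm; move: fA; case: (hs_sqnorm A) => [a||]// _; rewrite lee_fin.
by move=> a0 /=; rewrite sqr_sqrtr.
Qed.

Lemma hs_norm_ge0 (A : hs_op) : 0 <= hs_norm A.
Proof. exact: sqrtr_ge0. Qed.

Lemma hs_norm_le (A : hs_op) (c : R) : 0 <= c ->
  (forall s, orthonormal_seq s -> \sum_(e <- s) `|A e| ^+ 2 <= c ^+ 2) ->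
  hs_norm A <= c.
Proof.
move=> c0 h; rewrite -ler_sqr ?nnegrE ?hs_norm_ge0// -lee_fin -hs_sqnormE.
by apply: ge_ereal_sup => _ [s /h os <-]; rewrite lee_fin.
Qed.

Lemma hs_norm_ub (A : hs_op) s : orthonormal_seq s ->
  \sum_(e <- s) `|A e| ^+ 2 <= hs_norm A ^+ 2.
Proof. by move=> os; rewrite -lee_fin -hs_sqnormE; exact: hs_sqnorm_ub. Qed.

Lemma minkowski_sum (I : Type) (r : seq I) (f g : I -> R) (a b : R) :
  (forall i, 0 <= f i) -> (forall i, 0 <= g i) -> 0 <= a -> 0 <= b ->
  \sum_(i <- r) f i ^+ 2 <= a ^+ 2 -> \sum_(i <- r) g i ^+ 2 <= b ^+ 2 ->
  \sum_(i <- r) (f i + g i) ^+ 2 <= (a + b) ^+ 2.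
Proof.
move=> f0 g0; elim: r a b => [|i r ih] a b a0 b0.
  by rewrite !big_nil => *; exact: sqr_ge0.
rewrite !big_cons => fa gb.
have fi : 0 <= \sum_(i <- r) f i ^+ 2 by apply: sumr_ge0 => *; exact: sqr_ge0.
have gi : 0 <= \sum_(i <- r) g i ^+ 2 by apply: sumr_ge0 => *; exact: sqr_ge0.
have a'0 : 0 <= a ^+ 2 - f i ^+ 2 by lra.
have b'0 : 0 <= b ^+ 2 - g i ^+ 2 by lra.
set x := Num.sqrt (a ^+ 2 - f i ^+ 2); set y := Num.sqrt (b ^+ 2 - g i ^+ 2).
have x0 : 0 <= x by exact: sqrtr_ge0.
have y0 : 0 <= y by exact: sqrtr_ge0.
have x2 : x ^+ 2 = a ^+ 2 - f i ^+ 2 by exact: sqr_sqrtr.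
have y2 : y ^+ 2 = b ^+ 2 - g i ^+ 2 by exact: sqr_sqrtr.
have hr : \sum_(i <- r) (f i + g i) ^+ 2 <= (x + y) ^+ 2.
  by apply: ih => //; [rewrite x2|rewrite y2]; lra.
have cs : x * y + f i * g i <= a * b.
  rewrite -ler_sqr ?nnegrE ?mulr_ge0//; last by rewrite addr_ge0// mulr_ge0.
  have -> : (a * b) ^+ 2 = (x ^+ 2 + f i ^+ 2) * (y ^+ 2 + g i ^+ 2).
    by rewrite x2 y2; ring.
  have := sqr_ge0 (x * g i - y * f i); nra.
nra.
Qed.

Lemma hs_ler_normD (A B : hs_op) : hs_norm (A + B) <= hs_norm A + hs_norm B.
Proof.
apply: hs_norm_le => [|s os]; first by rewrite addr_ge0 ?hs_norm_ge0.
apply: (@le_trans _ _ (\sum_(e <- s) (`|A e| + `|B e|) ^+ 2)).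
  by apply: ler_sum => e _; rewrite ler_sqr ?nnegrE ?addr_ge0//; exact: ler_normD.
by apply: minkowski_sum => //; rewrite ?hs_norm_ge0 ?hs_norm_ub.
Qed.

Lemma hs_normrZ (c : R) (A : hs_op) : hs_norm (c *: A) = `|c| * hs_norm A.
Proof.
have hle (k : R) (B : hs_op) : hs_norm (k *: B) <= `|k| * hs_norm B.
  apply: hs_norm_le => [|s os]; first by rewrite mulr_ge0 ?hs_norm_ge0.
  rewrite exprMn; apply: le_trans (ler_wpM2l _ (hs_norm_ub B os)).
    by rewrite mulr_sumr; apply: ler_sum => e _; rewrite -exprMn -normrZ.
  exact: sqr_ge0.
apply/eqP; rewrite eq_le hle/=; have [->|c0] := eqVneq c 0.
  by rewrite normr0 mul0r hs_norm_ge0.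
have := hle c^-1 (c *: A); rewrite scalerA mulVf// scale1r normfV.
by rewrite ler_pdivlMl ?normr_gt0.
Qed.

Lemma hs_normr0_eq0 (A : hs_op) : hs_norm A = 0 -> A = 0.
Proof.
move=> A0; apply: val_inj; apply/funext => u /=.
change (A u = 0).
have [lA _] := hs_predP _ (hs_funP A).
have A00 : A 0 = 0.
  by have := lA (-1) 0 0; rewrite scaler0 addr0 scaleN1r addNr.
have [->//|u0] := eqVneq u 0.
have nu0 : `|u| != 0 by rewrite normr_eq0.
pose e := `|u|^-1 *: u.
have ee : inner e e = 1.
  by rewrite innerxx normrZ normfV normr_id mulVf// expr1n.
have /(hs_norm_ub A) : orthonormal_seq [:: e] by case=> [|i] [|j].
rewrite A0 big_seq1 expr0n/= => Ae.
have {}Ae : A e = 0.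
  by apply/eqP; rewrite -normr_eq0 -sqrf_eq0 eq_le Ae sqr_ge0.
have := lA `|u| e 0; rewrite addr0 Ae A00 scaler0 addr0.
by rewrite scalerA mulfV// scale1r.
Qed.

HB.instance Definition _ := Lmodule_isNormed.Build R hs_op
  hs_ler_normD hs_normrZ hs_normr0_eq0.

Lemma inner0l v : inner (0 : H) v = 0.
Proof. by have := innerZl 0 (0 : H) v; rewrite scaler0 mul0r. Qed.

Lemma innerNl u v : inner (- u) v = - inner u v.
Proof. by rewrite -scaleN1r innerZl mulN1r. Qed.

Lemma inner_suml (I : Type) (r : seq I) (F : I -> H) v :
  inner (\sum_(i <- r) F i) v = \sum_(i <- r) inner (F i) v.
Proof.
by elim: r => [|i r ih]; rewrite ?big_nil ?inner0l// !big_cons innerDl ih.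
Qed.

Lemma bessel s v : orthonormal_seq s ->
  \sum_(e <- s) inner e v ^+ 2 <= `|v| ^+ 2.
Proof.
move=> os; pose w := \sum_(e <- s) inner e v *: e.
have wv : inner w v = \sum_(e <- s) inner e v ^+ 2.
  by rewrite inner_suml; apply: eq_bigr => e _; rewrite innerZl -expr2.
have ww : inner w w = \sum_(e <- s) inner e v ^+ 2.
  rewrite {1}/w inner_suml [LHS](big_nth 0) [RHS](big_nth 0) !big_mkord.
  apply: eq_bigr => i _.
  rewrite innerZl [inner _ w]innerC inner_suml (big_nth 0) big_mkord.
  rewrite (bigD1 i)//= innerZl os// eqxx mulr1 big1 ?addr0 -?expr2// => j ji.
  have /negbTE {}ji : (j != i :> nat) := ji.
  by rewrite innerZl os// ji mulr0.
have : 0 <= inner (v - w) (v - w) by rewrite innerxx sqr_ge0.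
rewrite innerDl innerNl [inner v _]innerC [inner w _]innerC !innerDl !innerNl.
by rewrite innerxx ww [inner v w]innerC wv subrr subr0 subr_ge0.
Qed.

Fact tensor_subproof u v : (fun f : H => inner f v *: u) \in hs_pred.
Proof.
apply/hs_predP; split.
  by move=> c f g /=; rewrite innerDl innerZl scalerDl scalerA.
apply: (@le_lt_trans _ _ (`|v| ^+ 2 * `|u| ^+ 2)%:E); last exact: ltry.
apply: ge_ereal_sup => _ [s os <-]; rewrite lee_fin.
apply: le_trans (ler_wpM2r (sqr_ge0 _) (bessel v os)).
rewrite mulr_suml; apply: ler_sum => e _.
by rewrite normrZ exprMn real_normK// num_real.
Qed.

Definition tensor u v : hs_op := HSOp (tensor_subproof u v).

End hilbert_schmidt.

Section sphere.
Context (R : realType).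

Definition on_sphere : {pred 'cV[R]_3} := [pred x : 'cV[R]_3 | \sum_i x i 0 ^+ 2 == 1].

Record sphere := Sphere { sphere_pt :> 'cV[R]_3; sphereP : on_sphere sphere_pt }.

HB.instance Definition _ := [isSub for sphere_pt].
HB.instance Definition _ := [Choice of sphere by <:].

(* The point with colatitude theta and longitude phi. *)
Definition spherical_vec (theta phi : R) : 'cV[R]_3 :=
  \col_i [:: sin theta * cos phi; sin theta * sin phi; cos theta]`_i.

Fact spherical_subproof theta phi : on_sphere (spherical_vec theta phi).
Proof.
rewrite /on_sphere inE !big_ord_recl big_ord0 !mxE/= addr0 !exprMn addrA.
by rewrite -mulrDr cos2Dsin2 mulr1 addrC cos2Dsin2.
Qed.

Definition spherical_point (p : R * R) : sphere :=
  Sphere (spherical_subproof p.1 p.2).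

HB.instance Definition _ := isPointed.Build sphere (spherical_point (0, 0)).

Definition sphere_coords (x : sphere) : 3.-tuple R := [tuple x i 0 | i < 3].

Definition sphere_measurable : set (set sphere) :=
  g_sigma_algebra_preimage sphere_coords.

Let sphere_sigma_algebra : sigma_algebra setT sphere_measurable.
Proof. exact/sigma_algebra_preimage/sigma_algebra_measurable. Qed.

Let sphere_measurable0 : sphere_measurable set0.
Proof. by case: sphere_sigma_algebra. Qed.

Let sphere_measurableC A : sphere_measurable A -> sphere_measurable (~` A).
Proof. by rewrite -setTD; case: sphere_sigma_algebra => _ + _; apply. Qed.

Let sphere_bigcup (F : (set sphere)^nat) :
  (forall i, sphere_measurable (F i)) -> sphere_measurable (\bigcup_i F i).
Proof. by case: sphere_sigma_algebra => _ _; apply. Qed.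

HB.instance Definition _ := @isMeasurable.Build
  (preimage_display sphere_coords) sphere sphere_measurable
  sphere_measurable0 sphere_measurableC sphere_bigcup.

Lemma measurable_spherical_point :
  measurable_fun [set: R * R] spherical_point.
Proof.
suff h : measurable_fun [set: R * R] (sphere_coords \o spherical_point).
  by move=> _ _ [B mB <-]; rewrite setTI -comp_preimage; exact: h.
apply/measurable_fun_tnthP => i.
have -> : @tnth 3 R ^~ i \o (sphere_coords \o spherical_point) = fun p =>
    [:: sin p.1 * cos p.2; sin p.1 * sin p.2; cos p.1]`_i.
  by apply/funext => p /=; rewrite tnth_mktuple mxE.
have ms := continuous_measurable_fun (@continuous_sin R).
have mc := continuous_measurable_fun (@continuous_cos R).
have ms1 := measurableT_comp ms (@measurable_fst _ _ R R).
have mc1 := measurableT_comp mc (@measurable_fst _ _ R R).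
have ms2 := measurableT_comp ms (@measurable_snd _ _ R R).
have mc2 := measurableT_comp mc (@measurable_snd _ _ R R).
case: i => [[|[|[|//]]] i3] /=; [exact: measurable_funM.. | exact: mc1].
Qed.

Definition spherical_domain : set (R * R) := `[0, pi] `*` `[0, 2 * pi].

(* The area element is sin(theta) dtheta dphi. *)
Definition surface (A : set sphere) : \bar R :=
  (\int[lebesgue_measure \x lebesgue_measure]_(p in
    spherical_domain `&` spherical_point @^-1` A) (sin p.1)%:E)%E.

Let measurable_domain (A : set sphere) : measurable A ->
  measurable (spherical_domain `&` spherical_point @^-1` A).
Proof.
move=> mA; apply: measurableI; first exact: measurableX.
by rewrite -[X in measurable X]setTI; exact: measurable_spherical_point.
Qed.

Let sin_domain (A : set sphere) p :
  (spherical_domain `&` spherical_point @^-1` A) p -> (0 <= (sin p.1)%:E)%E.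
Proof.
move=> [[/= p1 _] _]; rewrite lee_fin sin_ge0_pi//.
Qed.

Let measurable_sin1 (D : set (R * R)) :
  measurable_fun D (fun p => (sin p.1)%:E).
Proof.
apply: (measurable_funS _ (subsetT D)) => //; apply/measurable_EFinP.
exact: measurableT_comp (continuous_measurable_fun (@continuous_sin R))
  (@measurable_fst _ _ R R).
Qed.

Let surface0 : surface set0 = 0%E.
Proof. by rewrite /surface preimage_set0 setI0 integral_set0. Qed.

Let surface_ge0 A : (0 <= surface A)%E.
Proof. by apply: integral_ge0 => p; exact: sin_domain. Qed.

Let surface_sigma_additive : semi_sigma_additive surface.
Proof.
move=> F mF tF mUF; rewrite /surface preimage_bigcup setI_bigcupr.
rewrite ge0_integral_bigcup//=; last 4 first.
- by move=> i; exact: measurable_domain.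
- exact: measurable_sin1.
- by move=> p [i _]; exact: sin_domain.
- apply/trivIsetP => /= i j _ _ ij; rewrite setIACA -preimage_setI.
  by move/trivIsetP : tF => /(_ _ _ _ _ ij) ->//; rewrite preimage_set0 setI0.
apply: is_cvg_ereal_nneg_natsum_cond => n _ _.
exact: surface_ge0.
Qed.

HB.instance Definition _ := isMeasure.Build _ _ _ surface
  surface0 surface_ge0 surface_sigma_additive.

Let surface_fin : fin_num_fun surface.
Proof.
move=> A mA; rewrite ge0_fin_numE//; apply: (@le_lt_trans _ _
  (\int[lebesgue_measure \x lebesgue_measure]_(p in spherical_domain)
    (cst 1%E) p)%E).
  apply: (@le_trans _ _ (\int[lebesgue_measure \x lebesgue_measure]_(p in
    spherical_domain `&` spherical_point @^-1` A) (cst 1%E) p)%E).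
    apply: ge0_le_integral => //=.
    + exact: measurable_domain.
    + by move=> p; exact: sin_domain.
    + exact: measurable_sin1.
    + by move=> p _; rewrite lee_fin sin_le1.
  apply: ge0_subset_integral => //=.
  + exact: measurable_domain.
  + exact: measurableX.
rewrite integral_cst ?mul1e; last exact: measurableX.
have /= := @product_measure1E _ _ _ _ R (@lebesgue_measure R)
  (@lebesgue_measure R) `[0, pi] `[0, 2 * pi] (measurable_itv _)
  (measurable_itv _).
rewrite /spherical_domain !lebesgue_measure_itv/= => ->.
by case: ifP => _; case: ifP => _; rewrite -?EFinB -?EFinM ?mule0 ?mul0e ltry.
Qed.

HB.instance Definition _ := Measure_isFinite.Build _ _ _ surface surface_fin.

Definition SO3 : {pred 'M[R]_3} :=
  [pred rho : 'M[R]_3 | (rho^T *m rho == 1%:M) && (\det rho == 1)].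

(* [insubd] is only a cast here, see [rotateE]. *)
Definition rotate (rho : 'M[R]_3) (x : sphere) : sphere :=
  insubd x (rho *m x).

Lemma rotateE rho x : rho \in SO3 -> rotate rho x = rho *m x :> 'cV[R]_3.
Proof.
move=> /andP[/eqP rhoK _].
have sqE (y : 'cV[R]_3) : \sum_i y i 0 ^+ 2 = (y^T *m y) 0 0.
  by rewrite mxE; apply: eq_bigr => i _; rewrite mxE expr2.
have rx : on_sphere (rho *m x).
  rewrite /on_sphere inE sqE trmx_mul -mulmxA (mulmxA _ rho) rhoK mul1mx -sqE.
  exact: sphereP.
by rewrite /rotate (val_insubd x) rx.
Qed.

Definition legendre (l : nat) : {poly R} :=
  ((2 ^ l * l`!)%:R)^-1 *: (('X^2 - 1) ^+ l)^`(l).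

(* No Condon-Shortley phase. *)
Definition assoc_legendre (l k : nat) (t : R) : R :=
  Num.sqrt (1 - t ^+ 2) ^+ k * (legendre l)^`(k).[t].

Definition sph_norm (l k : nat) : R :=
  Num.sqrt ((2 * l + 1)%:R / (4 * pi) * ((l - k)`!%:R / (l + k)`!%:R)).

(* In spherical coordinates x = (sin theta cos phi, sin theta sin phi,
   cos theta), so (x_0 + i x_1)^k = sin(theta)^k (cos(k phi) + i sin(k phi)):
   this form has no singularity at the poles. The usual expression is
   recovered by [sph_harmonic_spherical]. *)
Definition sph_harmonic (l : nat) (m : int) (x : sphere) : R :=
  let k := `|m|%N in
  let z := ((x 0 0 +i* x 1 0) ^+ k)%C in
  (if m == 0 then 1 else Num.sqrt 2) * sph_norm l k *
  (legendre l)^`(k).[x 2%R 0] *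
  (if 0 <= m then complex.Re z else complex.Im z).

Lemma sph_harmonic_spherical l m theta phi : 0 <= theta <= pi ->
  let k := `|m|%N in
  sph_harmonic l m (spherical_point (theta, phi)) =
  (if m == 0 then 1 else Num.sqrt 2) * sph_norm l k *
  assoc_legendre l k (cos theta) *
  (if 0 <= m then cos (k%:R * phi) else sin (k%:R * phi)).
Proof.
move=> theta0pi k; rewrite /sph_harmonic /assoc_legendre -/k !mxE/=.
rewrite -sin2cos2 sqrtr_sqr ger0_norm ?sin_ge0_pi//.
have -> : ((sin theta * cos phi +i* (sin theta * sin phi)) ^+ k =
    (sin theta ^+ k * cos (k%:R * phi)) +i*
    (sin theta ^+ k * sin (k%:R * phi)))%C.
  elim: k => [|k ih]; first by rewrite !expr0 mul0r cos0 sin0 mulr0 mulr1.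
  rewrite exprS ih mulrC -[k.+1%:R]natr1 mulrDl mul1r cosD sinD exprSr.
  by congr Complex => /=; ring.
by rewrite /=; case: (0 <= m) => /=; ring.
Qed.

End sphere.

Arguments SO3 : clear implicits.
Arguments surface : clear implicits.

Section spherical_field.
Context d (Omega : measurableType d) (R : realType) (P : probability Omega R).
Context (H : hilbertType R) (T : sphere R -> Omega -> H).

Record spherical_field : Prop := {
  field_measurable : measurable_fun [set: Omega * sphere R]
    (fun p => T p.2 p.1 : borel H) ;
  field_sqintegrable :
    forall x, (\int[P]_w (`|T x w| ^+ 2)%:E < +oo)%E ;
  field_centered : forall x, is_bochner P (T x) 0
}.

Definition autocov (x y : sphere R) : hs_op H :=
  bochner P (fun w => tensor (T x w) (T y w)).

Definition isotropic : Prop :=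
  forall x y rho, rho \in SO3 R ->
    autocov x y = autocov (rotate rho x) (rotate rho y).

Definition power_spectrum (l : nat) : hs_op H :=
  bochner (surface R \x surface R)%E (fun p : sphere R * sphere R =>
    (sph_harmonic l 0 p.1 * sph_harmonic l 0 p.2) *: autocov p.1 p.2).

End spherical_field.

(* The inner index i < 2l+1 stands for the order m = i - l in [-l, l]. *)
Definition harmonic_partial_sum (R : realType) (H : hilbertType R) (W : Type)
    (a : nat -> int -> W -> H) (L : nat) (x : sphere R) (w : W) : H :=
  \sum_(l < L.+1) \sum_(i < (2 * l).+1)
    sph_harmonic l (i%:Z - l%:Z) x *: a l (i%:Z - l%:Z) w.

(* Main.v *)
Require Import Defs.
From HB Require Import structures.
From mathcomp Require Import all_boot all_order all_algebra.
From mathcomp Require Import complex.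
From mathcomp Require Import all_classical all_reals all_analysis.
From mathcomp Require Import measurable_realfun.
From mathcomp Require Import ring lra zify.

Set Implicit Arguments.
Unset Strict Implicit.
Unset Printing Implicit Defensive.

Import Order.TTheory GRing.Theory Num.Theory.
Import numFieldNormedType.Exports.

Local Open Scope classical_set_scope.
Local Open Scope ring_scope.

(** The coefficient [a l m] is, path by path, the Bochner integral over the
    sphere of [x |-> Y l m x *: T x].

    _Covariances._ For vectors [u], [v] the scalar kernel
    [cross u v x y = E (<T x, u> <T y, v>)] is bounded and, by isotropy,
    invariant under rotations. By the Funk-Hecke theorem ([funk_hecke]) the
    harmonics of degree [l] are eigenfunctions of such a kernel, with an
    eigenvalue [lam l] that does not depend on the order. Exchanging expectation
    and surface integrals ([coefficient_fubini]), the expectation of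
    [<a l m, u> <a l' m', v>] is [lam l] if [(l, m) = (l', m')] and [0] otherwise
    ([coefficient_orthogonal]). The same number [lam l] is the matrix coefficient
    of the power spectrum operator ([spectrum_coef]). Bounded functionals commute
    with Bochner integrals ([bochner_functional]), and a Hilbert-Schmidt operator
    is determined by its matrix coefficients ([hs_ext]); hence the covariance
    operators of the coefficients are as claimed, as soon as all the Bochner
    integrals exist.

    _Convergence._ For fixed [u] and a truncation at degree [L], the mean square
    error at [x] of the expansion of [<T x, u>] is
    [cross u u x x - \sum_(l <= L) lam l * \sum_m Y l m x ^ 2] ([errorE]). Both
    terms are invariant under rotations, so the error is the same at every point,
    and it is enough that its integral over the sphere tends to [0]: this holds
    by completeness of the harmonics ([harmonics_complete]) and dominated
    convergence. Summing over an orthonormal basis, the directions beyond the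
    first [n] contribute at most the energy of the field in these directions
    ([mean_residual_le]), which is small uniformly in [x] and [L].

    _The sphere._ The surface measure is defined in spherical coordinates, so its
    rotation invariance has to be proved. The restrictions to the sphere of the
    polynomials of degree at most [n] are exactly the linear combinations of
    harmonics of degree at most [n] ([Poly_harmonics]), and polynomials determine
    finite measures ([polynomials_determine_measure]) and are dense in L2
    ([polynomials_dense]). Rotations about the polar axis act simply on harmonics
    ([polar_preserves_surface]), and the cyclic permutation of the axes acts
    simply on monomials, whose integrals satisfy a recurrence that is symmetric
    in the three coordinates ([moment_rec], [cycle_preserves_surface]). Products of
    these rotations bring any point to the north pole ([rotate_to_north]).

    _Bochner integrals._ A vector-valued function is approximated by its nearest
    points in a dense sequence, and a tensor product by the tensor products of
    these approximations ([bochner_vector_exists], [bochner_tensor_exists]). For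
    the power spectrum, the truncations of the covariance operator to finitely
    many directions converge uniformly, again because the energy of the tails is
    the same at every point ([finite_rank_error], [spectrum_exists]).

    Finally, the paths of infinite energy form a null set; the field is set to
    zero there ([regularized]) without changing any expectation. *)

(** * Legendre polynomials *)

Section polynomial_integral.
Context (R : realType).
Implicit Types (p q : {poly R}).

Definition prim p : {poly R} := \poly_(i < (size p).+1) (p`_i.-1 / i%:R).

Lemma coef_prim p i : (prim p)`_i = p`_i.-1 / i%:R.
Proof.
rewrite coef_poly; case: ltnP => // hi; case: i hi => [//|i /= hi].
by rewrite nth_default ?mul0r.
Qed.

Lemma deriv_prim p : (prim p)^`() = p.
Proof.
apply/polyP => i; rewrite coef_deriv coef_prim /= -[LHS]mulr_natr.
by rewrite divfK// pnatr_eq0.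
Qed.

Lemma prim_deriv p : prim p^`() = p - (p`_0)%:P.
Proof.
apply/polyP => i; rewrite coef_prim coefB coefC coef_deriv.
case: i => [|i] /=; first by rewrite subrr invr0 mulr0.
by rewrite subr0 -(mulr_natr _`_i.+1) mulfK// pnatr_eq0.
Qed.

(** The integral of [p] over [-1, 1], computed from a formal primitive so
    that integration by parts is pure algebra. *)
Definition pint p : R := (prim p).[1] - (prim p).[-1].

Fact pint_is_linear : linear_for *%R pint.
Proof.
move=> c; change (forall p q, pint (c *: p + q) = c * pint p + pint q) => p q.
rewrite /pint.
have -> : prim (c *: p + q) = c *: prim p + prim q.
  apply/polyP => i; rewrite !(coefD, coefZ, coef_prim).
  by rewrite mulrDl mulrA.
by rewrite !(hornerD, hornerZ); ring.
Qed.

HB.instance Definition _ := GRing.isLinear.Build R {poly R} R _ pint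
  pint_is_linear.

Lemma pint_deriv p : pint p^`() = p.[1] - p.[-1].
Proof. by rewrite /pint prim_deriv !hornerE; ring. Qed.

Lemma pint_by_parts p q : (p * q).[1] = 0 -> (p * q).[-1] = 0 ->
  pint (p^`() * q) = - pint (p * q^`()).
Proof.
move=> h1 h2; apply/eqP; rewrite -addr_eq0 -linearD/= -derivM pint_deriv.
by rewrite h1 h2 subrr.
Qed.

Lemma pint1 : pint 1 = 2.
Proof.
have -> : 1 = ('X : {poly R})^`() by rewrite derivX.
by rewrite pint_deriv !hornerX; ring.
Qed.

End polynomial_integral.

Section legendre.
Context (R : realType).
Implicit Types (p q : {poly R}).
Local Notation w := (1 - 'X^2 : {poly R}).
Local Notation P := (legendre R).

(** Differentiate [n + 1] times the first-order equation [(X^2 - 1) u' = 2 l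
    X u] satisfied by [u = (X^2 - 1)^l]. *)
Lemma rodrigues_ode l n (u := ('X^2 - 1 : {poly R}) ^+ l) :
  ('X^2 - 1) * u^`(n.+2) + (2 * (n.+1%:R - l%:R)) * 'X * u^`(n.+1)
  + n.+1%:R * (n%:R - 2 * l%:R) * u^`(n) = 0.
Proof.
have dX : ('X^2 - 1 : {poly R})^`() = 2 * 'X.
  by rewrite derivB derivXn derivC subr0 expr1 mulr_natl.
have u1 : ('X^2 - 1) * u^`() = 2 * l%:R * 'X * u.
  rewrite /u; case: (l) => [|m]; first by rewrite !expr0 derivC; ring.
  rewrite deriv_exp dX /= [in RHS]exprS -[in LHS](mulr_natr _ m.+1).
  ring.
have dn (m : nat) : (m%:R : {poly R})^`() = 0 by rewrite -polyC_natr derivC.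
elim: n => [|n ih].
  move/(congr1 (@deriv R)): u1.
  rewrite !derivM dX derivX !dn !derivSn !derivn0.
  move=> /eqP; rewrite -subr_eq0 => /eqP <-; ring.
clear u1; clearbody u; move: ('X^2 - 1 : {poly R}) dX ih => q dq ih.
move/(congr1 (@deriv R)): ih; rewrite raddf0 => <-.
rewrite !(dn, dq, derivX, derivM, derivN, derivD) -!derivnS; ring.
Qed.

(** This is [rodrigues_ode] at order [l + k], in divergence form. *)
Lemma legendre_ode l k :
  (w ^+ k.+1 * (P l)^`(k.+1))^`() =
  - (((l%:R - k%:R) * (l + k).+1%:R) *: (w ^+ k * (P l)^`(k))).
Proof.
have dw : (1 - 'X^2 : {poly R})^`() = - (2 * 'X).
  by rewrite derivB derivXn derivC sub0r expr1 mulr_natl.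
have := rodrigues_ode l (l + k).
set u := (_ ^+ l); set c := ((2 ^ l * l`!)%:R : R)^-1 => /= ode.
have Pd m : (P l)^`(m) = c *: u^`(l + m).
  by rewrite /legendre derivnZ addnC /derivn iterD.
rewrite derivM deriv_exp dw /= !Pd !derivZ.
move: (u^`(l + k)) ode => v ode.
rewrite -!mul_polyC polyCM polyCB !polyC_natr -(mulr_natr _ k.+1) (exprS _ k).
apply/eqP; rewrite -subr_eq0; apply/eqP.
rewrite -[RHS](mulr0 (- c%:P * w ^+ k)) -ode; ring.
Qed.

(** The scalar product over the heights of the latitude factors of two
    harmonics of order [k], of degrees [l] and [l']. *)
Definition lpair l l' k : R := pint (w ^+ k * (P l)^`(k) * (P l')^`(k)).

Lemma lpairC l l' k : lpair l l' k = lpair l' l k.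
Proof. by rewrite /lpair mulrAC. Qed.

Lemma horner_w1 : w.[1] = 0.
Proof. by rewrite !(hornerD, hornerN, hornerXn, hornerC) expr1n subrr. Qed.

Lemma horner_wN1 : w.[-1] = 0.
Proof. by rewrite !(hornerD, hornerN, hornerXn, hornerC) sqrrN expr1n subrr. Qed.

(** Integrate by parts, the boundary terms being killed by the weight, and
    apply [legendre_ode]. *)
Lemma lpairS l l' k :
  lpair l l' k.+1 = (l%:R - k%:R) * (l + k).+1%:R * lpair l l' k.
Proof.
rewrite /lpair [_^`(k.+1) in X in _ * X]derivnS.
rewrite -[LHS]opprK -pint_by_parts; last 2 first.
- by rewrite !hornerM horner_exp horner_w1 expr0n !mul0r.
- by rewrite !hornerM horner_exp horner_wN1 expr0n !mul0r.
by rewrite legendre_ode mulNr linearN/= opprK -scalerAl linearZ.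
Qed.

(** At order 0, [lpairS] can be read from either side of the symmetric
    pairing: the eigenvalues [l (l + 1)] and [l' (l' + 1)] differ. *)
Lemma lpair_neq l l' k : l != l' -> lpair l l' k = 0.
Proof.
move=> ll'; elim: k => [|k ih]; last by rewrite lpairS ih mulr0.
have := lpairS l' l 0; rewrite lpairC lpairS [lpair l' l 0]lpairC.
move/eqP; rewrite -subr_eq0 -mulrBl mulf_eq0 => /orP[|/eqP//].
rewrite !subr0 !addn0 -!natrM subr_eq0 eqr_nat => /eqP h.
by exfalso; move/eqP: ll'; apply; nia.
Qed.

Lemma lpair_eq l k : (k <= l)%N ->
  lpair l l k = (l + k)`!%:R / (l - k)`!%:R * lpair l l 0.
Proof.
elim: k => [_|k ih kl].
  by rewrite addn0 subn0 divff ?mul1r// pnatr_eq0 -lt0n fact_gt0.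
rewrite lpairS ih ?(ltnW kl)// addnS factS -natrB ?(ltnW kl)//.
rewrite -(subnSK kl) factS !natrM.
have h : (l - k.+1)`!%:R != 0 :> R by rewrite pnatr_eq0 -lt0n fact_gt0.
have h2 : (l - k.+1).+1%:R != 0 :> R by rewrite pnatr_eq0.
move: _`!%:R h _.+1%:R h2 => b b0 c c0.
by field; rewrite b0 c0.
Qed.

(** Integrating the derivative of [X w^(n + 1)] gives a recurrence in [n]. *)
Lemma pint_wX n : pint (w ^+ n) = (2 ^ (2 * n).+1 * n`! ^ 2)%:R / (2 * n).+1`!%:R.
Proof.
elim: n => [|n ih]; first by rewrite expr0 pint1 muln0 /= !fact0 divr1.
have h : (2 * n + 3)%:R * pint (w ^+ n.+1) = (2 * n.+1)%:R * pint (w ^+ n).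
  have dw : (1 - 'X^2 : {poly R})^`() = - (2 * 'X).
    by rewrite derivB derivXn derivC sub0r expr1 mulr_natl.
  apply/eqP; rewrite -subr_eq0 -!linearZ/= -linearB/=.
  have -> : (2 * n + 3)%:R *: w ^+ n.+1 - (2 * n.+1)%:R *: w ^+ n =
      ('X * w ^+ n.+1)^`().
    rewrite derivM derivX deriv_exp dw /= -!mul_polyC !polyC_natr.
    by rewrite -[in RHS](mulr_natr _ n.+1) !(exprS _ n); ring.
  by rewrite pint_deriv !(hornerM, horner_exp) horner_w1 horner_wN1 expr0n !mulr0 subrr.
have n0 : (2 * n + 3)%:R != 0 :> R by rewrite pnatr_eq0 addn3.
apply: (mulfI n0); rewrite h ih.
have h1 : (2 * n).+1`!%:R != 0 :> R by rewrite pnatr_eq0 -lt0n fact_gt0.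
rewrite (_ : (2 * n.+1).+1 = (2 * n).+3)%N; last by lia.
rewrite (_ : 2 * n + 3 = (2 * n).+3)%N ?addn3//.
rewrite (factS (2 * n).+2) (factS (2 * n).+1) (factS n).
have e2 : (2 * n).+2%:R = 2 * n.+1%:R :> R by rewrite -natrM; congr _%:R; lia.
move: ((2 * n).+1`!) h1 (n`!) => G h1 c.
rewrite !(natrM, natrX) e2 !exprS !expr0.
move: (2 ^+ _) (G%:R) h1 (c%:R) => a b h1 {}c.
have h2 : n.+1%:R != 0 :> R by rewrite pnatr_eq0.
have h3 : (2 * n).+3%:R != 0 :> R by rewrite pnatr_eq0.
move: (_.+3%:R) h3 (n.+1%:R) h2 => d d0 e e0.
by field; rewrite h1 d0 e0.
Qed.

Lemma legendre_top l :
  (P l)^`(l) = ((2 * l)`!%:R / (2 ^ l * l`!)%:R)%:P.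
Proof.
rewrite /legendre derivnZ [X in _ *: X](_ : _ = (('X^2 - 1) ^+ l)^`(2 * l)); last first.
  by rewrite mul2n -addnn /derivn iterD.
have qE : 'X^2 - 1 = 'X^2 - 1%:P :> {poly R} by rewrite polyC1.
have mq : ('X^2 - 1 : {poly R}) ^+ l \is monic.
  by apply: monic_exp; rewrite qE monicXnsubC.
have su : size (('X^2 - 1 : {poly R}) ^+ l) = (2 * l).+1.
  have /monic_neq0 u0 := mq.
  by rewrite (polySpred u0) size_exp qE size_XnsubC.
move/monicP: mq; rewrite lead_coefE su /= => u1.
rewrite -mul_polyC [in RHS]mulrC polyCM; congr (_ * _).
apply/polyP => i; rewrite coef_derivn coefC; case: i => [|i] /=.
  by rewrite addn0 u1 ffactnn.
by rewrite nth_default ?mul0rn// su; lia.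
Qed.

Lemma coef_legendre_top l k : (k <= l)%N -> ((P l)^`(k))`_(l - k) != 0.
Proof.
move=> kl; have := legendre_top l.
rewrite -[X in (P l)^`(X)](subnK kl) addnC /derivn addnC iterD -/(derivn _ _) -/(derivn _ _).
move/(congr1 (fun p => p`_0)); rewrite coef_derivn addn0 coefC eqxx => h.
apply: contra_eq_neq h => ->; rewrite mul0rn eq_sym mulf_neq0 ?invr_eq0//.
all: by rewrite pnatr_eq0 ?muln_eq0 ?negb_or -?lt0n ?fact_gt0 ?expn_gt0.
Qed.

Lemma size_legendre_derivn l k : (size ((P l)^`(k)) <= (l - k).+1)%N.
Proof.
apply/leq_sizeP => j lj; rewrite /legendre derivnZ coefZ /derivn -iterD -/(derivn _ _).
have qE : 'X^2 - 1 = 'X^2 - 1%:P :> {poly R} by rewrite polyC1.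
rewrite coef_derivn nth_default ?mul0rn ?mulr0//.
apply: leq_trans (size_poly_exp_leq _ _) _; rewrite qE size_XnsubC//=; lia.
Qed.

(** The derivatives of order [k] of the Legendre polynomials of degrees
    [k, ..., L] have degrees [0, ..., L - k], so by elimination of leading
    coefficients they span all polynomials of degree at most [L - k]; this is
    what makes the spherical harmonics span all polynomials. *)
Lemma legendre_span L k (S : {poly R} -> Prop) : S 0 ->
  (forall c l q, (k <= l)%N -> (l <= L)%N -> S q -> S (c *: (P l)^`(k) + q)) ->
  forall q, (k + size q <= L.+1)%N -> S q.
Proof.
move=> S0 SD q; have [n] := ubnP (size q).
elim: n q => [//|n ih] q qn hq; have [->//|q0] := eqVneq q 0.
have sq := polySpred q0; set s := (size q).-1 in sq.
have hl : (k <= k + s)%N by rewrite leq_addr.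
set p := (P (k + s))^`(k); pose c := q`_s / p`_s.
have ps : p`_s != 0 by have := coef_legendre_top hl; rewrite addKn.
have -> : q = c *: p + (q - c *: p) by rewrite addrC subrK.
apply: SD => //; first by lia.
have sz : (size (q - c *: p)%R <= s)%N.
  apply/leq_sizeP => j; rewrite leq_eqVlt => /predU1P[<-|sj].
    by rewrite coefB coefZ divfK// subrr.
  rewrite coefB coefZ !nth_default ?mulr0 ?subrr// ?sq//.
  by apply: leq_trans (size_legendre_derivn _ _) _; rewrite addKn.
by apply: ih; lia.
Qed.

(** The [l]-th derivative of the Legendre polynomial is constant, so [lpair
    l l l] is explicit; [lpair_eq] relates it to order 0. *)
Lemma lpair00 l : lpair l l 0 = 2 / (2 * l + 1)%:R.
Proof.
have := lpair_eq (leqnn l).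
rewrite {1}/lpair !legendre_top -mulrA -polyCM mulrC mul_polyC linearZ/= pint_wX.
rewrite subnn fact0 divr1 addnn -mul2n addn1 factS.
have h1 : (2 * l)`!%:R != 0 :> R by rewrite pnatr_eq0 -lt0n fact_gt0.
have h2 : (2 * l).+1%:R != 0 :> R by rewrite pnatr_eq0.
have h3 : l`!%:R != 0 :> R by rewrite pnatr_eq0 -lt0n fact_gt0.
have h4 : 2 ^+ l != 0 :> R by rewrite expf_neq0// pnatr_eq0.
move: (lpair _ _ _) => J; rewrite !(natrM, natrX) exprS [(2 * l)%N]mulnC exprM.
rewrite [(2 * l)%N]mulnC in h1 h2.
move: (l * 2)%N h1 h2 => n h1 h2.
move: (n`!%:R) (n.+1%:R) (l`!%:R) (2 ^+ l) h1 h2 h3 h4 => a b c e h1 h2 h3 h4 hJ.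
by apply: (mulfI h1); rewrite -hJ; field; rewrite h1 h2 h3 h4.
Qed.

End legendre.

(** * Integrals and square-integrable functions *)

Section integrability.
Context d (X : measurableType d) (R : realType).
Variable mu : {measure set X -> \bar R}.
Implicit Types f g : X -> R.

Lemma dominated_integrable f g : measurable_fun setT f ->
  mu.-integrable setT (EFin \o g) -> (forall x, `|f x| <= g x) ->
  mu.-integrable setT (EFin \o f).
Proof.
move=> mf ig fg; apply: le_integrable ig => //; first exact/measurable_EFinP.
by move=> x _ /=; rewrite lee_fin (le_trans (fg x))// ler_norm.
Qed.

Lemma nonneg_integrable f : measurable_fun setT f -> (forall x, 0 <= f x) ->
  (\int[mu]_x (f x)%:E < +oo)%E -> mu.-integrable setT (EFin \o f).
Proof.
move=> mf f0 foo; apply/integrableP; split; first exact/measurable_EFinP.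
by under eq_integral do rewrite /= ger0_norm//.
Qed.

Lemma EFin_Rintegral f : mu.-integrable setT (EFin \o f) ->
  (\int[mu]_x f x)%:E = (\int[mu]_x (f x)%:E)%E.
Proof. by move=> fi; rewrite /Rintegral fineK//; exact: integrable_fin_num fi. Qed.

Lemma integrable_sumr (I : Type) (r : seq I) (F : I -> X -> R) :
  (forall i, mu.-integrable setT (EFin \o F i)) ->
  mu.-integrable setT (EFin \o (fun x => \sum_(i <- r) F i x)).
Proof.
move=> iF; elim: r => [|i r ih].
  apply: (eq_integrable _ (cst 0%E)) => //; last exact: integrable0.
  by move=> x _; rewrite /= big_nil.
have := integrableD measurableT (iF i) ih.
by apply: eq_integrable => // x _; rewrite /= big_cons.
Qed.

Lemma Rintegral_sum (I : Type) (r : seq I) (F : I -> X -> R) :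
  (forall i, mu.-integrable setT (EFin \o F i)) ->
  \int[mu]_x (\sum_(i <- r) F i x) = \sum_(i <- r) \int[mu]_x F i x.
Proof.
move=> iF; elim: r => [|i r ih].
  under eq_Rintegral do rewrite big_nil.
  by rewrite big_nil /Rintegral integral0.
under eq_Rintegral do rewrite big_cons.
by rewrite big_cons RintegralD// ?ih//; exact: integrable_sumr.
Qed.

End integrability.

Lemma Rintegral_dominated_cvg d (X : measurableType d) (R : realType)
    (mu : {measure set X -> \bar R}) (f_ : nat -> X -> R) (f g : X -> R) :
  (forall n, measurable_fun setT (f_ n)) -> mu.-integrable setT (EFin \o g) ->
  (forall n x, `|f_ n x| <= g x) -> (forall x, f_ n x @[n --> \oo] --> f x) ->
  \int[mu]_x f_ n x @[n --> \oo] --> \int[mu]_x f x.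
Proof.
move=> mf ig fg cf.
have mlim : measurable_fun setT f by apply: (measurable_fun_cvg mf) => x _; exact: cf.
have fle x : `|f x| <= g x.
  by apply: cvgr_to_le (cvg_norm (cf x)) _; exact: nearW.
have [|||||_ _ h] := @dominated_convergence _ _ _ mu setT measurableT
  (fun n => EFin \o f_ n) (EFin \o f) (EFin \o g).
- by move=> n; exact/measurable_EFinP.
- exact/measurable_EFinP.
- by apply: aeW => x _; apply/cvg_EFin; [exact: nearW|exact: cf].
- exact: ig.
- by apply: aeW => x n _ /=; rewrite lee_fin.
apply: fine_cvg; rewrite EFin_Rintegral; first exact: h.
exact: dominated_integrable mlim ig fle.
Qed.

Section square_integrable.
Context d (X : measurableType d) (R : realType).
Variable mu : {finite_measure set X -> \bar R}.
Implicit Types f g h : X -> R.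

Definition L2 f := measurable_fun setT f /\
  (\int[mu]_x ((f x) ^+ 2)%:E < +oo)%E.

Lemma L2_measurable f : L2 f -> measurable_fun setT f.
Proof. by case. Qed.

Lemma L2_sq_integrable f : L2 f -> mu.-integrable setT (EFin \o (fun x => f x ^+ 2)).
Proof.
move=> [mf f2]; apply: nonneg_integrable => // [|x]; last exact: sqr_ge0.
exact: measurable_funX.
Qed.

Lemma sq_integrable_L2 f : measurable_fun setT f ->
  mu.-integrable setT (EFin \o (fun x => f x ^+ 2)) -> L2 f.
Proof. by move=> mf fi; split => //; have /(_ measurableT) := integrable_lty _ fi. Qed.

Lemma L2_dominated f g : measurable_fun setT f -> L2 g ->
  (forall x, `|f x| <= g x) -> L2 f.
Proof.
move=> mf Lg fg; apply: sq_integrable_L2 => //.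
apply: (dominated_integrable _ (L2_sq_integrable Lg)) => [|x].
  exact: measurable_funX.
by rewrite normrX ler_sqr ?nnegrE// (le_trans _ (fg x)).
Qed.

Lemma bounded_integrable f (M : R) : measurable_fun setT f -> (forall x, `|f x| <= M) ->
  mu.-integrable setT (EFin \o f).
Proof.
move=> mf fM; apply: measurable_bounded_integrable => //.
  by apply: fin_num_fun_lty => //; exact: fin_num_measure.
exists M; split; first exact: num_real.
by move=> y My x _ /=; apply: le_trans (fM x) _; exact: ltW.
Qed.

Lemma bounded_L2 f (M : R) : measurable_fun setT f -> (forall x, `|f x| <= M) -> L2 f.
Proof.
move=> mf fM; apply: sq_integrable_L2 => //.
apply: (@bounded_integrable _ (M ^+ 2)) => [|x]; first exact: measurable_funX.
by rewrite normrX ler_pXn2r ?nnegrE// (le_trans _ (fM x)).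
Qed.

Lemma L2M_integrable f g : L2 f -> L2 g ->
  mu.-integrable setT (EFin \o (fun x => f x * g x)).
Proof.
move=> Lf Lg; have if' := L2_sq_integrable Lf; have ig := L2_sq_integrable Lg.
apply: (@dominated_integrable _ _ _ _ _ (fun x => f x ^+ 2 + g x ^+ 2)).
- by apply: measurable_funM; exact: L2_measurable.
- exact: (integrableD _ if' ig).
move=> x; rewrite normrM.
rewrite -[f x ^+ 2]real_normK ?num_real// -[g x ^+ 2]real_normK ?num_real//.
have := sqr_ge0 (`|f x| - `|g x|); have := sqr_ge0 (`|f x|); have := sqr_ge0 (`|g x|).
nra.
Qed.

Lemma L2_cst (c : R) : L2 (fun=> c).
Proof. by apply: (@bounded_L2 _ `|c|) => //; exact: measurable_cst. Qed.

Lemma L2_integrable f : L2 f -> mu.-integrable setT (EFin \o f).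
Proof.
move=> Lf; have := L2M_integrable Lf (L2_cst 1).
by apply: eq_integrable => // x _ /=; rewrite mulr1.
Qed.

Lemma L2D f g : L2 f -> L2 g -> L2 (fun x => f x + g x).
Proof.
move=> Lf Lg; apply: sq_integrable_L2.
  by apply: measurable_funD; exact: L2_measurable.
have i := integrableD measurableT (L2_sq_integrable Lf) (L2_sq_integrable Lg).
apply: (@dominated_integrable _ _ _ _ _ (fun x => 2 * (f x ^+ 2 + g x ^+ 2))).
- by apply: measurable_funX; apply: measurable_funD; exact: L2_measurable.
- exact: (integrableZl _ 2 i).
- move=> x; rewrite ger0_norm ?sqr_ge0//.
  by have := sqr_ge0 (f x - g x); nra.
Qed.

Lemma L2Z c f : L2 f -> L2 (fun x => c * f x).
Proof.
move=> Lf; apply: sq_integrable_L2.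
  by apply: measurable_funM => //; exact: L2_measurable.
have := integrableZl measurableT (c ^+ 2) (L2_sq_integrable Lf).
by apply: eq_integrable => // x _ /=; rewrite exprMn.
Qed.

Lemma L2_Rintegral_linear c f g : L2 f -> L2 g ->
  \int[mu]_x (c * f x + g x) = c * \int[mu]_x f x + \int[mu]_x g x.
Proof.
move=> Lf Lg; have if' := L2_integrable Lf; have ig := L2_integrable Lg.
by rewrite RintegralD// ?RintegralZl//; apply: L2_integrable; exact: L2Z.
Qed.

Lemma L2B f g : L2 f -> L2 g -> L2 (fun x => f x - g x).
Proof.
move=> Lf Lg; have := L2D Lf (L2Z (-1) Lg).
by congr L2; apply/funext => x; rewrite mulN1r.
Qed.

Lemma L2_sum (I : Type) (r : seq I) (F : I -> X -> R) : (forall i, L2 (F i)) ->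
  L2 (fun x => \sum_(i <- r) F i x).
Proof.
move=> LF; elim: r => [|i r ih].
  by under eq_fun do rewrite big_nil; exact: L2_cst.
by under eq_fun do rewrite big_cons; exact: L2D.
Qed.

Definition ip f g : R := \int[mu]_x (f x * g x).

Lemma ipC f g : ip f g = ip g f.
Proof. by apply: eq_Rintegral => x _; rewrite mulrC. Qed.

Lemma ip0l f : ip (fun=> 0) f = 0.
Proof.
rewrite /ip; under eq_Rintegral do rewrite mul0r.
by rewrite /Rintegral integral0.
Qed.

Lemma ipDl f g h : L2 f -> L2 g -> L2 h ->
  ip (fun x => f x + g x) h = ip f h + ip g h.
Proof.
move=> Lf Lg Lh; rewrite /ip -RintegralD//; try exact: L2M_integrable.
by apply: eq_Rintegral => x _; rewrite mulrDl.
Qed.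

Lemma ipZl c f g : L2 f -> L2 g -> ip (fun x => c * f x) g = c * ip f g.
Proof.
move=> Lf Lg; rewrite /ip -RintegralZl//; try exact: L2M_integrable.
by apply: eq_Rintegral => x _; rewrite mulrA.
Qed.

Lemma ipBl f g h : L2 f -> L2 g -> L2 h ->
  ip (fun x => f x - g x) h = ip f h - ip g h.
Proof.
move=> Lf Lg Lh; rewrite /ip -RintegralB//; try exact: L2M_integrable.
by apply: eq_Rintegral => x _; rewrite mulrBl.
Qed.

Lemma ip_suml (I : Type) (r : seq I) (F : I -> X -> R) g :
  (forall i, L2 (F i)) -> L2 g ->
  ip (fun x => \sum_(i <- r) F i x) g = \sum_(i <- r) ip (F i) g.
Proof.
move=> LF Lg; rewrite /ip -Rintegral_sum; last by move=> i; exact: L2M_integrable.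
by apply: eq_Rintegral => x _; rewrite mulr_suml.
Qed.

Lemma ipBB f g : L2 f -> L2 g ->
  ip (fun x => f x - g x) (fun x => f x - g x) = ip f f - 2 * ip f g + ip g g.
Proof.
move=> Lf Lg; have Lfg := L2B Lf Lg.
by rewrite ipBl// [ip f _]ipC [ip g _]ipC !ipBl// [ip g f]ipC; ring.
Qed.

Lemma ip_ge0 f : 0 <= ip f f.
Proof. by apply: Rintegral_ge0 => x _; rewrite -expr2 sqr_ge0. Qed.

Lemma ip_EFin f g : L2 f -> L2 g -> (ip f g)%:E = (\int[mu]_x (f x * g x)%:E)%E.
Proof. by move=> Lf Lg; apply: EFin_Rintegral; exact: L2M_integrable. Qed.

Lemma ipDD_le f g : L2 f -> L2 g ->
  ip (fun x => f x + g x) (fun x => f x + g x) <= 2 * ip f f + 2 * ip g g.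
Proof.
move=> Lf Lg; have Lfg := L2D Lf Lg; have Lfg' := L2B Lf Lg.
have := ip_ge0 (fun x => f x - g x); rewrite ipBB//.
by rewrite ipDl// ![ip _ (fun x => f x + g x)]ipC !ipDl// [ip g f]ipC; lra.
Qed.

Lemma L2_normr (f : X -> R) : L2 f -> L2 (fun x => `|f x|).
Proof.
move=> [mf foo]; split; first exact: measurableT_comp.
rewrite (eq_integral (fun x => (f x ^+ 2)%:E))// => x _.
by rewrite real_normK ?num_real.
Qed.

Lemma ip_normr (f : X -> R) : ip (fun x => `|f x|) (fun x => `|f x|) = ip f f.
Proof. by apply: eq_Rintegral => x _; rewrite -!expr2 real_normK ?num_real. Qed.

Lemma ip_schwarz (f g : X -> R) : L2 f -> L2 g ->
  ip f g ^+ 2 <= ip f f * ip g g.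
Proof.
move=> Lf Lg.
have quad t : 0 <= ip f f - 2 * (t * ip f g) + t ^+ 2 * ip g g.
  have Ltg := L2Z t Lg; have := ip_ge0 (fun x => f x - t * g x).
  rewrite ipBB// (ipC f) !ipZl// (ipC g (fun x => t * g x)) ipZl// (ipC g f).
  by rewrite expr2 -(mulrA t t).
have fg0 := ip_ge0 g; have ff0 := ip_ge0 f.
have [g0|g0] := eqVneq (ip g g) 0.
  have [->|fg] := eqVneq (ip f g) 0; first by rewrite expr0n mulr_ge0.
  have := quad ((ip f f + 1) / (2 * ip f g)); rewrite g0 mulr0 addr0.
  have -> : 2 * ((ip f f + 1) / (2 * ip f g) * ip f g) = ip f f + 1 by field.
  by lra.
have gp : 0 < ip g g by rewrite lt_neqAle eq_sym g0.
have := quad (ip f g / ip g g).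
have -> : ip f f - 2 * (ip f g / ip g g * ip f g) +
  (ip f g / ip g g) ^+ 2 * ip g g =
  (ip f f * ip g g - ip f g ^+ 2) / ip g g by field.
by rewrite pmulr_lge0 ?invr_gt0// subr_ge0.
Qed.

Lemma ip_sum_sum (I J : Type) (r : seq I) (s : seq J) (F : I -> X -> R) (G : J -> X -> R) :
  (forall i, L2 (F i)) -> (forall j, L2 (G j)) ->
  ip (fun x => \sum_(i <- r) F i x) (fun x => \sum_(j <- s) G j x) =
  \sum_(i <- r) \sum_(j <- s) ip (F i) (G j).
Proof.
move=> LF LG; rewrite ip_suml//; last exact: L2_sum.
apply: eq_bigr => i _; rewrite ipC ip_suml//.
by apply: eq_bigr => j _; rewrite ipC.
Qed.

(** Pythagoras: the last two hypotheses make [t - \sum_i F i] orthogonal to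
    every [F i]. *)
Lemma ip_residual n (F : 'I_n -> X -> R) t : L2 t -> (forall i, L2 (F i)) ->
  (forall i j, i != j -> ip (F i) (F j) = 0) ->
  (forall i, ip (F i) t = ip (F i) (F i)) ->
  ip (fun x => t x - \sum_i F i x) (fun x => t x - \sum_i F i x) =
  ip t t - \sum_i ip (F i) (F i).
Proof.
move=> Lt LF Fo Ft; have LS : L2 (fun x => \sum_i F i x) by exact: L2_sum.
rewrite ipBB// ip_sum_sum// ipC ip_suml//.
have -> : \sum_i \sum_j ip (F i) (F j) = \sum_i ip (F i) (F i).
  apply: eq_bigr => i _; rewrite (bigD1 i)//= big1 ?addr0// => j ji.
  by rewrite Fo// eq_sym.
by rewrite (eq_bigr (fun i => ip (F i) (F i)))//; ring.
Qed.

End square_integrable.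

(** * Integration in spherical coordinates *)

Section image_of_density.
Local Open Scope ereal_scope.
Context d1 d2 (X : measurableType d1) (Y : measurableType d2) (R : realType).
Variables (mu : {measure set X -> \bar R}) (nu : {measure set Y -> \bar R}).
Variables (phi : X -> Y) (D : set X) (g : X -> R).
Hypothesis mphi : measurable_fun setT phi.
Hypothesis mD : measurable D.
Hypothesis mg : measurable_fun setT g.
Hypothesis g0 : forall x, D x -> (0 <= g x)%R.
Hypothesis nuE : forall A, measurable A ->
  nu A = \int[mu]_(x in D `&` phi @^-1` A) (g x)%:E.

Import HBNNSimple.

(** Change of variables for the image by [phi] of the measure of density
    [g]: it holds for simple functions by the hypothesis on [nu], and passes
    to monotone limits. *)
Lemma ge0_integral_density_image (f : Y -> \bar R) :
  measurable_fun setT f -> (forall y, 0 <= f y) ->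
  \int[nu]_y f y = \int[mu]_(x in D) (f (phi x) * (g x)%:E).
Proof.
move=> mf f0; pose f_ := nnsfun_approx measurableT mf.
transitivity (limn (fun n => \int[nu]_x (f_ n x)%:E)).
  rewrite -monotone_convergence//.
  - by apply: eq_integral => x _; apply/esym/cvg_lim => //; apply: cvg_nnsfun_approx.
  - by move=> n; exact/measurable_EFinP/measurable_funTS.
  - by move=> *; rewrite lee_fin.
  - by move=> x _ m n mn; rewrite lee_fin; exact/lefP/nd_nnsfun_approx.
have mgD : measurable_fun D (EFin \o g).
  by apply/measurable_EFinP; exact: measurable_funTS.
have mfphi n : measurable_fun D (fun x => (f_ n (phi x))%:E).
  apply: measurable_funTS; apply/measurable_EFinP.
  exact: measurableT_comp.
transitivity (limn (fun n => \int[mu]_(x in D) ((f_ n (phi x))%:E * (g x)%:E))); last first.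
  rewrite -monotone_convergence//.
  - apply: eq_integral => x _; apply/cvg_lim => //.
    by apply: cvgeZr => //; apply: cvg_nnsfun_approx.
  - by move=> n; apply: emeasurable_funM => //.
  - by move=> n x Dx; rewrite -EFinM lee_fin mulr_ge0// g0.
  - move=> x Dx m n mn; rewrite -!EFinM lee_fin ler_wpM2r ?g0//.
    exact/lefP/nd_nnsfun_approx.
congr (limn _); apply/funext => n; set h := f_ n.
under eq_integral do rewrite fimfunE// -fsumEFin//.
rewrite ge0_integral_fsum//; last 2 first.
- by move=> r; exact/measurable_EFinP/measurableT_comp.
- by move=> r x _; rewrite nnfun_muleindic_ge0.
under [RHS]eq_integral.
  move=> x xD; rewrite fimfunE -fsumEFin// ge0_mule_fsuml; last first.
    by move=> r; rewrite nnfun_muleindic_ge0.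
  over.
have mh r : measurable_fun D (fun x => (r * \1_(h @^-1` [set r]) (phi x))%:E).
  apply: measurable_funTS; apply/measurable_EFinP.
  by apply: measurable_funM => //; apply: measurableT_comp.
rewrite ge0_integral_fsum//; last 2 first.
- by move=> r; apply: emeasurable_funM.
- by move=> r x Dx; rewrite mule_ge0// ?lee_fin ?g0// -lee_fin EFinM nnfun_muleindic_ge0.
apply: eq_fsbigr => r /[!inE] -[y _ hy].
have r0 : (0 <= r)%R by rewrite -hy.
rewrite integralZl_indic_nnsfun// integral_indic// setIT nuE//.
rewrite integral_mkcondr -ge0_integralZl_EFin//; last 2 first.
- by move=> x Dx; rewrite patchE; case: ifP => // _; rewrite lee_fin g0.
- apply/measurable_restrict => //; last first.
    by apply: measurable_funS mgD => //; exact: subIsetl.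
  by rewrite -[X in measurable X]setTI; exact: mphi.
apply: eq_integral => x _; rewrite patchE indicE.
rewrite (_ : (x \in phi @^-1` (h @^-1` [set r])) = (phi x \in h @^-1` [set r])).
  by case: ifP => _; rewrite ?mulr1 ?mulr0 ?mul0e ?mule0.
by apply/idP/idP; rewrite !inE.
Qed.

End image_of_density.

Section separated_product.
Local Open Scope ereal_scope.
Context d1 d2 (X : measurableType d1) (Y : measurableType d2) (R : realType).
Variables (m1 : {sigma_finite_measure set X -> \bar R}).
Variables (m2 : {sigma_finite_measure set Y -> \bar R}).

Lemma Rintegral_prod_sep (u : X -> R) (v : Y -> R) :
  m1.-integrable setT (EFin \o u) -> m2.-integrable setT (EFin \o v) ->
  (\int[m1 \x m2]_p (u p.1 * v p.2) = (\int[m1]_x u x) * (\int[m2]_y v y))%R.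
Proof.
move=> iu iv.
have /integrableP[/measurable_EFinP mu uoo] := iu.
have /integrableP[/measurable_EFinP mv voo] := iv.
have mf : measurable_fun setT (fun p : X * Y => (u p.1 * v p.2)%:E).
  by apply/measurable_EFinP; apply: measurable_funM; apply: measurableT_comp.
have fi : (m1 \x m2).-integrable setT (fun p : X * Y => (u p.1 * v p.2)%:E).
  apply/integrable12ltyP => //=.
  under eq_integral.
    move=> x _; under eq_integral do rewrite normrM EFinM.
    rewrite ge0_integralZl_EFin//; last first.
      by apply/measurable_EFinP; exact: measurableT_comp.
    over.
  rewrite ge0_integralZr//; last 2 first.
  - by apply/measurable_EFinP; exact: measurableT_comp.
  - by apply: integral_ge0 => y _; rewrite lee_fin.
  by rewrite lte_mul_pinfty// ?integral_ge0//= ge0_fin_numE ?integral_ge0//.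
apply: EFin_inj; rewrite EFin_Rintegral// -integral12_prod_meas1// /fubini_F/=.
under eq_integral.
  move=> x _; under eq_integral do rewrite EFinM.
  rewrite integralZl//; over.
under eq_integral do rewrite -(EFin_Rintegral iv).
by rewrite integralZr// EFinM (EFin_Rintegral iu).
Qed.

End separated_product.

Section surface_integral.
Context (R : realType).
Local Notation leb := (@lebesgue_measure R).

Lemma surface_integralE (f : sphere R -> R) : measurable_fun setT f ->
  (\int[surface R]_x (f x)%:E =
   \int[leb \x leb]_(p in @spherical_domain R) (f (spherical_point p) * sin p.1)%:E)%E.
Proof.
move=> mf; have mE : measurable_fun setT (EFin \o f) by exact/measurable_EFinP.
have mD : measurable (@spherical_domain R) by exact: measurableX.
have s0 (p : R * R) : spherical_domain p -> 0 <= sin p.1.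
  by move=> [/= p1 _]; exact: sin_ge0_pi.
have ms : measurable_fun setT (fun p : R * R => sin p.1).
  exact: measurableT_comp (continuous_measurable_fun (@continuous_sin R))
    (@measurable_fst _ _ R R).
have h := @ge0_integral_density_image _ _ _ _ _ (leb \x leb)%E (surface R)
   (@spherical_point R) _ _ (@measurable_spherical_point R) mD ms s0
   (fun _ _ => erefl).
rewrite [LHS]integralE [RHS]integralE !h//; last 2 first.
- exact: measurable_funeneg.
- exact: measurable_funepos.
congr (_ - _)%E; apply: eq_integral => p /[!inE] Dp.
- by rewrite !funepos.unlock/= -!EFin_max -EFinM maxr_pMl ?s0// mul0r.
- by rewrite !funeneg.unlock/= -!EFin_max -EFinM maxr_pMl ?s0// mul0r mulNr.
Qed.

Lemma surface_integral_sep (f : sphere R -> R) (g h : R -> R) :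
  measurable_fun setT f -> continuous g -> continuous h ->
  (forall p, f (spherical_point p) = g p.1 * h p.2) ->
  \int[surface R]_x f x =
    (\int[leb]_(t in `[0, pi]) (g t * sin t)) * (\int[leb]_(s in `[0, 2 * pi]) h s).
Proof.
move=> mf cg ch fE.
have icont (k : R -> R) (a b : R) : continuous k ->
    leb.-integrable setT (EFin \o (k \_ `[a, b])).
  move=> ck; rewrite -restrict_EFin.
  have : leb.-integrable `[a, b] (EFin \o k).
    apply: continuous_compact_integrable; first exact: segment_compact.
    exact: continuous_subspaceT.
  by have [+ _] := integrable_mkcond (mu := leb) (EFin \o k) (measurable_itv `[a, b]); exact.
pose u := (fun t => g t * sin t) \_ `[0, pi]; pose v := h \_ `[0, 2 * pi].
transitivity (\int[(leb \x leb)%E]_p (u p.1 * v p.2)).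
  rewrite {1}/Rintegral surface_integralE// integral_mkcond.
  congr fine; apply: eq_integral => p _.
  rewrite /u /v !patchE /spherical_domain fE in_setX.
  have p0 : point = 0 :> R by [].
  case: (p.1 \in _); case: (p.2 \in _) => /=; rewrite ?p0 ?mulr0 ?mul0r//.
  by rewrite mulrAC.
rewrite Rintegral_prod_sep ?icont//; first by rewrite -!Rintegral_mkcond.
by move=> x; apply: cvgM; [exact: cg|exact: continuous_sin].
Qed.

End surface_integral.

Section ftc_period.
Context (R : realType).
Local Notation leb := (@lebesgue_measure R).
Implicit Types (f F : R -> R) (a b : R).

Lemma derivable_continuousT f : (forall x : R, derivable f x 1) -> continuous f.
Proof. by move=> df x; apply/differentiable_continuous/derivable1_diffP. Qed.

Lemma continuous_itv_integrable f a b : continuous f ->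
  leb.-integrable `[a, b] (EFin \o f).
Proof.
move=> cf; apply: continuous_compact_integrable; first exact: segment_compact.
exact: continuous_subspaceT.
Qed.

Lemma Rintegral_derive F f a b : a < b -> continuous f ->
  (forall x : R, is_derive x (1 : R) F (f x)) ->
  \int[leb]_(x in `[a, b]) f x = F b - F a.
Proof.
move=> ab cf dF; rewrite /Rintegral (@continuous_FTC2 _ _ F)//.
- exact: continuous_subspaceT.
- have cF : continuous F.
    by apply: derivable_continuousT => x; have [] := dF x.
  split.
  + by move=> x _; have [] := dF x.
  + exact/cvg_at_right_filter/cF.
  + exact/cvg_at_left_filter/cF.
- by move=> x _; rewrite derive1E; have [_ ->] := dF x.
Qed.

(** The latitude integral of a polynomial in the height [cos t], by the
    substitution hidden in [sin t dt]. *)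
Lemma pint_cos (q : {poly R}) :
  \int[leb]_(t in `[0, pi]) (q.[cos t] * sin t) = pint q.
Proof.
have dF (x : R) : is_derive x (1 : R) (fun t : R => - (prim q).[cos t]) (q.[cos x] * sin x).
  have := is_deriveN (is_derive1_comp (is_derive_poly (prim q) (cos x)) (is_derive_cos x)).
  by move=> h; apply: (is_derive_eq h); rewrite deriv_prim mulrN opprK.
rewrite (Rintegral_derive (pi_gt0 R) _ dF).
  by rewrite cospi cos0 /pint opprK addrC.
apply: derivable_continuousT => x; apply: derivableM => //.
Qed.

Lemma twopi_gt0 : 0 < 2 * pi :> R.
Proof. by rewrite mulr_gt0// pi_gt0. Qed.

Lemma sin_int_twopi (z : int) : sin (z%:~R * (2 * pi)) = 0 :> R.
Proof.
have h (n : nat) : sin (n%:R * (2 * pi)) = 0 :> R.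
  by rewrite mulr_natl -[_ *+ n]add0r mulr_natl periodicn ?sin0//; exact: sinD2pi.
case: z => n; first exact: h.
by rewrite NegzE mulrNz mulNr sinN h oppr0.
Qed.

Lemma cos_int_twopi (z : int) : cos (z%:~R * (2 * pi)) = 1 :> R.
Proof.
have h (n : nat) : cos (n%:R * (2 * pi)) = 1 :> R.
  by rewrite mulr_natl -[_ *+ n]add0r mulr_natl periodicn ?cos0//; exact: cosD2pi.
case: z => n; first exact: h.
by rewrite NegzE mulrNz mulNr cosN h.
Qed.

Lemma is_derive_linear (c x : R) : is_derive x (1 : R) (fun t : R => c * t) c.
Proof.
have := is_deriveZ c (is_derive_id x (1 : R)).
by move=> h; apply: (is_derive_eq h); rewrite [LHS]mulr1.
Qed.

Lemma continuous_trig (c : R) :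
  continuous (fun t : R => cos (c * t)) /\ continuous (fun t : R => sin (c * t)).
Proof.
split; apply: derivable_continuousT => x.
  by have [] := is_derive1_comp (is_derive_cos (c * x)) (is_derive_linear c x).
by have [] := is_derive1_comp (is_derive_sin (c * x)) (is_derive_linear c x).
Qed.

Lemma int_cos (z : int) :
  \int[leb]_(t in `[0, 2 * pi]) cos (z%:~R * t) = if z == 0 then 2 * pi else 0.
Proof.
case: eqVneq => [->|z0].
  under eq_Rintegral do rewrite mul0r cos0.
  have ci : continuous (cst 1 : R -> R) by move=> x; exact: cvg_cst.
  by rewrite (Rintegral_derive twopi_gt0 ci (fun x => is_derive_id x 1)) subr0.
have zr : z%:~R != 0 :> R by rewrite intr_eq0.
have dF (x : R) : is_derive x (1 : R) (fun t : R => z%:~R^-1 * sin (z%:~R * t)) (cos (z%:~R * x)).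
  have := is_deriveZ (z%:~R^-1) (is_derive1_comp (is_derive_sin (z%:~R * x))
    (is_derive_linear z%:~R x)).
  by move=> h; apply: (is_derive_eq h); rewrite [LHS]mulrCA mulVf ?mulr1.
rewrite (Rintegral_derive twopi_gt0 (continuous_trig _).1 dF).
by rewrite sin_int_twopi !mulr0 sin0 mulr0 subrr.
Qed.

Lemma int_sin (z : int) : \int[leb]_(t in `[0, 2 * pi]) sin (z%:~R * t) = 0.
Proof.
have [->|z0] := eqVneq z 0.
  under eq_Rintegral do rewrite mul0r sin0.
  by rewrite Rintegral_cst// mul0r.
have zr : z%:~R != 0 :> R by rewrite intr_eq0.
have dF (x : R) : is_derive x (1 : R) (fun t : R => - z%:~R^-1 * cos (z%:~R * t)) (sin (z%:~R * x)).
  have := is_deriveZ (- z%:~R^-1) (is_derive1_comp (is_derive_cos (z%:~R * x))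
    (is_derive_linear z%:~R x)).
  move=> h; apply: (is_derive_eq h); rewrite [LHS](_ : _ = z%:~R^-1 * z%:~R * sin (z%:~R * x)).
    by rewrite mulVf// mul1r.
  by rewrite [LHS]/GRing.scale/=; ring.
rewrite (Rintegral_derive twopi_gt0 (continuous_trig _).2 dF).
by rewrite cos_int_twopi !mulr0 cos0 subrr.
Qed.

(** The longitude factor of the harmonic of order [m]. *)
Definition trig (m : int) (t : R) : R :=
  if 0 <= m then cos (`|m|%N%:R * t) else sin (`|m|%N%:R * t).

Lemma continuous_trig_fun m : continuous (trig m).
Proof.
rewrite /trig; case: (0 <= m); [exact: (continuous_trig _).1|exact: (continuous_trig _).2].
Qed.

(** Product-to-sum formulas reduce this to [int_cos] and [int_sin] at the
    frequencies [k - j] and [k + j]. *)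
Lemma int_trigM m m' :
  \int[leb]_(t in `[0, 2 * pi]) (trig m t * trig m' t) =
  if m == m' then (if m == 0 then 2 * pi else pi) else 0.
Proof.
pose k : int := `|m|%N; pose j : int := `|m'|%N.
have ci z : leb.-integrable `[0, 2 * pi] (EFin \o (fun t : R => cos (z%:~R * t))).
  exact/continuous_itv_integrable/(continuous_trig _).1.
have si z : leb.-integrable `[0, 2 * pi] (EFin \o (fun t : R => sin (z%:~R * t))).
  exact/continuous_itv_integrable/(continuous_trig _).2.
have cc : \int[leb]_(t in `[0, 2 * pi]) (cos (k%:~R * t) * cos (j%:~R * t)) =
    2^-1 * ((if k - j == 0 then 2 * pi else 0) + (if k + j == 0 then 2 * pi else 0)).
  rewrite -!int_cos -RintegralD// -RintegralZl//; last first.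
    by apply: continuous_itv_integrable => x; apply: cvgD; apply: (continuous_trig _).1.
  apply: eq_Rintegral => t _.
  by rewrite rmorphB rmorphD/= mulrBl mulrDl cosB cosD; field.
have ss : \int[leb]_(t in `[0, 2 * pi]) (sin (k%:~R * t) * sin (j%:~R * t)) =
    2^-1 * ((if k - j == 0 then 2 * pi else 0) - (if k + j == 0 then 2 * pi else 0)).
  rewrite -!int_cos -RintegralB// -RintegralZl//; last first.
    by apply: continuous_itv_integrable => x; apply: cvgB; apply: (continuous_trig _).1.
  apply: eq_Rintegral => t _.
  by rewrite rmorphB rmorphD/= mulrBl mulrDl cosB cosD; field.
have sc : \int[leb]_(t in `[0, 2 * pi]) (sin (k%:~R * t) * cos (j%:~R * t)) = 0.
  transitivity (2^-1 * (\int[leb]_(t in `[0, 2 * pi]) sin ((k - j)%:~R * t) +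
    \int[leb]_(t in `[0, 2 * pi]) sin ((k + j)%:~R * t))); last first.
    by rewrite !int_sin addr0 mulr0.
  rewrite -RintegralD// -RintegralZl//; last first.
    by apply: continuous_itv_integrable => x; apply: cvgD; apply: (continuous_trig _).2.
  apply: eq_Rintegral => t _.
  by rewrite rmorphB rmorphD/= mulrBl mulrDl sinB sinD; field.
have cs : \int[leb]_(t in `[0, 2 * pi]) (cos (k%:~R * t) * sin (j%:~R * t)) = 0.
  transitivity (2^-1 * (\int[leb]_(t in `[0, 2 * pi]) sin ((k + j)%:~R * t) -
    \int[leb]_(t in `[0, 2 * pi]) sin ((k - j)%:~R * t))); last first.
    by rewrite !int_sin subr0 mulr0.
  rewrite -RintegralB// -RintegralZl//; last first.
    by apply: continuous_itv_integrable => x; apply: cvgB; apply: (continuous_trig _).2.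
  apply: eq_Rintegral => t _.
  by rewrite rmorphB rmorphD/= mulrBl mulrDl sinB sinD; field.
rewrite /trig -/k -/j.
have kp : 0 <= k by [].
have jp : 0 <= j by [].
have hk : (0 <= m) -> m = k by move=> ?; rewrite /k; lia.
have hk' : ~~ (0 <= m) -> m = - k /\ k <> 0 by move=> ?; rewrite /k; lia.
have hj : (0 <= m') -> m' = j by move=> ?; rewrite /j; lia.
have hj' : ~~ (0 <= m') -> m' = - j /\ j <> 0 by move=> ?; rewrite /j; lia.
have [m0|m0] := boolP (0 <= m); have [m'0|m'0] := boolP (0 <= m').
- rewrite cc (hk m0) (hj m'0) subr_eq0; case: eqVneq => [kj|kj]; rewrite ?kj; case: eqVneq => h.
  + by rewrite (_ : j == 0) //; [field|lia].
  + by rewrite (_ : (j == 0) = false) //; [field|lia].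
  + exfalso; lia.
  + by rewrite addr0 mulr0.
- rewrite cs; case: eqVneq => // h; exfalso; move: m'0; rewrite -h m0; by [].
- rewrite sc; case: eqVneq => // h; exfalso; move: m0; rewrite h m'0; by [].
- have [mk k0] := hk' m0; have [mj j0] := hj' m'0.
  rewrite ss mk mj eqr_opp subr_eq0; case: eqVneq => [kj|kj]; rewrite ?kj; case: eqVneq => h.
  + exfalso; lia.
  + by rewrite (_ : (- j == 0) = false) //; [field|lia].
  + exfalso; lia.
  + by rewrite subr0 mulr0.
Qed.

End ftc_period.

(** * Polynomials on the sphere *)

Section linear_span.
Context (R : realType) (X : Type).
Implicit Types (G : (X -> R) -> Prop) (f g h : X -> R).

(** Span as an inductive predicate, so that linear statements can be proved
    by induction on a combination. *)
Inductive lspan G : (X -> R) -> Prop :=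
| lspan0 : lspan G (fun=> 0)
| lspanD c g f : G g -> lspan G f -> lspan G (fun x => c * g x + f x).

Lemma lspan_ext G f g : f =1 g -> lspan G f -> lspan G g.
Proof. by move=> /funext ->. Qed.

Lemma lspan_add G f g : lspan G f -> lspan G g -> lspan G (fun x => f x + g x).
Proof.
move=> Gf Gg; elim: Gf => [|c h f' Gh _ ih]; first by apply: lspan_ext Gg => x; rewrite add0r.
by apply: lspan_ext (lspanD c Gh ih) => x; rewrite addrA.
Qed.

Lemma lspan_gen G g : G g -> lspan G g.
Proof. by move=> Gg; apply: lspan_ext (lspanD 1 Gg (lspan0 G)) => x; rewrite mul1r addr0. Qed.

Lemma lspan_scale G c f : lspan G f -> lspan G (fun x => c * f x).
Proof.
elim=> [|b h f' Gh _ ih]; first by apply: lspan_ext (lspan0 G) => x; rewrite mulr0.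
by apply: lspan_ext (lspanD (c * b) Gh ih) => x; rewrite mulrDr mulrA.
Qed.

Lemma lspan_sub G f g : lspan G f -> lspan G g -> lspan G (fun x => f x - g x).
Proof.
move=> Gf Gg; apply: lspan_ext (lspan_add Gf (lspan_scale (-1) Gg)) => x.
by rewrite mulN1r.
Qed.

Lemma lspan_sum G (I : Type) (r : seq I) (F : I -> X -> R) :
  (forall i, lspan G (F i)) -> lspan G (fun x => \sum_(i <- r) F i x).
Proof.
move=> GF; elim: r => [|i r ih].
  by apply: lspan_ext (lspan0 G) => x; rewrite big_nil.
by apply: lspan_ext (lspan_add (GF i) ih) => x; rewrite big_cons.
Qed.

Lemma lspan_mono G G' f : (forall g, G g -> lspan G' g) -> lspan G f -> lspan G' f.
Proof.
move=> GG'; elim=> [|c h f' Gh _ ih]; first exact: lspan0.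
exact: lspan_add (lspan_scale _ (GG' _ Gh)) ih.
Qed.

Lemma lspan_mul G G' K f f' :
  (forall g g', G g -> G' g' -> lspan K (fun x => g x * g' x)) ->
  lspan G f -> lspan G' f' -> lspan K (fun x => f x * f' x).
Proof.
move=> GK Gf Gf'; elim: Gf => [|c g h Gg _ ih].
  by apply: lspan_ext (lspan0 K) => x; rewrite mul0r.
have : lspan K (fun x => g x * f' x).
  elim: Gf' => [|b g' h' Gg' _ ih'].
    by apply: lspan_ext (lspan0 K) => x; rewrite mulr0.
  apply: lspan_ext (lspan_add (lspan_scale b (GK _ _ Gg Gg')) ih') => x.
  by rewrite mulrDr mulrCA.
move=> /(lspan_scale c) /lspan_add /(_ ih).
by apply: lspan_ext => x; rewrite mulrDl mulrA.
Qed.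

End linear_span.

Section polynomials_on_sphere.
Context (R : realType).
Implicit Types (x y : sphere R) (f g : sphere R -> R).

Definition monomial a b c x : R := x 0 0 ^+ a * x 1 0 ^+ b * x 2%R 0 ^+ c.

Definition monomials n f := exists a b c, (a + b + c <= n)%N /\ f = monomial a b c.

(** A property of functions on the sphere, where different polynomials may
    coincide. *)
Definition Poly n f := lspan (monomials n) f.

Lemma Poly_le n m f : (n <= m)%N -> Poly n f -> Poly m f.
Proof.
move=> nm; apply: lspan_mono => g [a [b [c [h ->]]]]; apply: lspan_gen.
by exists a, b, c; split => //; exact: leq_trans h nm.
Qed.

Lemma Poly_mul n m f g : Poly n f -> Poly m g -> Poly (n + m) (fun x => f x * g x).
Proof.
apply: lspan_mul => _ _ [a [b [c [h ->]]]] [a' [b' [c' [h' ->]]]].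
apply: (@lspan_ext _ _ _ (monomial (a + a') (b + b') (c + c'))).
  by move=> x; rewrite /monomial !exprD; ring.
by apply: lspan_gen; do 3 eexists; split; last reflexivity; lia.
Qed.

Lemma Poly_cst n (c : R) : Poly n (fun=> c).
Proof.
apply: (@lspan_ext _ _ _ (fun x => c * monomial 0 0 0 x)).
  by move=> x; rewrite /monomial !expr0 !mulr1.
by apply: lspan_scale; apply: lspan_gen; exists 0%N, 0%N, 0%N.
Qed.

Lemma Poly_coord (i : 'I_3) : Poly 1 (fun x => x i 0).
Proof.
have i3 := ltn_ord i.
apply: lspan_gen; exists (i == 0%N :> nat), (i == 1%N :> nat), (i == 2%N :> nat); split.
  by move: (nat_of_ord i) i3 => [|[|[|]]].
apply/funext => x; rewrite /monomial.
case: i i3 => [[|[|[|//]]] hi] _ /=; rewrite ?expr0 ?expr1 ?mulr1 ?mul1r.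
all: by congr (sphere_pt x _ _); exact: val_inj.
Qed.

Lemma Poly_exp n f k : Poly n f -> Poly (k * n) (fun x => f x ^+ k).
Proof.
move=> Pf; elim: k => [|k ih].
  by apply: (@lspan_ext _ _ _ (fun=> 1)); [move=> x; rewrite expr0|exact: Poly_cst].
by apply: lspan_ext (Poly_mul Pf ih) => x; rewrite exprS.
Qed.

Lemma Poly_ind (S : nat -> (sphere R -> R) -> Prop) :
  (forall n f g, f =1 g -> S n f -> S n g) ->
  (forall n m f, (n <= m)%N -> S n f -> S m f) ->
  (forall n c, S n (fun=> c)) ->
  (forall i : 'I_3, S 1%N (fun x => x i 0)) ->
  (forall n f g, S n f -> S n g -> S n (fun x => f x + g x)) ->
  (forall n m f g, S n f -> S m g -> S (n + m)%N (fun x => f x * g x)) ->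
  forall n f, Poly n f -> S n f.
Proof.
move=> Sext Sle Scst Scoord SD SM n f; elim=> [|c g h [a [b [e [abc ->]]]] _ ih].
  exact: Scst.
have Sexp i k : S k (fun x => x i 0 ^+ k).
  elim: k => [|k ihk]; first by apply: Sext (Scst _ 1) => x; rewrite expr0.
  by apply: Sext (SM _ _ _ _ (Scoord i) ihk) => x; rewrite exprS.
apply: SD => //; apply: (SM 0%N n _ _ (Scst 0%N c)).
by apply: (Sle _ _ _ abc); apply: SM (SM _ _ _ _ (Sexp _ a) (Sexp _ b)) (Sexp _ e).
Qed.

Lemma Poly_rotate rho n f : rho \in SO3 R -> Poly n f ->
  Poly n (fun x => f (rotate rho x)).
Proof.
move=> hr; move: n f; apply: Poly_ind.
- by move=> n f g fg; apply: lspan_ext => x; exact: fg.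
- by move=> n m f; exact: Poly_le.
- by move=> n c; exact: Poly_cst.
- move=> i; apply: (@lspan_ext _ _ _ (fun x => \sum_j rho i j * x j 0)).
    by move=> x; rewrite rotateE// mxE.
  by apply: lspan_sum => j; apply: lspan_scale; exact: Poly_coord.
- by move=> n f g; exact: lspan_add.
- by move=> n m f g; exact: Poly_mul.
Qed.

Lemma coord_le1 x (i : 'I_3) : `|x i 0| <= 1.
Proof.
have /eqP sx := sphereP x.
rewrite -(@ler_pXn2r _ 2)// ?nnegrE// expr1n real_normK ?num_real// -sx.
by rewrite (bigD1 i)//= lerDl sumr_ge0// => j _; exact: sqr_ge0.
Qed.

Lemma measurable_coord (i : 'I_3) : measurable_fun setT (fun x : sphere R => x i 0).
Proof.
have -> : (fun x : sphere R => x i 0) = (fun t => tnth t i) \o @sphere_coords R.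
  by apply/funext => x /=; rewrite tnth_mktuple.
apply: measurableT_comp => //; first exact: measurable_tnth.
by move=> _ B mB; exists B.
Qed.

Lemma Poly_bounded_measurable n f : Poly n f ->
  measurable_fun setT f /\ exists M, forall x, `|f x| <= M.
Proof.
move: n f; apply: (@Poly_ind (fun _ f => measurable_fun setT f /\
  exists M, forall x, `|f x| <= M)).
- by move=> n f g /funext ->.
- by [].
- by move=> n c; split => //; exists `|c|.
- by move=> i; split; [exact: measurable_coord|exists 1 => x; exact: coord_le1].
- move=> n f g [mf [M fM]] [mg [N gN]]; split; first exact: measurable_funD.
  by exists (M + N) => x; rewrite (le_trans (ler_normD _ _))// lerD.
- move=> n m f g [mf [M fM]] [mg [N gN]]; split; first exact: measurable_funM.
  by exists (M * N) => x; rewrite normrM ler_pM.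
Qed.

Lemma Poly_L2 n f : Poly n f -> L2 (surface R) f.
Proof. by move=> /Poly_bounded_measurable[mf [M fM]]; exact: bounded_L2 fM. Qed.

End polynomials_on_sphere.

(** * Spherical harmonics span the polynomials *)

Section harmonics_span_polynomials.
Context (R : realType).
Implicit Types (x y : sphere R) (f g : sphere R -> R).

Definition rzeta k x : R := complex.Re ((x 0 0 +i* x 1 0) ^+ k)%C.
Definition izeta k x : R := complex.Im ((x 0 0 +i* x 1 0) ^+ k)%C.

Lemma rzeta0 x : rzeta 0 x = 1. Proof. by rewrite /rzeta expr0. Qed.
Lemma izeta0 x : izeta 0 x = 0. Proof. by rewrite /izeta expr0. Qed.

Lemma rzetaS k x : rzeta k.+1 x = x 0 0 * rzeta k x - x 1 0 * izeta k x.
Proof. by rewrite /rzeta /izeta exprS; case: (_ ^+ k)%C. Qed.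

Lemma izetaS k x : izeta k.+1 x = x 0 0 * izeta k x + x 1 0 * rzeta k x.
Proof. by rewrite /rzeta /izeta exprS; case: (_ ^+ k)%C. Qed.

Lemma sphere_norm x : x 0 0 ^+ 2 + x 1 0 ^+ 2 = 1 - x 2%R 0 ^+ 2.
Proof.
have /eqP := sphereP x; rewrite !big_ord_recl big_ord0 addr0 => <-.
rewrite (_ : lift ord0 ord0 = 1); last exact: val_inj.
rewrite (_ : lift ord0 _ = 2%R); last exact: val_inj.
ring.
Qed.

Definition sph_coef l (m : int) : R :=
  (if m == 0 then 1 else Num.sqrt 2) * sph_norm R l `|m|%N.

Lemma sph_harmonicE l m x : sph_harmonic l m x =
  sph_coef l m * (legendre R l)^`(`|m|%N).[x 2%R 0] *
  (if 0 <= m then rzeta `|m|%N x else izeta `|m|%N x).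
Proof. by []. Qed.

Definition harmonics n f := exists l (m : int),
  [/\ (l <= n)%N, (`|m| <= l)%N & f = sph_harmonic l m].

(** A spanning family between the monomials and the harmonics: the
    dependence on the longitude is already resolved, and only the dependence
    on the height remains to be expanded. *)
Definition cylindrics n f := exists k j, (k + j <= n)%N /\
  (f = (fun x => x 2%R 0 ^+ j * rzeta k x) \/ f = (fun x => x 2%R 0 ^+ j * izeta k x)).

Lemma Poly_zeta k : Poly k (rzeta k) /\ Poly k (izeta k).
Proof.
elim: k => [|k [ihr ihi]].
  by split; [apply: lspan_ext (Poly_cst 0 1) => x; rewrite rzeta0|
    apply: lspan_ext (Poly_cst 0 0) => x; rewrite izeta0].
have P0 := Poly_coord R 0; have P1 := Poly_coord R 1; split.
  apply: lspan_ext (lspan_sub (Poly_mul P0 ihr) (Poly_mul P1 ihi)) => x.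
  by rewrite rzetaS.
apply: lspan_ext (lspan_add (Poly_mul P0 ihi) (Poly_mul P1 ihr)) => x.
by rewrite izetaS.
Qed.

Lemma Poly_horner (q : {poly R}) n : (size q <= n.+1)%N ->
  Poly n (fun x => q.[x 2%R 0]).
Proof.
move=> sq; apply: (@lspan_ext _ _ _ (fun x => \sum_(i < size q) q`_i * x 2%R 0 ^+ i)).
  by move=> x; rewrite horner_coef.
apply: lspan_sum => i; apply: lspan_scale.
apply: (@Poly_le _ (i * 1)); first by have := ltn_ord i; lia.
exact: Poly_exp (Poly_coord R 2%R).
Qed.

Lemma Poly_harmonic l m : (`|m| <= l)%N -> Poly l (@sph_harmonic R l m).
Proof.
move=> ml; have [Pr Pi] := Poly_zeta `|m|%N.
have Ph : Poly (l - `|m|) (fun x : sphere R => (legendre R l)^`(`|m|%N).[x 2%R 0]).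
  exact/Poly_horner/size_legendre_derivn.
apply: (@Poly_le _ (l - `|m| + `|m|)%N); first by rewrite subnK.
apply: (@lspan_ext _ _ _ (fun x => sph_coef l m * ((legendre R l)^`(`|m|%N).[x 2%R 0] *
    (if 0 <= m then rzeta `|m|%N x else izeta `|m|%N x)))).
  by move=> x; rewrite sph_harmonicE mulrA.
by apply: lspan_scale; case: (0 <= m); exact: Poly_mul.
Qed.

Lemma cylindrics_r n k j : (k + j <= n)%N ->
  lspan (cylindrics n) (fun x => x 2%R 0 ^+ j * rzeta k x).
Proof. by move=> h; apply: lspan_gen; exists k, j; split => //; left. Qed.

Lemma cylindrics_i n k j : (k + j <= n)%N ->
  lspan (cylindrics n) (fun x => x 2%R 0 ^+ j * izeta k x).
Proof. by move=> h; apply: lspan_gen; exists k, j; split => //; right. Qed.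

(** Multiplying by [x 0 0] or [x 1 0], the real and imaginary parts of [zeta],
    raises or lowers the power of [zeta] by one, since
    [|zeta|^2 = 1 - x 2 0 ^ 2] on the sphere. *)
Lemma cylindrics_coord n f (i : 'I_3) : lspan (cylindrics n) f ->
  lspan (cylindrics n.+1) (fun x => x i 0 * f x).
Proof.
have E0 := lspan0 (cylindrics n.+1).
have main (F G : nat -> sphere R -> R) :
    F = rzeta /\ G = izeta \/ F = izeta /\ G = rzeta ->
    forall k j, (k + j <= n)%N -> lspan (cylindrics n.+1)
      (fun x => x i 0 * (x 2%R 0 ^+ j * F k x)).
  move=> FG k j h.
  have cF p q : (p + q <= n.+1)%N ->
      lspan (cylindrics n.+1) (fun x => x 2%R 0 ^+ q * F p x).
    by case: FG => -[-> _]; [exact: cylindrics_r|exact: cylindrics_i].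
  have cG p q : (p + q <= n.+1)%N ->
      lspan (cylindrics n.+1) (fun x => x 2%R 0 ^+ q * G p x).
    by case: FG => -[_ ->]; [exact: cylindrics_i|exact: cylindrics_r].
  have [i0|i0] := eqVneq i 0.
    case: k h => [|k] h.
      case: FG => -[FE GE].
        apply: lspan_ext (cF 1%N j _) => [x|]; last by lia.
        by rewrite FE i0 rzetaS rzeta0 izeta0; ring.
      by apply: lspan_ext E0 => x; rewrite FE izeta0 !mulr0.
    apply: (@lspan_ext _ _ _ (fun x => 2^-1 * (x 2%R 0 ^+ j * F k.+2 x
       + (x 2%R 0 ^+ j * F k x - x 2%R 0 ^+ j.+2 * F k x)))); last first.
      apply: lspan_scale; apply: lspan_add; first by apply: cF; lia.
      by apply: lspan_sub; apply: cF; lia.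
    move=> x; have := sphere_norm x; rewrite i0 (exprS _ j.+1) (exprS _ j).
    case: FG => -[-> _]; rewrite ?rzetaS ?izetaS ?rzetaS ?izetaS => sn.
      move: (rzeta k x) (izeta k x) (x 2%R 0) (x 0 0) (x 1 0) (_ ^+ j) sn => r s z a b e sn.
      have -> : z * (z * e) = (1 - (a ^+ 2 + b ^+ 2)) * e by rewrite sn; ring.
      by field.
    move: (rzeta k x) (izeta k x) (x 2%R 0) (x 0 0) (x 1 0) (_ ^+ j) sn => r s z a b e sn.
    have -> : z * (z * e) = (1 - (a ^+ 2 + b ^+ 2)) * e by rewrite sn; ring.
    by field.
  have [i1|i1] := eqVneq i 1.
    case: k h => [|k] h.
      case: FG => -[FE GE].
        apply: lspan_ext (cG 1%N j _) => [x|]; last by lia.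
        by rewrite FE GE i1 izetaS rzeta0 izeta0; ring.
      by apply: lspan_ext E0 => x; rewrite FE izeta0 !mulr0.
    have [s [s1 sE]] : exists s : R, s * s = 1 /\ forall x,
        x 1 0 * F k.+1 x = s * (2^-1 * (G k.+2 x - (1 - x 2%R 0 ^+ 2) * G k x)).
      case: FG => -[-> ->].
        exists 1; split; first by rewrite mulr1.
        by move=> x; rewrite -sphere_norm !(rzetaS, izetaS); field.
      exists (-1); split; first by rewrite mulrNN mulr1.
      by move=> x; rewrite -sphere_norm !(rzetaS, izetaS); field.
    apply: (@lspan_ext _ _ _ (fun x => s * (2^-1 * (x 2%R 0 ^+ j * G k.+2 x
       - (x 2%R 0 ^+ j * G k x - x 2%R 0 ^+ j.+2 * G k x))))); last first.
      do 2 apply: lspan_scale; apply: lspan_sub; first by apply: cG; lia.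
      by apply: lspan_sub; apply: cG; lia.
    by move=> x; rewrite i1 [RHS]mulrCA sE (exprS _ j.+1) (exprS _ j); field.
  have i2 : i = 2%R.
    by apply: val_inj; case: i i0 i1 => [[|[|[|//]]] ?].
  apply: lspan_ext (cF k j.+1 _) => [x|]; last by lia.
  by rewrite i2 exprS mulrA.
elim=> [|c g h [k [j [kj FE]]] _ ih].
  by apply: lspan_ext E0 => x; rewrite mulr0.
apply: (@lspan_ext _ _ _ (fun x => c * (x i 0 * g x) + x i 0 * h x)).
  by move=> x; rewrite mulrDr mulrCA.
apply: lspan_add => //; apply: lspan_scale.
by case: FE => ->; [apply: (main rzeta izeta)|apply: (main izeta rzeta)] => //; [left|right].
Qed.

Lemma Poly_cylindrics n f : Poly n f -> lspan (cylindrics n) f.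
Proof.
apply: lspan_mono => _ [a [b [c [abc ->]]]].
have base : lspan (cylindrics (n - (a + b + c))) (fun=> 1).
  apply: lspan_ext (@cylindrics_r _ 0 0 _) => // x.
  by rewrite expr0 rzeta0 mulr1.
have step (i : 'I_3) k p f' : lspan (cylindrics p) f' ->
    lspan (cylindrics (k + p)) (fun x => x i 0 ^+ k * f' x).
  move=> Cf; elim: k => [|k ih].
    by apply: lspan_ext Cf => x; rewrite expr0 mul1r.
  by apply: lspan_ext (cylindrics_coord i ih) => x; rewrite exprS mulrA.
have := step 0 a _ _ (step 1 b _ _ (step 2%R c _ _ base)).
rewrite (_ : a + _ = n)%N; last by lia.
by apply: lspan_ext => x; rewrite /monomial mulr1 mulrA.
Qed.

Lemma sph_norm_gt0 l k : (k <= l)%N -> 0 < sph_norm R l k.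
Proof.
move=> kl; rewrite sqrtr_gt0 mulr_gt0// divr_gt0 ?ltr0n ?fact_gt0//.
  by rewrite addn1.
by rewrite mulr_gt0// pi_gt0.
Qed.

Lemma sph_coef_neq0 l m : (`|m| <= l)%N -> sph_coef l m != 0.
Proof.
move=> ml; apply: mulf_neq0; last by rewrite gt_eqF ?sph_norm_gt0.
by case: ifP => _; rewrite ?oner_neq0// gt_eqF// sqrtr_gt0.
Qed.

(** At a fixed order, [legendre_span] expands the dependence on the height. *)
Lemma cylindrics_harmonics n f : lspan (cylindrics n) f -> lspan (harmonics n) f.
Proof.
have main (m : int) (q : {poly R}) : (`|m| + size q <= n.+1)%N ->
    lspan (harmonics n) (fun x => q.[x 2%R 0] *
      (if 0 <= m then rzeta `|m|%N x else izeta `|m|%N x)).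
  move: q; apply: legendre_span.
    by apply: lspan_ext (lspan0 _) => x; rewrite horner0 mul0r.
  move=> c l q ml ln Hq.
  have Hl : lspan (harmonics n) (@sph_harmonic R l m) by apply: lspan_gen; exists l, m.
  apply: lspan_ext (lspan_add (lspan_scale (c / sph_coef l m) Hl) Hq) => x.
  rewrite sph_harmonicE hornerD hornerZ mulrDl; congr (_ + _).
  by move: (sph_coef l m) (sph_coef_neq0 ml) => a a0; field.
apply: lspan_mono => _ [k [j [kj [->|->]]]].
  have h : (`|k%:Z| + size ('X^j : {poly R}) <= n.+1)%N by rewrite size_polyXn /=; lia.
  by apply: lspan_ext (main k _ h) => x; rewrite hornerXn.
case: k kj => [|k] kj.
  by apply: lspan_ext (lspan0 _) => x; rewrite izeta0 mulr0.
have h : (`|- k.+1%:Z| + size ('X^j : {poly R}) <= n.+1)%N by rewrite size_polyXn; lia.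
by apply: lspan_ext (main (- k.+1%:Z) _ h) => x; rewrite hornerXn.
Qed.

Lemma Poly_harmonics n f : Poly n f <-> lspan (harmonics n) f.
Proof.
split=> [/Poly_cylindrics|]; first exact: cylindrics_harmonics.
apply: lspan_mono => _ [l [m [ln ml ->]]].
exact: Poly_le ln (Poly_harmonic ml).
Qed.

End harmonics_span_polynomials.

(** * Orthonormality of the spherical harmonics *)

Section orthonormality.
Context (R : realType).
Implicit Types (x y : sphere R) (f g : sphere R -> R).
Local Notation Y := (@sph_harmonic R).
Local Notation ip := (ip (surface R)).

Lemma zeta_spherical (m : int) (p : R * R) :
  (if 0 <= m then rzeta `|m|%N (spherical_point p)
   else izeta `|m|%N (spherical_point p)) = sin p.1 ^+ `|m|%N * trig m p.2.
Proof.
have [h1 h2] : rzeta `|m|%N (spherical_point p) = sin p.1 ^+ `|m|%N * cos (`|m|%N%:R * p.2) /\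
  izeta `|m|%N (spherical_point p) = sin p.1 ^+ `|m|%N * sin (`|m|%N%:R * p.2).
  elim: `|m|%N => [|k [ihr ihi]].
    by rewrite rzeta0 izeta0 mul0r cos0 sin0 !expr0 mulr1 mulr0.
  rewrite rzetaS izetaS ihr ihi !mxE/= -[k.+1%:R]natr1 mulrDl mul1r cosD sinD exprSr.
  by split; ring.
by rewrite /trig; case: (0 <= m).
Qed.

Lemma continuous_horner_cos (q : {poly R}) : continuous (fun t : R => q.[cos t]).
Proof.
apply: derivable_continuousT => t.
by have [] := is_derive1_comp (is_derive_poly q (cos t)) (is_derive_cos t).
Qed.

Lemma continuous_sinX k : continuous (fun t : R => sin t ^+ k).
Proof.
elim: k => [|k ih] t; first by under eq_fun do rewrite expr0; exact: cvg_cst.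
by under eq_fun do rewrite exprS; apply: cvgM; [exact: continuous_sin|exact: ih].
Qed.

Lemma L2_harmonic l m : (`|m| <= l)%N -> L2 (surface R) (Y l m).
Proof. by move=> ml; exact: Poly_L2 (Poly_harmonic R ml). Qed.

Lemma sph_coef_sq l m : (`|m| <= l)%N ->
  sph_coef R l m ^+ 2 = (if m == 0 then 1 else 2) *
    ((2 * l + 1)%:R / (4 * pi) * ((l - `|m|)`!%:R / (l + `|m|)`!%:R)).
Proof.
move=> ml; rewrite exprMn; congr (_ * _).
  by case: ifP => _; rewrite ?expr1n// sqr_sqrtr.
rewrite sqr_sqrtr// mulr_ge0// divr_ge0// ?ler0n//.
by rewrite mulr_ge0// pi_ge0.
Qed.

(** In spherical coordinates the integral separates: [int_trigM] settles the
    orders, [lpair_neq] and [lpair00] the degrees. *)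
Lemma harmonic_orthonormal l m l' m' : (`|m| <= l)%N -> (`|m'| <= l')%N ->
  ip (Y l m) (Y l' m') = ((l == l') && (m == m'))%:R.
Proof.
move=> ml ml'.
have my : measurable_fun setT (fun x : sphere R => Y l m x * Y l' m' x).
  by apply: measurable_funM; apply: L2_measurable; exact: L2_harmonic.
pose g t := sph_coef R l m * sph_coef R l' m' * ((legendre R l)^`(`|m|%N).[cos t] *
  (legendre R l')^`(`|m'|%N).[cos t] * (sin t ^+ `|m|%N * sin t ^+ `|m'|%N)).
pose h t : R := trig m t * trig m' t.
have cg : continuous g.
  move=> t; apply: cvgM; first exact: cvg_cst.
  by do 2 apply: cvgM; (exact: continuous_horner_cos || exact: continuous_sinX).
have ch : continuous h by move=> t; apply: cvgM; exact: continuous_trig_fun.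
rewrite /ip (surface_integral_sep my cg ch); last first.
  move=> p; rewrite !sph_harmonicE !zeta_spherical /g /h !mxE/=; ring.
rewrite int_trigM; have [mm'|_] := eqVneq m m'; last by rewrite andbF mulr0.
rewrite andbT -{m'}mm' in ml' g h my cg ch *; set k := `|m|%N in ml ml' g h my cg ch *.
rewrite (_ : \int[_]_(t in _) _ = sph_coef R l m * sph_coef R l' m * lpair R l l' k); last first.
  rewrite /lpair -pint_cos -RintegralZl//; last first.
    apply: continuous_itv_integrable => t; apply: cvgM; last exact: continuous_sin.
    exact: continuous_horner_cos.
  apply: eq_Rintegral => t _; rewrite /g !hornerM horner_exp.
  have -> : (1 - 'X^2).[cos t] = sin t ^+ 2 :> R.
    by rewrite !(hornerD, hornerN, hornerXn, hornerC) sin2cos2.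
  by rewrite -exprM mulnC exprM -expr2; ring.
have [ll'|ll'] := eqVneq l l'; last by rewrite lpair_neq// mulr0 mul0r.
rewrite -ll' lpair_eq// lpair00 -expr2 sph_coef_sq// -/k mulr1n.
have h1 : (l - k)`!%:R != 0 :> R by rewrite pnatr_eq0 -lt0n fact_gt0.
have h2 : (l + k)`!%:R != 0 :> R by rewrite pnatr_eq0 -lt0n fact_gt0.
have h3 : (2 * l + 1)%:R != 0 :> R by rewrite pnatr_eq0 addn1.
have h4 : pi != 0 :> R by rewrite gt_eqF// pi_gt0.
move: ((l - k)`!%:R) ((l + k)`!%:R) ((2 * l + 1)%:R) (pi) h1 h2 h3 h4 => a b c p h1 h2 h3 h4.
by case: ifP => _; field; rewrite h1 h2 h3 h4.
Qed.

Definition order_of (l i : nat) : int := i%:Z - l%:Z.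

Lemma order_ofP l (i : 'I_(2 * l).+1) : (`|order_of l i| <= l)%N.
Proof. by have := ltn_ord i; rewrite /order_of; lia. Qed.

Definition harmonic_proj L f x : R := \sum_(l < L.+1) \sum_(i < (2 * l).+1)
  Y l (order_of l i) x * ip f (Y l (order_of l i)).

Lemma sum_order_of l m (F : int -> R) : (`|m| <= l)%N ->
  \sum_(i < (2 * l).+1) (m == order_of l i)%:R * F (order_of l i) = F m.
Proof.
move=> ml; have hi : (`|(m + l%:Z)%R| < (2 * l).+1)%N by lia.
rewrite (bigD1 (Ordinal hi))//= (_ : order_of l _ = m); last by rewrite /order_of; lia.
rewrite eqxx mul1r big1 ?addr0// => i /eqP ine.
rewrite (_ : m == _ = false) ?mul0r//; apply/negbTE/eqP => mi; apply: ine.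
by apply: val_inj => /=; rewrite mi /order_of; have := ltn_ord i; lia.
Qed.

Lemma harmonic_proj_id L f x : Poly L f -> harmonic_proj L f x = f x.
Proof.
move=> /Poly_harmonics; elim=> [|c g h [l0 [m0 [l0L ml0 ->]]] Hh ih].
  rewrite /harmonic_proj big1// => l _; rewrite big1// => i _.
  by rewrite ip0l mulr0.
have Lh : L2 (surface R) h by apply: Poly_L2; apply/Poly_harmonics; exact: Hh.
have L0 := L2_harmonic ml0.
rewrite -ih; transitivity (c * (\sum_(l < L.+1) (l0 == l)%:R *
    \sum_(i < (2 * l).+1) (m0 == order_of l i)%:R * Y l (order_of l i) x)
    + harmonic_proj L h x).
  rewrite mulr_sumr /harmonic_proj -big_split/=; apply: eq_bigr => l _.
  rewrite !mulr_sumr -big_split/=; apply: eq_bigr => i _.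
  have Ll := L2_harmonic (order_ofP i).
  rewrite ipDl//; last exact: L2Z.
  rewrite ipZl// harmonic_orthonormal//; last exact: order_ofP.
  by case: (l0 == l); case: (m0 == _); rewrite /= ?mulr1n ?mulr0n; ring.
congr (c * _ + _); have l0L' : (l0 < L.+1)%N by [].
rewrite (bigD1 (Ordinal l0L'))//= eqxx mul1r (sum_order_of (fun m => Y l0 m x))//.
rewrite big1 ?addr0// => l ne; rewrite (_ : l0 == l = false) ?mul0r//.
by apply: contraNF ne => /eqP ll; apply/eqP; apply: val_inj; rewrite /= ll.
Qed.

End orthonormality.

(** * Polynomials determine measures on the sphere *)

Section polynomials_determine.
Context (R : realType).
Implicit Types (x y : sphere R) (f g : sphere R -> R) (u : R).

Lemma bernoulli_ge (n : nat) u : 0 <= u <= 1 -> 1 - n%:R * u <= (1 - u) ^+ n.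
Proof.
move=> /andP[u0 u1]; elim: n => [|n ih]; first by rewrite mul0r subr0 expr0.
have n0 : 0 <= n%:R * u by rewrite mulr_ge0.
rewrite exprS; apply: (@le_trans _ _ ((1 - u) * (1 - n%:R * u))).
  by rewrite -natr1; nra.
by rewrite ler_wpM2l// subr_ge0.
Qed.

Lemma bernoulli_le (n : nat) u : 0 <= u <= 1 -> (1 - u) ^+ n * (1 + n%:R * u) <= 1.
Proof.
move=> /andP[u0 u1]; elim: n => [|n ih]; first by rewrite mul0r addr0 expr0 mulr1.
have n0 : 0 <= n%:R * u by rewrite mulr_ge0.
have h : (1 - u) * (1 + n.+1%:R * u) <= 1 + n%:R * u by rewrite -natr1; nra.
rewrite exprS mulrAC; apply: le_trans ih.
by rewrite mulrC ler_wpM2l ?exprn_ge0// subr_ge0.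
Qed.

Lemma cvg_nexpr (v : R) : 0 <= v -> v < 1 -> n%:R * v ^+ n @[n --> \oo] --> (0 : R).
Proof.
move=> v0 v1; pose w := Num.sqrt v.
have w0 : 0 <= w by exact: sqrtr_ge0.
have w1 : w < 1 by rewrite -sqrtr1 ltr_sqrt.
have w2 : w * w = v by rewrite -expr2 sqr_sqrtr.
have h0 : 0 < 1 - w by rewrite subr_gt0.
apply: (@squeeze_cvgr _ _ _ _ (fun=> 0) (fun n => (1 - w)^-1 * w ^+ n)).
- near=> n; rewrite mulr_ge0 ?exprn_ge0//= -w2 exprMn mulrA.
  rewrite ler_wpM2r ?exprn_ge0// -[leRHS]mul1r ler_pdivlMr//.
  have := @bernoulli_le n (1 - w); rewrite subKr => /(_ _) h.
  have {h} : w ^+ n * (1 + n%:R * (1 - w)) <= 1 by apply: h; lra.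
  by apply: le_trans; have := exprn_ge0 n w0; nra.
- exact: cvg_cst.
- rewrite -[X in _ --> X](mulr0 (1 - w)^-1); apply: cvgM; first exact: cvg_cst.
  by apply: cvg_expr; rewrite ger0_norm.
Unshelve. all: by end_near.
Qed.

(** Polynomials in [0, 1] converging everywhere on [0, 1] to the indicator of
    [u < 1/2]; the extra factor [n] in the exponent settles the point
    [u = 1/2]. *)
Definition half_step n u : R := (1 - u ^+ n) ^+ (n * 2 ^ n).

Lemma half_step_itv n u : 0 <= u <= 1 -> 0 <= half_step n u <= 1.
Proof.
move=> /andP[u0 u1]; have h : 0 <= 1 - u ^+ n <= 1.
  by rewrite subr_ge0 exprn_ile1//= gerBl exprn_ge0.
by case/andP: h => h0 h1; rewrite exprn_ge0//= exprn_ile1.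
Qed.

Lemma cvg_half_step u : 0 <= u <= 1 ->
  half_step n u @[n --> \oo] --> ((u < 2^-1 :> R)%R%:R : R).
Proof.
move=> u01; have /andP[u0 u1] := u01.
have un n : 0 <= u ^+ n <= 1 by rewrite exprn_ge0//= exprn_ile1.
have E n : (n * 2 ^ n)%:R * u ^+ n = n%:R * (2 * u) ^+ n.
  by rewrite natrM natrX -mulrA exprMn.
have [lt|ge] := ltP u 2^-1.
  rewrite mulr1n; apply: (@squeeze_cvgr _ _ _ _ (fun n => 1 - n%:R * (2 * u) ^+ n) (fun=> 1)).
  - near=> n; rewrite (andP (half_step_itv n u01)).2 andbT -E.
    exact: bernoulli_ge.
  - rewrite -[X in _ --> X]subr0; apply: cvgB; first exact: cvg_cst.
    by apply: cvg_nexpr; [rewrite mulr_ge0|rewrite mulrC -ltr_pdivlMr// div1r].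
  - exact: cvg_cst.
rewrite mulr0n; apply: (@squeeze_cvgr _ _ _ _ (fun=> 0) (fun n => n.+1%:R^-1)).
- near=> n; rewrite (andP (half_step_itv n u01)).1 /=.
  have h := bernoulli_le (n * 2 ^ n) (un n).
  have h1 : n.+1%:R <= 1 + (n * 2 ^ n)%:R * u ^+ n.
    rewrite E -natr1 addrC lerD2l -[leLHS]mulr1 ler_wpM2l// exprn_ege1//.
    by rewrite mulrC -ler_pdivrMr// div1r.
  rewrite -div1r ler_pdivlMr// (le_trans _ h)// ler_wpM2l//.
  exact: (andP (half_step_itv n u01)).1.
- exact: cvg_cst.
- exact: cvg_harmonic.
Unshelve. all: by end_near.
Qed.

Definition polynomial f := exists n, Poly n f.

Lemma polynomial_sub f g : polynomial f -> polynomial g -> polynomial (fun x => f x - g x).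
Proof.
move=> [n Pf] [m Pg]; exists (maxn n m); apply: lspan_sub.
  exact: Poly_le (leq_maxl _ _) Pf.
exact: Poly_le (leq_maxr _ _) Pg.
Qed.

Lemma polynomial_add f g : polynomial f -> polynomial g -> polynomial (fun x => f x + g x).
Proof.
move=> [n Pf] [m Pg]; exists (maxn n m); apply: lspan_add.
  exact: Poly_le (leq_maxl _ _) Pf.
exact: Poly_le (leq_maxr _ _) Pg.
Qed.

Lemma polynomial_scale c f : polynomial f -> polynomial (fun x => c * f x).
Proof. by move=> [n Pf]; exists n; exact: lspan_scale. Qed.

Lemma polynomial_cst c : polynomial (fun=> c).
Proof. by exists 0%N; exact: Poly_cst. Qed.

Lemma polynomial_exp f k : polynomial f -> polynomial (fun x => f x ^+ k).
Proof. by move=> [n Pf]; exists (k * n)%N; exact: Poly_exp. Qed.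

Lemma polynomial_prod (I : Type) (r : seq I) (F : I -> sphere R -> R) :
  (forall i, polynomial (F i)) -> polynomial (fun x => \prod_(i <- r) F i x).
Proof.
move=> PF; elim: r => [|i r [m ih]].
  by under eq_fun do rewrite big_nil; exact: polynomial_cst.
have [n Pi] := PF i; exists (n + m)%N.
by under eq_fun do rewrite big_cons; exact: Poly_mul.
Qed.

Lemma polynomial_bounded_measurable f : polynomial f ->
  measurable_fun setT f /\ exists M, forall x, `|f x| <= M.
Proof. by move=> [n]; exact: Poly_bounded_measurable. Qed.

(** Corners of the sphere: a pi-system generating its Borel sets. *)
Definition corner (t : 'I_3 -> R) : set (sphere R) := [set x | forall i, x i 0 < t i].

(** An increasing affine map sending [t] to [1/2] and the interval [-1, 1]
    into [0, 1]. *)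
Let squeeze (t u : R) : R := 2^-1 + (u - t) / (2 * (1 + `|t|)).

Definition corner_approx (t : 'I_3 -> R) n x : R := \prod_(i < 3) half_step n (squeeze (t i) (x i 0)).

Let squeeze_itv (t u : R) : `|u| <= 1 -> 0 <= squeeze t u <= 1.
Proof.
move=> u1; have d0 : 0 < 2 * (1 + `|t|) by rewrite mulr_gt0// ltr_pwDl.
have : `|(u - t) / (2 * (1 + `|t|))| <= 2^-1.
  rewrite normrM normfV (gtr0_norm d0) ler_pdivrMr// mulrA mulVf// mul1r.
  by rewrite (le_trans (ler_normB _ _))// lerD2r.
rewrite /squeeze ler_norml; move: (_ / _) => v; lra.
Qed.

Let squeeze_lt (t u : R) : (squeeze t u < 2^-1) = (u < t).
Proof.
have d0 : 0 < 2 * (1 + `|t|) by rewrite mulr_gt0// ltr_pwDl.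
by rewrite /squeeze -[ltRHS]addr0 ltrD2l pmulr_llt0 ?invr_gt0// subr_lt0.
Qed.

Let corner_itv (t : 'I_3 -> R) x i : 0 <= squeeze (t i) (x i 0) <= 1.
Proof. exact/squeeze_itv/coord_le1. Qed.

Lemma corner_approx_polynomial t n : polynomial (corner_approx t n).
Proof.
apply: polynomial_prod => i; apply: polynomial_exp; apply: polynomial_sub.
  exact: polynomial_cst.
apply: polynomial_exp; apply: polynomial_add; first exact: polynomial_cst.
have -> : (fun x : sphere R => (x i 0 - t i) / (2 * (1 + `|t i|))) =
    (fun x => (2 * (1 + `|t i|))^-1 * (x i 0 - t i)).
  by apply/funext => x; rewrite mulrC.
apply: polynomial_scale; apply: polynomial_sub; last exact: polynomial_cst.
by exists 1%N; exact: Poly_coord.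
Qed.

Lemma corner_approx_itv t n x : 0 <= corner_approx t n x <= 1.
Proof.
apply/andP; split.
  by apply: prodr_ge0 => i _; case/andP: (half_step_itv n (corner_itv t x i)).
by apply: prodr_ile1 => i _; exact: half_step_itv.
Qed.

Lemma cvg_corner_approx t x : corner_approx t n x @[n --> \oo] --> (\1_(corner t) x : R).
Proof.
have h (i : 'I_3) : half_step n (squeeze (t i) (x i 0)) @[n --> \oo] -->
    ((x i 0 < t i)%R%:R : R).
  by rewrite -squeeze_lt; exact/cvg_half_step/corner_itv.
have -> : \1_(corner t) x = \prod_(i < 3) ((x i 0 < t i)%R%:R : R).
  rewrite indicE; have [/set_mem xt|] := boolP (x \in corner t).
    by rewrite big1// => i _; rewrite xt.
  rewrite notin_setE => /existsNP[i /negP xi].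
  by rewrite (bigD1 i)//= (negbTE xi) mul0r.
rewrite /corner_approx !big_ord_recl big_ord0.
under eq_fun do rewrite !big_ord_recl big_ord0.
by apply: cvgM => //; apply: cvgM => //; apply: cvgM => //; exact: cvg_cst.
Qed.

Lemma measurable_corner t : measurable (corner t).
Proof.
rewrite (_ : corner t = \bigcap_(i in setT) ((fun x : sphere R => x i 0) @^-1` `]-oo, t i[%classic)).
  apply: fin_bigcap_measurable => // i _.
  by rewrite -[X in measurable X]setTI; apply: measurable_coord.
apply/seteqP; split => x /=; first by move=> h i _; rewrite /= in_itv/=.
by move=> h i; have := h i Logic.I; rewrite /= in_itv/=.
Qed.

Lemma corner_setI : setI_closed (range corner).
Proof.
move=> _ _ [t _ <-] [s _ <-]; exists (fun i => Num.min (t i) (s i)) => //.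
apply/seteqP; split => [x h|x [h1 h2] i].
  by split => i; have := h i; rewrite lt_min => /andP[].
by rewrite lt_min h1 h2.
Qed.

Lemma corner_generates : (@measurable _ (sphere R)) = <<s range corner >>.
Proof.
apply/seteqP; split; last first.
  by apply: smallest_sub; [exact: sigma_algebra_measurable|move=> _ [t _ <-]; exact: measurable_corner].
move=> _ [B mB <-].
pose S := g_sigma_algebraType (range corner).
have : measurable_fun setT (@sphere_coords R : S -> 3.-tuple R).
  apply/measurable_fun_tnthP => i.
  have -> : @tnth 3 R ^~ i \o (@sphere_coords R : S -> _) = (fun x : S => (x : sphere R) i 0).
    by apply/funext => x /=; rewrite tnth_mktuple.
  apply: (measurability _ (RGenInftyO.measurableE R)).
  move=> _ [_ [u ->] <-]; rewrite setTI.
  apply: sub_sigma_algebra; exists (fun j => if j == i then u else 2) => //.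
  apply/seteqP; split => x /=.
    by move=> h; have := h i; rewrite eqxx/= in_itv/=.
  rewrite in_itv/= => h j; case: eqP => [->//|_].
  by rewrite (le_lt_trans (ler_norm _))// (le_lt_trans (coord_le1 x j))// ltr1n.
by move=> /(_ measurableT _ mB); rewrite setTI.
Qed.

(** The corners form a pi-system, and their indicators are bounded limits,
    at every point, of polynomials. *)
Lemma polynomials_determine_measure (mu nu : {measure set (sphere R) -> \bar R}) :
  (mu setT < +oo)%E -> (nu setT < +oo)%E ->
  (forall f, polynomial f -> \int[mu]_x f x = \int[nu]_x f x) ->
  forall A, measurable A -> mu A = nu A.
Proof.
move=> muoo nuoo h.
have lim (m : {measure set (sphere R) -> \bar R}) t : (m setT < +oo)%E ->
    (\int[m]_x corner_approx t n x)%:E @[n --> \oo] --> m (corner t).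
  move=> moo; have mi n : m.-integrable setT (EFin \o corner_approx t n).
    have [mf [M fM]] := polynomial_bounded_measurable (corner_approx_polynomial t n).
    apply: measurable_bounded_integrable => //; exists M; split; first exact: num_real.
    by move=> y My x _ /=; apply: le_trans (fM x) _; exact: ltW.
  have := @dominated_convergence _ _ _ m setT measurableT
    (fun n => EFin \o corner_approx t n) (EFin \o \1_(corner t)) (cst 1%E).
  case.
  - by move=> n; have /integrableP[] := mi n.
  - by apply/measurable_EFinP/measurable_indic; exact: measurable_corner.
  - apply: aeW => x _; apply/cvg_EFin; first exact: nearW.
    exact: cvg_corner_approx.
  - apply/integrableP; split; first exact: measurable_cst.
    by under eq_integral do rewrite abse1; rewrite integral_cst// mul1e.
  - apply: aeW => x n _ /=; rewrite lee_fin.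
    by have /andP[a0 a1] := corner_approx_itv t n x; rewrite ger0_norm.
  move=> _ _; rewrite integral_indic ?setIT//; last exact: measurable_corner.
  by apply: cvg_trans; apply: near_eq_cvg; apply: nearW => n; rewrite EFin_Rintegral.
have cornerE t : mu (corner t) = nu (corner t).
  apply: cvg_unique (lim mu t muoo) _ => //.
  rewrite (_ : (fun n => _) = (fun n => (\int[nu]_x corner_approx t n x)%:E)); first exact: lim.
  by apply/funext => n; rewrite h//; exact: corner_approx_polynomial.
apply: (@measure_unique _ _ _ (range corner) (fun=> corner (fun=> 2))).
- exact: corner_generates.
- exact: corner_setI.
- by move=> _; exists (fun=> 2).
- apply/seteqP; split => // x _; exists 0%N => // i.
  by rewrite (le_lt_trans (ler_norm _))// (le_lt_trans (coord_le1 x i))// ltr1n.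
- by move=> _ [t _ <-].
- by move=> _; apply: le_lt_trans muoo; apply: le_measure => //;
    rewrite inE//; exact: measurable_corner.
Qed.

End polynomials_determine.

(** * Rotation invariance of the surface measure *)

Section rotation_invariance.
Context (R : realType).
Implicit Types (x y : sphere R) (f g : sphere R -> R) (rho : 'M[R]_3).
Local Notation Y := (@sph_harmonic R).

Lemma measurable_rotate rho : rho \in SO3 R -> measurable_fun setT (rotate rho).
Proof.
move=> hr _ A [B mB <-].
suff h : measurable_fun setT (@sphere_coords R \o rotate rho).
  by rewrite (setTI (_ @^-1` B)) -comp_preimage; exact: h.
apply/measurable_fun_tnthP => i.
have -> : @tnth 3 R ^~ i \o (@sphere_coords R \o rotate rho) =
    (fun x => \sum_j rho i j * x j 0).
  by apply/funext => x /=; rewrite tnth_mktuple rotateE// mxE.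
apply: measurable_sum => j; apply: measurable_funM => //; exact: measurable_coord.
Qed.

Lemma SO3M rho rho' : rho \in SO3 R -> rho' \in SO3 R -> rho *m rho' \in SO3 R.
Proof.
move=> /andP[/eqP o1 /eqP d1] /andP[/eqP o2 /eqP d2]; apply/andP; split.
  by rewrite trmx_mul -mulmxA (mulmxA rho^T) o1 mul1mx o2.
by rewrite det_mulmx d1 d2 mulr1.
Qed.

Lemma SO3V rho : rho \in SO3 R -> rho^T \in SO3 R.
Proof.
move=> /andP[/eqP o1 /eqP d1]; apply/andP; split; last by rewrite det_tr d1.
by rewrite trmxK; apply/eqP/mulmx1C.
Qed.

Lemma sphere_ext x y : (forall i, x i 0 = y i 0) -> x = y.
Proof. by move=> h; apply: val_inj; apply/matrixP => i j; rewrite ord1 h. Qed.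

Lemma rotateM rho rho' x : rho \in SO3 R -> rho' \in SO3 R ->
  rotate (rho *m rho') x = rotate rho (rotate rho' x).
Proof.
by move=> h h'; apply: val_inj; rewrite /= !rotateE ?SO3M// mulmxA.
Qed.

Lemma rotateK rho x : rho \in SO3 R -> rotate rho^T (rotate rho x) = x.
Proof.
move=> hr; apply: val_inj; rewrite /= rotateE ?SO3V// rotateE// mulmxA.
by case/andP: hr => /eqP -> _; rewrite mul1mx.
Qed.

Definition preserves_surface rho := forall A, measurable A ->
  surface R (rotate rho @^-1` A) = surface R A.

Lemma preserves_surfaceM rho rho' : rho \in SO3 R -> rho' \in SO3 R ->
  preserves_surface rho -> preserves_surface rho' -> preserves_surface (rho *m rho').
Proof.
move=> h h' p p' A mA; rewrite (_ : _ @^-1` A = rotate rho' @^-1` (rotate rho @^-1` A)).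
  by rewrite p' ?p// -[X in measurable X]setTI; apply: measurable_rotate.
by apply/funext => x; rewrite /preimage/= rotateM.
Qed.

Lemma preserves_surface_integral rho f : rho \in SO3 R -> preserves_surface rho ->
  (surface R).-integrable setT (EFin \o f) ->
  (surface R).-integrable setT (EFin \o (fun x => f (rotate rho x))) ->
  \int[surface R]_x f (rotate rho x) = \int[surface R]_x f x.
Proof.
move=> hr pr fi fri; have mf : measurable_fun setT (EFin \o f) by have /integrableP[] := fi.
have := @integral_pushforward _ _ _ _ _ _ (measurable_rotate hr) (surface R) setT _ mf fri measurableT.
rewrite /Rintegral => <-; congr fine.
pose nu := measure_function_pushforward__canonical__measure_function_Measure
  (surface R) (measurable_rotate hr).
have h A : measurable A -> A `<=` setT -> nu A = surface R A by move=> mA _; exact: pr.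
exact: (@eq_measure_integral _ _ _ setT (surface R) nu (EFin \o f) h).
Qed.

(** Apply [polynomials_determine_measure] to the surface measure and its
    image by [rho]. *)
Lemma preserves_surface_polynomial rho : rho \in SO3 R ->
  (forall f, polynomial f -> \int[surface R]_x f (rotate rho x) = \int[surface R]_x f x) ->
  preserves_surface rho.
Proof.
move=> hr h A mA; have mr := measurable_rotate hr.
pose nu := measure_function_pushforward__canonical__measure_function_Measure (surface R) mr.
have sT : (surface R setT < +oo)%E.
  exact: (fin_num_fun_lty (@fin_num_measure _ _ _ (surface R))).
have nT : (nu setT < +oo)%E by rewrite [nu _]/(surface R setT).
apply: (polynomials_determine_measure nT sT) => [f Pf|]; last exact: mA.
have [mf [M fM]] := polynomial_bounded_measurable Pf.
rewrite -(h f Pf) /Rintegral; congr fine.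
rewrite (@integral_pushforward _ _ _ _ _ _ mr (surface R) setT (EFin \o f))//.
  exact/measurable_EFinP.
apply: (@bounded_integrable _ _ _ _ _ M) => [|x]; last exact: fM.
exact: measurableT_comp.
Qed.

(** Rotation about the polar axis by the unit complex number [c + i s]. *)
Definition polar_rotation (c s : R) : 'M[R]_3 :=
  \matrix_(i, j) (nth [::] [:: [:: c; - s; 0]; [:: s; c; 0]; [:: 0; 0; 1]] i)`_j.

Definition axis_cycle : 'M[R]_3 :=
  \matrix_(i, j) (nth [::] [:: [:: 0; 1; 0]; [:: 0; 0; 1]; [:: 1; 0; 0]] i)`_j.

Lemma polar_rotation_SO3 c s : c ^+ 2 + s ^+ 2 = 1 -> polar_rotation c s \in SO3 R.
Proof.
move=> cs; apply/andP; split.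
  apply/eqP/matrixP => i j; rewrite !mxE !big_ord_recl big_ord0 !mxE -val_eqE.
  by case: i j => [[|[|[|//]]] hi] [[|[|[|//]]] hj] /=; rewrite ?mulr1n ?mulr0n;
    (ring || (rewrite -cs; ring)).
rewrite (expand_det_row _ 0) !big_ord_recl big_ord0 /cofactor.
rewrite !(expand_det_row _ 0) !big_ord_recl !big_ord0 /cofactor !det_mx11 !mxE /=.
rewrite /bump /=; apply/eqP; transitivity (c ^+ 2 + s ^+ 2); [ring|exact: cs].
Qed.

Lemma axis_cycle_SO3 : axis_cycle \in SO3 R.
Proof.
apply/andP; split.
  apply/eqP/matrixP => i j; rewrite !mxE !big_ord_recl big_ord0 !mxE -val_eqE.
  by case: i j => [[|[|[|//]]] hi] [[|[|[|//]]] hj] /=; rewrite ?mulr1n ?mulr0n; ring.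
rewrite (expand_det_row _ 0) !big_ord_recl big_ord0 /cofactor.
rewrite !(expand_det_row _ 0) !big_ord_recl !big_ord0 /cofactor !det_mx11 !mxE /=.
by rewrite /bump /=; apply/eqP; ring.
Qed.

Lemma rotate_polar c s x : c ^+ 2 + s ^+ 2 = 1 ->
  let y := rotate (polar_rotation c s) x in
  [/\ y 0 0 = c * x 0 0 - s * x 1 0, y 1 0 = s * x 0 0 + c * x 1 0
    & y 2%R 0 = x 2%R 0].
Proof.
move=> cs /=; rewrite rotateE ?polar_rotation_SO3// !mxE !big_ord_recl !big_ord0 !mxE /=.
rewrite (_ : lift ord0 ord0 = 1); last exact: val_inj.
rewrite (_ : lift ord0 _ = 2%R); last exact: val_inj.
by split; ring.
Qed.

Lemma rotate_cycle x : let y := rotate axis_cycle x in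
  [/\ y 0 0 = x 1 0, y 1 0 = x 2%R 0 & y 2%R 0 = x 0 0].
Proof.
rewrite /= rotateE ?axis_cycle_SO3// !mxE !big_ord_recl !big_ord0 !mxE /=.
rewrite (_ : lift ord0 ord0 = 1); last exact: val_inj.
rewrite (_ : lift ord0 _ = 2%R); last exact: val_inj.
by split; ring.
Qed.

Lemma zeta_polar c s k x : c ^+ 2 + s ^+ 2 = 1 ->
  let w := ((c +i* s) ^+ k)%C in
  rzeta k (rotate (polar_rotation c s) x) =
    complex.Re w * rzeta k x - complex.Im w * izeta k x /\
  izeta k (rotate (polar_rotation c s) x) =
    complex.Im w * rzeta k x + complex.Re w * izeta k x.
Proof.
move=> cs w; have [E0 E1 _] := rotate_polar x cs.
rewrite /rzeta /izeta E0 E1.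
have -> : ((c * x 0 0 - s * x 1 0) +i* (s * x 0 0 + c * x 1 0) =
    (c +i* s) * (x 0 0 +i* x 1 0))%C.
  by congr Complex; ring.
rewrite exprMn -/w; case: w => a b; case: (_ ^+ k)%C => a' b' /=.
by split; ring.
Qed.

Lemma sph_coefN l m : sph_coef R l (- m) = sph_coef R l m.
Proof. by rewrite /sph_coef abszN oppr_eq0. Qed.

(** The rotation multiplies [x 0 0 + i x 1 0] by [c + i s], so it mixes the
    harmonics of orders [m] and [- m] as real and imaginary parts. *)
Lemma harmonic_polar c s l m x : c ^+ 2 + s ^+ 2 = 1 ->
  let w := ((c +i* s) ^+ `|m|%N)%C in
  Y l m (rotate (polar_rotation c s) x) = complex.Re w * Y l m x +
    (if 0 <= m then - complex.Im w else complex.Im w) * Y l (- m) x.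
Proof.
move=> cs w; have [_ _ E2] := rotate_polar x cs.
have [Er Ei] := zeta_polar `|m|%N x cs.
rewrite !sph_harmonicE E2 abszN sph_coefN Er Ei -/w oppr_ge0.
have [m0|m0] := eqVneq m 0; first by rewrite /w m0 absz0 !lexx izeta0 expr0 /=; ring.
clear Er Ei; clearbody w.
have -> : (m <= 0) = ~~ (0 <= m) by lia.
by case: (0 <= m) => /=; ring.
Qed.

(** The constant function is a multiple of the harmonic of degree 0, to which
    the others are orthogonal. *)
Lemma integral_harmonic l m : (`|m| <= l)%N -> m != 0 ->
  \int[surface R]_x Y l m x = 0.
Proof.
move=> ml m0; have L00 : L2 (surface R) (Y 0 0) by apply: L2_harmonic.
have Llm := L2_harmonic R ml.
have one x : 1 = Y 0 0 x * ip (surface R) (fun=> 1) (Y 0 0).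
  have := harmonic_proj_id x (Poly_cst 0 1).
  by rewrite /harmonic_proj !big_ord1 /order_of subrr => /esym.
transitivity (ip (surface R) (Y l m) (fun x => ip (surface R) (fun=> 1) (Y 0 0) * Y 0 0 x)).
  by apply: eq_Rintegral => x _; rewrite [X in _ * X]mulrC -one mulr1.
rewrite ipC ipZl// ipC harmonic_orthonormal//.
by rewrite [0 == m]eq_sym (negbTE m0) andbF mulr0.
Qed.

(** By [harmonic_polar] harmonics of order 0 are fixed, and the others
    integrate to zero before and after the rotation. *)
Lemma polar_preserves_surface c s : c ^+ 2 + s ^+ 2 = 1 ->
  preserves_surface (polar_rotation c s).
Proof.
move=> cs; have hr := polar_rotation_SO3 cs.
apply: preserves_surface_polynomial => // f [n /Poly_harmonics].
elim=> [//|e g h [l [m [ln ml ->]]] Hh ih].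
have Lh : L2 (surface R) h by apply: Poly_L2; apply/Poly_harmonics; exact: Hh.
have Lhr : L2 (surface R) (fun x => h (rotate (polar_rotation c s) x)).
  by apply: Poly_L2; apply: Poly_rotate => //; apply/Poly_harmonics; exact: Hh.
have Ll := L2_harmonic R ml.
have Llr : L2 (surface R) (fun x => Y l m (rotate (polar_rotation c s) x)).
  by apply: Poly_L2; apply: Poly_rotate => //; exact: Poly_harmonic.
have ml' : (`|(- m)%R| <= l)%N by rewrite abszN.
have Ln := L2_harmonic R ml'.
have key : \int[surface R]_x Y l m (rotate (polar_rotation c s) x) =
    \int[surface R]_x Y l m x.
  under eq_Rintegral do rewrite (harmonic_polar l m _ cs).
  rewrite (L2_Rintegral_linear _ Ll (L2Z _ Ln)).
  rewrite RintegralZl//; last exact: L2_integrable.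
  have [->|m0] := eqVneq m 0; first by rewrite expr0 /= oppr0 mul0r addr0 mul1r.
  by rewrite !integral_harmonic// ?oppr_eq0// !mulr0 addr0.
by rewrite (L2_Rintegral_linear _ Llr Lhr) (L2_Rintegral_linear _ Ll Lh) ih key.
Qed.

End rotation_invariance.

(** * Moments of the sphere and transitivity of rotations *)

Section transitivity.
Context (R : realType).
Local Notation leb := (@lebesgue_measure R).
Implicit Types (x y : sphere R) (f g : sphere R -> R) (rho : 'M[R]_3).

Definition moment a b c : R := \int[surface R]_x monomial a b c x.

Lemma Poly_monomial a b c : Poly (a + b + c) (@monomial R a b c).
Proof. by apply: lspan_gen; exists a, b, c. Qed.

Let J a b := \int[leb]_(t in `[0, 2 * pi]) (cos t ^+ a * sin t ^+ b : R).
Let I n c := \int[leb]_(t in `[0, pi]) (sin t ^+ n * cos t ^+ c * sin t : R).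

Lemma continuous_cosX k : continuous (fun t : R => cos t ^+ k).
Proof.
elim: k => [|k ih] t; first by under eq_fun do rewrite expr0; exact: cvg_cst.
by under eq_fun do rewrite exprS; apply: cvgM; [exact: continuous_cos|exact: ih].
Qed.

Let contM (f g : R -> R) : continuous f -> continuous g -> continuous (fun t => f t * g t).
Proof. by move=> cf cg t; apply: cvgM; [exact: cf|exact: cg]. Qed.

Let cI n c : continuous (fun t : R => sin t ^+ n * cos t ^+ c * sin t).
Proof.
apply: contM; last exact: continuous_sin.
by apply: contM; [exact: continuous_sinX|exact: continuous_cosX].
Qed.

Let cJ a b : continuous (fun t : R => cos t ^+ a * sin t ^+ b).
Proof. by apply: contM; [exact: continuous_cosX|exact: continuous_sinX]. Qed.

Lemma momentE a b c : moment a b c = I (a + b) c * J a b.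
Proof.
rewrite /moment (@surface_integral_sep _ _ (fun t => sin t ^+ (a + b) * cos t ^+ c)
    (fun t => cos t ^+ a * sin t ^+ b)) //.
- by have [] := Poly_bounded_measurable (Poly_monomial a b c).
- by apply: contM; [exact: continuous_sinX|exact: continuous_cosX].
- by move=> p; rewrite /monomial !mxE /= !exprMn exprD; ring.
Qed.

Let dsinX n (t : R) : is_derive t (1 : R) (fun t : R => sin t ^+ n.+1) (n.+1%:R * sin t ^+ n * cos t).
Proof.
have -> : (fun t : R => sin t ^+ n.+1) = (fun t => ('X^(n.+1) : {poly R}).[sin t]).
  by apply/funext => u; rewrite hornerXn.
have h := is_derive1_comp (is_derive_poly 'X^(n.+1) (sin t)) (is_derive_sin t); apply: (is_derive_eq h).
by rewrite derivXn /= hornerMn hornerXn -(mulr_natl _ n.+1); ring.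
Qed.

Let dcosX n (t : R) : is_derive t (1 : R) (fun t : R => cos t ^+ n.+1)
  (- (n.+1%:R * cos t ^+ n * sin t)).
Proof.
have -> : (fun t : R => cos t ^+ n.+1) = (fun t => ('X^(n.+1) : {poly R}).[cos t]).
  by apply/funext => u; rewrite hornerXn.
have h := is_derive1_comp (is_derive_poly 'X^(n.+1) (cos t)) (is_derive_cos t); apply: (is_derive_eq h).
by rewrite derivXn /= hornerMn hornerXn -(mulr_natl _ n.+1); ring.
Qed.

Let contZB (k l : R) (f g : R -> R) : continuous f -> continuous g ->
  continuous (fun t => k * f t - l * g t).
Proof.
move=> cf cg t; apply: cvgB; apply: cvgM; (exact: cvg_cst || exact: cf || exact: cg).
Qed.

Let intZD (b k l : R) (f g : R -> R) : continuous f -> continuous g ->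
  \int[leb]_(t in `[0, b]) (k * f t - l * g t) =
  k * \int[leb]_(t in `[0, b]) f t - l * \int[leb]_(t in `[0, b]) g t.
Proof.
move=> cf cg; rewrite RintegralB//; last 2 first.
- by apply: continuous_itv_integrable; apply: contM => // t; exact: cvg_cst.
- by apply: continuous_itv_integrable; apply: contM => // t; exact: cvg_cst.
by rewrite !RintegralZl//; exact: continuous_itv_integrable.
Qed.

(** Integrate the derivative of [cos t ^ (a + 1) sin t ^ (b + 1)] over a
    period. *)
Lemma longitude_rec a b : a.+1%:R * J a b.+2 = b.+1%:R * J a.+2 b.
Proof.
apply/eqP; rewrite eq_sym -subr_eq0 -intZD//.
pose F (t : R) := cos t ^+ a.+1 * sin t ^+ b.+1.
have dF (t : R) : is_derive t (1 : R) F
    (b.+1%:R * (cos t ^+ a.+2 * sin t ^+ b) - a.+1%:R * (cos t ^+ a * sin t ^+ b.+2)).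
  have h := is_deriveM (dcosX a t) (dsinX b t); apply: (is_derive_eq h).
  by rewrite /GRing.scale/= !exprS; ring.
rewrite (Rintegral_derive (twopi_gt0 R) _ dF); last exact: contZB.
have := sin_int_twopi R 1; rewrite mul1r => s1.
by rewrite /F s1 sin0 !expr0n !mulr0 subrr.
Qed.

(** Integrate the derivative of [sin t ^ (n + 2) cos t ^ (c + 1)] from pole
    to pole. *)
Lemma latitude_rec n c : n.+2%:R * I n c.+2 = c.+1%:R * I n.+2 c.
Proof.
apply/eqP; rewrite -subr_eq0 -intZD//.
pose F (t : R) := sin t ^+ n.+2 * cos t ^+ c.+1.
have dF (t : R) : is_derive t (1 : R) F
    (n.+2%:R * (sin t ^+ n * cos t ^+ c.+2 * sin t) - c.+1%:R * (sin t ^+ n.+2 * cos t ^+ c * sin t)).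
  have h := is_deriveM (dsinX n.+1 t) (dcosX c t); apply: (is_derive_eq h).
  by rewrite /GRing.scale/= !exprS; ring.
rewrite (Rintegral_derive (pi_gt0 R) _ dF); last exact: contZB.
by rewrite /F sinpi sin0 !expr0n !mul0r subrr.
Qed.

Lemma longitude_odd_cos b : J 1 b = 0.
Proof.
pose F (t : R) := b.+1%:R^-1 * sin t ^+ b.+1.
have dF (t : R) : is_derive t (1 : R) F (cos t ^+ 1 * sin t ^+ b).
  have h := is_deriveZ (b.+1%:R^-1) (dsinX b t); apply: (is_derive_eq h).
  have : b.+1%:R != 0 :> R by rewrite pnatr_eq0.
  by rewrite /GRing.scale/=; move: (b.+1%:R) => z z0; field.
rewrite /J (Rintegral_derive (twopi_gt0 R) (@cJ 1 b) dF).
have := sin_int_twopi R 1; rewrite mul1r => s1.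
by rewrite /F s1 sin0 expr0n !mulr0 subrr.
Qed.

Lemma longitude_odd_sin a : J a 1 = 0.
Proof.
pose F (t : R) := - a.+1%:R^-1 * cos t ^+ a.+1.
have dF (t : R) : is_derive t (1 : R) F (cos t ^+ a * sin t ^+ 1).
  have h := is_deriveZ (- a.+1%:R^-1) (dcosX a t); apply: (is_derive_eq h).
  have : a.+1%:R != 0 :> R by rewrite pnatr_eq0.
  by rewrite /GRing.scale/=; move: (a.+1%:R) => z z0; field.
rewrite /J (Rintegral_derive (twopi_gt0 R) (@cJ a 1) dF).
have := cos_int_twopi R 1; rewrite mul1r => s1.
by rewrite /F s1 cos0 subrr.
Qed.

Lemma latitude_odd n : I n 1 = 0.
Proof.
pose F (t : R) := n.+2%:R^-1 * sin t ^+ n.+2.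
have dF (t : R) : is_derive t (1 : R) F (sin t ^+ n * cos t ^+ 1 * sin t).
  have h := is_deriveZ (n.+2%:R^-1) (dsinX n.+1 t); apply: (is_derive_eq h).
  have : n.+2%:R != 0 :> R by rewrite pnatr_eq0.
  by rewrite /GRing.scale/= exprS; move: (n.+2%:R) => z z0; field.
rewrite /I (Rintegral_derive (pi_gt0 R) (@cI n 1) dF).
by rewrite /F sinpi sin0 expr0n !mulr0 subrr.
Qed.

Lemma moment_norm a b c :
  moment a.+2 b c + moment a b.+2 c + moment a b c.+2 = moment a b c.
Proof.
have Lm a' b' c' : L2 (surface R) (@monomial R a' b' c').
  exact: Poly_L2 (Poly_monomial a' b' c').
have add f g : L2 (surface R) f -> L2 (surface R) g ->
    \int[surface R]_x f x + \int[surface R]_x g x = \int[surface R]_x (f x + g x).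
  move=> Lf Lg; rewrite -[X in X + _]mul1r -L2_Rintegral_linear//.
  by apply: eq_Rintegral => x _; rewrite mul1r.
rewrite /moment add// add//; last exact: L2D.
apply: eq_Rintegral => x _; rewrite /monomial.
have sn := sphere_norm x.
transitivity ((x 0 0 ^+ 2 + x 1 0 ^+ 2 + x 2%R 0 ^+ 2) *
  (x 0 0 ^+ a * x 1 0 ^+ b * x 2%R 0 ^+ c)); last by rewrite sn subrK mul1r.
move: (x 0 0) (x 1 0) (x 2%R 0) => p q r.
have E2 (u : R) n : u ^+ n.+2 = u ^+ 2 * u ^+ n by rewrite -exprD.
by rewrite (E2 p a) (E2 q b) (E2 r c); ring.
Qed.

(** All three coordinates obey the same recurrence: this symmetry of the
    moments is what makes the surface measure, although defined through a
    distinguished axis, invariant under exchanging axes. *)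
Lemma moment_rec a b c (s : R := (a + b + c + 3)%:R) :
  [/\ s * moment a.+2 b c = a.+1%:R * moment a b c,
      s * moment a b.+2 c = b.+1%:R * moment a b c &
      s * moment a b c.+2 = c.+1%:R * moment a b c].
Proof.
have N := moment_norm a b c.
have L : a.+1%:R * moment a b.+2 c = b.+1%:R * moment a.+2 b c.
  by rewrite !momentE !addnS !addSn mulrCA longitude_rec mulrCA.
have H : (a + b).+2%:R * moment a b c.+2 = c.+1%:R * (moment a.+2 b c + moment a b.+2 c).
  rewrite !momentE !addnS !addSn mulrA latitude_rec -mulrDr.
  rewrite -[LHS]mulrA; congr (_ * (_ * _)).
  rewrite /J -RintegralD//; try exact: continuous_itv_integrable.
  apply: eq_Rintegral => t _; rewrite 2!(exprS (cos t)) 2!(exprS (sin t)).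
  have := cos2Dsin2 t => cs.
  by rewrite -[LHS]mul1r -cs; ring.
move: N L H; rewrite /s !natrD -!natr1 !natrD.
move: (moment _ _ _) (moment a.+2 _ _) (moment _ b.+2 _) (moment _ _ c.+2) => M A B C.
move: (a%:R) (b%:R) (c%:R) (ler0n R a) (ler0n R b) => p q r p0 q0 N L H.
have HC : (p + q + r + 3) * C = (r + 1) * M by rewrite -N; nra.
have pq : p + q + 2 != 0 by rewrite gt_eqF// ltr_wpDl// addr_ge0.
have HAB : (p + q + r + 3) * (A + B) = (p + q + 2) * M.
  by apply: (mulfI pq); move: HC H N; nra.
have EA : (p + q + 2) * A = (p + 1) * (A + B) by nra.
have EB : (p + q + 2) * B = (q + 1) * (A + B) by nra.
have -> : p + q + r + (0 + 1 + 1 + 1) = p + q + r + 3 by ring.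
by split => //; apply: (mulfI pq); rewrite mulrCA ?EA ?EB mulrCA HAB; ring.
Qed.

(** By [moment_rec] an exponent can be lowered by two in both members; the
    moments with an exponent equal to one vanish. *)
Lemma moment_cycle a b c : moment a b c = moment c a b.
Proof.
have [n] := ubnP (a + b + c)%N.
elim: n a b c => [//|n ih] a b c abc.
have s0 (m : nat) : (m + 3)%:R != 0 :> R by rewrite addn3 pnatr_eq0.
case: a abc => [|[|a]] abc.
- case: b abc => [|[|b]] abc.
  + case: c abc => [|[|c]] abc.
    * by [].
    * by rewrite !momentE latitude_odd longitude_odd_cos mul0r mulr0.
    * have [_ _ h] := moment_rec 0 0 c; have [h' _ _] := moment_rec c 0 0.
      apply: (mulfI (s0 (0 + 0 + c)%N)); rewrite h [in RHS](_ : 0 + 0 + c = c + 0 + 0)%N.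
        by rewrite h' ih//; lia.
      lia.
  + by rewrite !momentE longitude_odd_sin latitude_odd mul0r mulr0.
  + have [_ h _] := moment_rec 0 b c; have [_ _ h'] := moment_rec c 0 b.
    apply: (mulfI (s0 (0 + b + c)%N)); rewrite h [in RHS](_ : 0 + b + c = c + 0 + b)%N.
      by rewrite h' ih//; lia.
    lia.
- by rewrite !momentE longitude_odd_cos longitude_odd_sin !mulr0.
- have [h _ _] := moment_rec a b c; have [_ h' _] := moment_rec c a b.
  apply: (mulfI (s0 (a + b + c)%N)); rewrite h [in RHS](_ : a + b + c = c + a + b)%N.
    by rewrite h' ih//; lia.
  lia.
Qed.

Lemma cycle_preserves_surface : preserves_surface (axis_cycle R).
Proof.
have hr := axis_cycle_SO3 R.
apply: preserves_surface_polynomial => // f [n].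
elim=> [//|e g h [a [b [c [abc ->]]]] Hh ih].
have Lh : L2 (surface R) h by apply: Poly_L2; exact: Hh.
have Lhr : L2 (surface R) (fun x => h (rotate (axis_cycle R) x)).
  by apply: Poly_L2; apply: Poly_rotate => //; exact: Hh.
have Lm := Poly_L2 (Poly_monomial a b c).
have Lm' := Poly_L2 (Poly_monomial c a b).
have E x : monomial a b c (rotate (axis_cycle R) x) = monomial c a b x.
  rewrite /monomial; have [-> -> ->] := rotate_cycle x.
  by rewrite mulrC mulrA.
under eq_Rintegral do rewrite E.
rewrite (L2_Rintegral_linear _ Lm' Lhr) (L2_Rintegral_linear _ Lm Lh) ih.
by have := moment_cycle a b c; rewrite /moment => ->.
Qed.

Definition north : sphere R := spherical_point (0, 0).

Lemma north_coords : [/\ north 0 0 = 0, north 1 0 = 0 & north 2%R 0 = 1].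
Proof. by rewrite !mxE /= sin0 cos0 !mul0r. Qed.

(** A rotation about the polar axis brings [x] to the meridian plane
    [x 1 0 = 0]; there a polar rotation conjugated by the cycle of the axes
    brings it to the pole. *)
Lemma rotate_to_north x : exists rho,
  [/\ rho \in SO3 R, preserves_surface rho & rotate rho x = north].
Proof.
have [C0 CP] := (axis_cycle_SO3 R, cycle_preserves_surface).
have [y [rho [rS rP rx y1]]] : exists y, exists rho,
    [/\ rho \in SO3 R, preserves_surface rho, rotate rho x = y & y 1 0 = 0].
  pose r := Num.sqrt (x 0 0 ^+ 2 + x 1 0 ^+ 2).
  have r2 : r ^+ 2 = x 0 0 ^+ 2 + x 1 0 ^+ 2 by rewrite sqr_sqrtr// addr_ge0// sqr_ge0.
  have [cs [cs1 E]] : exists cs : R * R, cs.1 ^+ 2 + cs.2 ^+ 2 = 1 /\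
      cs.2 * x 0 0 + cs.1 * x 1 0 = 0.
    have [r0|r0] := eqVneq r 0.
      exists (1, 0); rewrite expr1n expr0n addr0 mul0r add0r mul1r; split => //.
      apply/eqP; rewrite -sqrf_eq0; move: r2; rewrite r0 expr0n => /eqP.
      by rewrite eq_sym paddr_eq0 ?sqr_ge0// => /andP[].
    exists (x 0 0 / r, - (x 1 0 / r)) => /=; split.
      by rewrite sqrrN !expr_div_n -mulrDl -r2 divff// expf_neq0.
    by rewrite mulNr -mulrA mulrC; ring.
  exists (rotate (polar_rotation cs.1 cs.2) x), (polar_rotation cs.1 cs.2); split.
  - exact: polar_rotation_SO3.
  - exact: polar_preserves_surface.
  - by [].
  - by have [_ -> _] := rotate_polar x cs1.
pose C := axis_cycle R.
have yn := sphere_norm y; rewrite y1 expr0n addr0 in yn.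
have cs2 : y 2%R 0 ^+ 2 + (- y 0 0) ^+ 2 = 1 by rewrite sqrrN yn addrC subrK.
pose Q := polar_rotation (y 2%R 0) (- y 0 0).
have QS : Q \in SO3 R by exact: polar_rotation_SO3.
have QP : preserves_surface Q by exact: polar_preserves_surface.
exists (C *m (Q *m (C *m (C *m rho)))).
have S1 := SO3M C0 rS; have S2 := SO3M C0 S1; have S3 := SO3M QS S2.
split; first exact: SO3M C0 S3.
  exact: (preserves_surfaceM C0 S3 CP (preserves_surfaceM QS S2 QP
    (preserves_surfaceM C0 S1 CP (preserves_surfaceM C0 rS CP rP)))).
rewrite !rotateM// rx; apply: sphere_ext => i.
set z := rotate C (rotate C y).
have [z0 z1 z2] : [/\ z 0 0 = y 2%R 0, z 1 0 = y 0 0 & z 2%R 0 = y 1 0].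
  have [a0 a1 a2] := rotate_cycle (rotate C y); have [b0 b1 b2] := rotate_cycle y.
  by rewrite /z a0 a1 a2 b0 b1 b2.
have [q0 q1 q2] := rotate_polar z cs2; have [c0 c1 c2] := rotate_cycle (rotate Q z).
have [n0 n1 n2] := north_coords.
have [->|i0] := eqVneq i 0; first by rewrite c0 q1 z0 z1 n0; ring.
have [->|i1] := eqVneq i 1; first by rewrite c1 q2 z2 n1 y1.
have -> : i = 2%R by apply: val_inj; case: i i0 i1 => [[|[|[|//]]] ?].
by rewrite c2 q0 z0 z1 n2 -cs2; ring.
Qed.

End transitivity.

(** * The Funk-Hecke theorem *)

Section funk_hecke.
Context (R : realType).
Implicit Types (x y z : sphere R) (f g : sphere R -> R) (rho : 'M[R]_3).
Local Notation Y := (@sph_harmonic R).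
Local Notation ip := (ip (surface R)).
Local Notation north := (north R).

(** The reproducing kernel of the harmonics of degree [l]. *)
Definition zonal l x y : R :=
  \sum_(i < (2 * l).+1) Y l (order_of l i) x * Y l (order_of l i) y.

Definition repro L x y : R := \sum_(l < L.+1) zonal l x y.

Lemma zonalC l x y : zonal l x y = zonal l y x.
Proof. by apply: eq_bigr => i _; exact: mulrC. Qed.

Lemma repro0 x y : repro 0 x y = zonal 0 x y.
Proof. exact: big_ord1. Qed.

Lemma reproS L x y : repro L.+1 x y = repro L x y + zonal L.+1 x y.
Proof. exact: big_ord_recr. Qed.

Lemma Poly_zonal l x : Poly l (zonal l x).
Proof.
apply: lspan_sum => i; apply: lspan_scale; apply: Poly_harmonic; exact: order_ofP.
Qed.

Lemma Poly_repro L x : Poly L (repro L x).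
Proof.
by apply: lspan_sum => l; apply: Poly_le (Poly_zonal l x); rewrite -ltnS.
Qed.

Lemma ip_zonal l g x : L2 (surface R) g -> ip g (zonal l x) =
  \sum_(i < (2 * l).+1) Y l (order_of l i) x * ip g (Y l (order_of l i)).
Proof.
move=> Lg; rewrite ipC ip_suml//; last first.
  by move=> i; apply: L2Z; apply: L2_harmonic; exact: order_ofP.
apply: eq_bigr => i _; rewrite ipZl// 1?ipC//.
by apply: L2_harmonic; exact: order_ofP.
Qed.

Lemma ip_repro L f x : L2 (surface R) f -> ip f (repro L x) = harmonic_proj L f x.
Proof.
move=> Lf; rewrite ipC ip_suml//; last by move=> l; exact: Poly_L2 (Poly_zonal l x).
by apply: eq_bigr => l _; rewrite ipC ip_zonal.
Qed.

Lemma ip_rotate rho f g : rho \in SO3 R -> preserves_surface rho ->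
  L2 (surface R) f -> L2 (surface R) g ->
  L2 (surface R) (fun x => f (rotate rho x)) ->
  L2 (surface R) (fun x => g (rotate rho x)) ->
  ip (fun x => f (rotate rho x)) (fun x => g (rotate rho x)) = ip f g.
Proof.
move=> hr pr Lf Lg Lfr Lgr.
exact: (preserves_surface_integral hr pr (L2M_integrable Lf Lg) (L2M_integrable Lfr Lgr)).
Qed.

(** [repro L] is the reproducing kernel of the space of polynomials of degree
    at most [L]; this space is rotation invariant, and its kernel is unique. *)
Lemma repro_rotate L rho x y : rho \in SO3 R -> preserves_surface rho ->
  repro L (rotate rho x) (rotate rho y) = repro L x y.
Proof.
move=> hr pr; pose e y' := repro L (rotate rho x) (rotate rho y') - repro L x y'.
have PA : Poly L (fun y' => repro L (rotate rho x) (rotate rho y')).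
  exact: Poly_rotate (Poly_repro L _).
have Pe : Poly L e := lspan_sub PA (Poly_repro L x).
suff : e y = 0 by move/eqP; rewrite subr_eq0 => /eqP.
have key f : Poly L f -> ip e f = 0.
  move=> Pf; have Lf := Poly_L2 Pf.
  rewrite ipBl//; [|exact: Poly_L2 PA|exact: Poly_L2 (Poly_repro L x)].
  rewrite [X in _ - X]ipC ip_repro// harmonic_proj_id//.
  have PV : Poly L (fun z => f (rotate rho^T z)) by exact: Poly_rotate (SO3V hr) Pf.
  have fE : f = (fun z => f (rotate rho^T (rotate rho z))).
    by apply/funext => z; rewrite rotateK.
  have := @ip_rotate rho (repro L (rotate rho x)) (fun z => f (rotate rho^T z)) hr pr
    (Poly_L2 (Poly_repro L _)) (Poly_L2 PV) (Poly_L2 PA).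
  rewrite -fE => ->//; rewrite ipC ip_repro//; last exact: Poly_L2 PV.
  by rewrite harmonic_proj_id// rotateK// subrr.
rewrite -(harmonic_proj_id y Pe) /harmonic_proj big1// => l _.
rewrite big1// => i _; rewrite key ?mulr0//.
by apply: Poly_le (Poly_harmonic R (order_ofP i)); rewrite -ltnS.
Qed.

Lemma zonal_rotate l rho x y : rho \in SO3 R -> preserves_surface rho ->
  zonal l (rotate rho x) (rotate rho y) = zonal l x y.
Proof.
move=> hr pr; case: l => [|l].
  by rewrite -!repro0; exact: repro_rotate.
have := repro_rotate l.+1 x y hr pr.
by rewrite !reproS (repro_rotate l x y hr pr) => /addrI.
Qed.

Lemma zeta_north k : (0 < k)%N -> rzeta k north = 0 /\ izeta k north = 0.
Proof.
case: k => // k _; have [n0 n1 _] := north_coords R.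
by rewrite rzetaS izetaS n0 n1 !mul0r subr0 addr0.
Qed.

Lemma harmonic_north l m : m != 0 -> Y l m north = 0.
Proof.
move=> m0; rewrite sph_harmonicE.
have [-> ->] : rzeta `|m|%N north = 0 /\ izeta `|m|%N north = 0.
  by apply: zeta_north; rewrite absz_gt0.
by rewrite if_same mulr0.
Qed.

Lemma sum_order0 l (F : int -> R) :
  (forall m, (`|m| <= l)%N -> m != 0 -> F m = 0) ->
  \sum_(i < (2 * l).+1) F (order_of l i) = F 0.
Proof.
move=> F0; rewrite -(@sum_order_of R l 0 F)//; apply: eq_bigr => i _.
by have [<-|h] := eqVneq 0 (order_of l i); rewrite ?mul1r// mul0r F0 ?order_ofP// eq_sym.
Qed.

Lemma zonal_north l x : zonal l x north = Y l 0 x * Y l 0 north.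
Proof.
rewrite /zonal (@sum_order0 l (fun m => Y l m x * Y l m north))// => m _ m0.
by rewrite harmonic_north// mulr0.
Qed.

Lemma zonal_diag l x : zonal l x x = zonal l north north.
Proof. by have [rho [hr pr <-]] := rotate_to_north x; rewrite zonal_rotate. Qed.

(** Otherwise [zonal l] would vanish on the diagonal, where it is a sum of
    squares of all the harmonics of degree [l]. *)
Lemma harmonic_north_neq0 l : Y l 0 north != 0.
Proof.
apply/eqP => Y0; have L0 : L2 (surface R) (Y l 0) by apply: L2_harmonic.
have Yx x : Y l 0 x = 0.
  have : zonal l x x = 0 by rewrite zonal_diag zonal_north Y0 mulr0.
  have l0 : (`|0%R| <= l)%N by [].
  move/eqP; rewrite psumr_eq0; last by move=> i _; rewrite -expr2 sqr_ge0.
  move=> /allP h.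
  have := @sum_order_of R l 0 (fun m => Y l m x) l0 => <-.
  rewrite big1// => i _; have := h i; rewrite mem_index_enum => /(_ isT).
  by rewrite -expr2 sqrf_eq0 => /eqP ->; rewrite mulr0.
have := @harmonic_orthonormal R l 0 l 0 (leq0n _) (leq0n _).
rewrite !eqxx (_ : Y l 0 = fun=> 0) ?ip0l; last exact/funext.
by move/eqP; rewrite eq_sym oner_eq0.
Qed.

Lemma polar_rotation_north c s : c ^+ 2 + s ^+ 2 = 1 ->
  rotate (polar_rotation c s) north = north.
Proof.
move=> cs; have [e0 e1 e2] := rotate_polar north cs; have [n0 n1 n2] := north_coords R.
apply: sphere_ext => i.
have [->|i0] := eqVneq i 0; first by rewrite e0 n0 n1 !mulr0 subrr.
have [->|i1] := eqVneq i 1; first by rewrite e1 n0 n1 !mulr0 addr0.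
have -> : i = 2%R by apply: val_inj; case: i i0 i1 => [[|[|[|//]]] ?].
by rewrite e2.
Qed.

Section invariant_kernel.
Variables (k : sphere R -> sphere R -> R) (M : R).
Hypothesis mk : forall x, measurable_fun setT (k x).
Hypothesis kM : forall x y, `|k x y| <= M.
Hypothesis k_rotate : forall rho x y, rho \in SO3 R ->
  k (rotate rho x) (rotate rho y) = k x y.

Let Lk x : L2 (surface R) (k x).
Proof. exact: bounded_L2 (mk x) (kM x). Qed.

Lemma L2_rotate_kernel rho x : rho \in SO3 R ->
  L2 (surface R) (fun y => k x (rotate rho y)).
Proof.
move=> hr; apply: (@bounded_L2 _ _ _ _ _ M) => [|y]; last exact: kM.
exact: measurableT_comp (mk x) (measurable_rotate hr).
Qed.

(** The polar rotation of angle [pi / m] fixes [k north] but changes the sign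
    of the harmonics of order [m]. *)
Lemma kernel_north_order l m : (`|m| <= l)%N -> m != 0 -> ip (k north) (Y l m) = 0.
Proof.
move=> ml m0; pose a : R := pi / `|m|%N%:R.
have cs := cos2Dsin2 a; have hr := polar_rotation_SO3 cs.
have pr := polar_preserves_surface cs.
have mn : `|m|%N%:R != 0 :> R by rewrite pnatr_eq0 absz_eq0.
have w j : ((cos a +i* sin a) ^+ j = cos (j%:R * a) +i* sin (j%:R * a))%C.
  elim: j => [|j ih]; first by rewrite expr0 mul0r cos0 sin0.
  rewrite exprS ih -[j.+1%:R]natr1 mulrDl mul1r cosD sinD.
  by congr Complex => /=; ring.
have Yr x : Y l m (rotate (polar_rotation (cos a) (sin a)) x) = -1 * Y l m x.
  rewrite harmonic_polar// w /a [_ * (pi / _)]mulrC divfK// cospi sinpi /=.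
  by rewrite oppr0 if_same mul0r addr0.
have Lm := L2_harmonic R ml.
have := ip_rotate hr pr (Lk north) Lm (L2_rotate_kernel north hr).
have -> : (fun x => Y l m (rotate (polar_rotation (cos a) (sin a)) x)) = (fun x => -1 * Y l m x).
  by apply/funext => x; rewrite Yr.
have -> : (fun x => k north (rotate (polar_rotation (cos a) (sin a)) x)) = k north.
  by apply/funext => x; rewrite -{1}(polar_rotation_north cs) k_rotate.
move=> /(_ (L2Z _ Lm)); rewrite ipC ipZl// ipC.
by move=> h; lra.
Qed.

(** At the pole only the order 0 survives, by [kernel_north_order], so that
    [k north] acts on degree [l] as a multiple of the zonal kernel.
    Rotations carry this to every point, and the zonal kernel reproduces the
    harmonics. *)
Theorem funk_hecke l : exists lam, forall m x, (`|m| <= l)%N ->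
  ip (k x) (Y l m) = lam * Y l m x.
Proof.
pose lam := ip (k north) (Y l 0) / Y l 0 north; exists lam => m x ml.
have Lz z : L2 (surface R) (zonal l z) by exact: Poly_L2 (Poly_zonal l z).
have atN z : ip (k north) (zonal l z) = lam * zonal l north z.
  rewrite ip_zonal// (@sum_order0 l (fun m => Y l m z * ip (k north) (Y l m))); last first.
    by move=> j jl j0; rewrite kernel_north_order ?mulr0.
  rewrite zonalC zonal_north /lam; have := harmonic_north_neq0 l.
  by move: (Y l 0 north) (Y l 0 z) => a b a0; field.
have atx z : ip (k x) (zonal l z) = lam * zonal l x z.
  have [rho [hr pr rx]] := rotate_to_north x.
  have := ip_rotate hr pr (Lk north) (Lz (rotate rho z)) (L2_rotate_kernel north hr).
  have -> : (fun y => k north (rotate rho y)) = k x.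
    by apply/funext => y; rewrite -rx k_rotate.
  have -> : (fun y => zonal l (rotate rho z) (rotate rho y)) = zonal l z.
    by apply/funext => y; rewrite zonal_rotate.
  move=> /(_ (Lz z)) ->; rewrite atN -rx zonal_rotate//.
have Lm := L2_harmonic R ml.
have proj c : ip (fun z => \sum_(i < (2 * l).+1) c (order_of l i) * Y l (order_of l i) z)
    (Y l m) = c m.
  rewrite ip_suml//; last first.
    by move=> i; apply: L2Z; apply: L2_harmonic; exact: order_ofP.
  rewrite -(sum_order_of c ml); apply: eq_bigr => i _.
  rewrite ipZl ?harmonic_orthonormal ?order_ofP//; last first.
    by apply: L2_harmonic; exact: order_ofP.
  by rewrite eqxx/= mulrC eq_sym.
rewrite -(proj (fun m => ip (k x) (Y l m))) -(proj (fun m => lam * Y l m x)).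
congr (ip _ _); apply/funext => z.
transitivity (ip (k x) (zonal l z)).
  by rewrite ip_zonal//; apply: eq_bigr => i _; rewrite mulrC.
rewrite atx zonalC /zonal mulr_sumr; apply: eq_bigr => i _.
by move: (Y l _ z) (Y l _ x) => a b; ring.
Qed.

End invariant_kernel.
End funk_hecke.

(** * Completeness of the spherical harmonics *)

Section square_mean_convergence.
Context d (X : measurableType d) (R : realType).
Variable mu : {finite_measure set X -> \bar R}.

Lemma L2_dominated_cvg (f_ : nat -> X -> R) (f g : X -> R) :
  (forall n, measurable_fun setT (f_ n)) -> measurable_fun setT f -> L2 mu g ->
  (forall x, f_ n x @[n --> \oo] --> f x) ->
  (forall n x, `|f_ n x| <= g x) -> (forall x, `|f x| <= g x) ->
  ip mu (fun x => f x - f_ n x) (fun x => f x - f_ n x) @[n --> \oo] --> (0 : R).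
Proof.
move=> mf_ mf Lg cv bd_ bd; have Lf := L2_dominated mf Lg bd.
have Lfn n := L2B Lf (L2_dominated (mf_ n) Lg (bd_ n)).
have -> : (0 : R) = \int[mu]_x (0 : R) by rewrite /Rintegral integral0.
apply: (@Rintegral_dominated_cvg _ _ _ _ _ _ (fun x => 4 * g x ^+ 2)).
- by move=> n; apply: measurable_funM; exact: L2_measurable (Lfn n).
- exact: (integrableZl measurableT 4 (L2_sq_integrable Lg)).
- move=> n x; rewrite ger0_norm -?expr2 ?sqr_ge0//.
  rewrite -[leLHS]real_normK ?num_real//.
  have := ler_normB (f x) (f_ n x); have := bd_ n x; have := bd x.
  have := normr_ge0 (f x - f_ n x); nra.
- move=> x; have c0 : f x - f_ n x @[n --> \oo] --> (0 : R).
    by rewrite -(subrr (f x)); apply: cvgB; [exact: cvg_cst|exact: cv].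
  by rewrite -[X in _ --> X](mulr0 0); exact: cvgM.
Qed.

End square_mean_convergence.

Section density.
Context (R : realType).
Implicit Types (x y : sphere R) (f g : sphere R -> R).
Local Notation ip := (ip (surface R)).
Local Notation L2 := (L2 (surface R)).

Lemma polynomial_L2 f : polynomial f -> L2 f.
Proof. by move=> [n]; exact: Poly_L2. Qed.

Definition approximable f := L2 f /\ forall e : R, 0 < e ->
  exists p, polynomial p /\ ip (fun x => f x - p x) (fun x => f x - p x) < e.

Lemma approximable_closed f : L2 f ->
  (forall e : R, 0 < e -> exists g, approximable g /\
    ip (fun x => f x - g x) (fun x => f x - g x) < e) -> approximable f.
Proof.
move=> Lf h; split => // e e0; have e4 : 0 < e / 4 by rewrite divr_gt0.
have [g [[Lg /(_ _ e4)[p [Pp gp]]] fg]] := h _ e4.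
have Lp := polynomial_L2 Pp.
exists p; split => //.
have -> : (fun x => f x - p x) = (fun x => (f x - g x) + (g x - p x)).
  by apply/funext => x; ring.
by have := ipDD_le (L2B Lf Lg) (L2B Lg Lp); lra.
Qed.

Lemma approximable_polynomial p : polynomial p -> approximable p.
Proof.
move=> Pp; split; first exact: polynomial_L2.
move=> e e0; exists p; split => //.
rewrite (_ : (fun x => p x - p x) = fun=> 0) ?ip0l//.
by apply/funext => x; rewrite subrr.
Qed.

Lemma approximable_lin c f g : approximable f -> approximable g ->
  approximable (fun x => c * f x + g x).
Proof.
move=> [Lf hf] [Lg hg]; split; first exact: L2D (L2Z c Lf) Lg.
move=> e e0; have c0 : 0 < 4 * (c ^+ 2 + 1) by rewrite mulr_gt0// ltr_wpDl ?sqr_ge0.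
have ec : 0 < e / (4 * (c ^+ 2 + 1)) by rewrite divr_gt0.
have e4 : 0 < e / 4 by rewrite divr_gt0.
have [p [Pp fp]] := hf _ ec; have [q [Pq gq]] := hg _ e4.
exists (fun x => c * p x + q x); split.
  by apply: polynomial_add => //; exact: polynomial_scale.
have Lp := polynomial_L2 Pp; have Lq := polynomial_L2 Pq.
have -> : (fun x => c * f x + g x - (c * p x + q x)) =
    (fun x => c * (f x - p x) + (g x - q x)) by apply/funext => x; ring.
have Lfp := L2B Lf Lp.
have := ipDD_le (L2Z c Lfp) (L2B Lg Lq).
rewrite ipZl//; last exact: L2Z.
rewrite [ip (fun x => f x - p x) _]ipC ipZl//.
move: fp gq; rewrite ltr_pdivlMr//.
have := ip_ge0 (surface R) (fun x => f x - p x).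
move: (ip _ _) (ip _ _) (ip _ _) => u v w u0 fp gq hw.
have := sqr_ge0 c; nra.
Qed.

Lemma approximable_sub f g : approximable f -> approximable g ->
  approximable (fun x => f x - g x).
Proof.
move=> hf hg; have := approximable_lin (-1) hg hf.
by congr approximable; apply/funext => x; rewrite mulN1r addrC.
Qed.

Lemma approximable_cvg (f_ : nat -> sphere R -> R) f g :
  (forall n, approximable (f_ n)) -> measurable_fun setT f -> L2 g ->
  (forall x, f_ n x @[n --> \oo] --> f x) ->
  (forall n x, `|f_ n x| <= g x) -> (forall x, `|f x| <= g x) -> approximable f.
Proof.
move=> af_ mf Lg cv bd_ bd.
have Lf := L2_dominated mf Lg bd.
apply: approximable_closed => // e e0.
have mf_ n : measurable_fun setT (f_ n) by have [/L2_measurable] := af_ n.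
have /cvgrPdist_lt/(_ e e0)[n _ hn] := L2_dominated_cvg mf_ mf Lg cv bd_ bd.
exists (f_ n); split => //; have := hn n (leqnn n).
by rewrite /= sub0r normrN ger0_norm ?ip_ge0.
Qed.

Lemma indic_le1 (A : set (sphere R)) x : `|\1_A x : R| <= 1.
Proof. by rewrite indicE; case: (_ \in _); rewrite ?normr1 ?normr0. Qed.

(** Corners are limits of polynomials, and the pi-lambda theorem extends the
    property to all measurable sets. *)
Lemma approximable_indic (A : set (sphere R)) : measurable A -> approximable (\1_A).
Proof.
pose S := [set A : set (sphere R) | measurable A /\ approximable (\1_A)].
suff : measurable `<=` S by move=> + mA => /(_ _ mA)[].
rewrite corner_generates; apply: lambda_system_subset => //.
- exact: corner_setI.
- split => //.
  + split => //; have := approximable_polynomial (@polynomial_cst R 1).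
    by congr approximable; apply/funext => x; rewrite indicT.
  + move=> B A' BA [mB aB] [mA' aA]; split; first exact: measurableD.
    have := approximable_sub aB aA.
    congr approximable; apply/funext => x; rewrite !indicE in_setD.
    have [xA|xA] := boolP (x \in A'); last by rewrite subr0 andbT.
    by rewrite (_ : x \in B) ?subrr//; apply/mem_set/BA/set_mem.
  + move=> F ndF SF; have mF n : measurable (F n) by have [] := SF n.
    have mU : measurable (\bigcup_n F n) by exact: bigcup_measurable.
    split => //; apply: (@approximable_cvg (fun n => \1_(F n)) _ (fun=> 1)).
    * by move=> n; have [] := SF n.
    * exact: measurable_indic.
    * exact: L2_cst.
    * move=> x; rewrite [X in _ --> X]indicE.
      have [/set_mem[n _ Fnx]|xU] := boolP (x \in _).
        apply: cvg_near_cst; exists n => // m /= nm.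
        by rewrite indicE mem_set//; have /subsetPset := ndF n m nm; exact.
      apply: cvg_near_cst; apply: nearW => m; rewrite indicE memNset// => Fmx.
      by move: xU; rewrite notin_setE; apply; exists m.
    * by move=> n x; exact: indic_le1.
    * by move=> x; exact: indic_le1.
- move=> _ [t _ <-]; split; first exact: measurable_corner.
  apply: (@approximable_cvg (corner_approx t) _ (fun=> 1)).
  + by move=> n; apply: approximable_polynomial; exact: corner_approx_polynomial.
  + by apply: measurable_indic; exact: measurable_corner.
  + exact: L2_cst.
  + by move=> x; exact: cvg_corner_approx.
  + by move=> n x; have /andP[h0 h1] := corner_approx_itv t n x; rewrite ger0_norm.
  + by move=> x; exact: indic_le1.
Qed.

Import HBNNSimple.

Lemma approximable_ge0 f : L2 f -> (forall x, 0 <= f x) -> approximable f.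
Proof.
move=> Lf f0; have mf : measurable_fun setT (EFin \o f).
  by apply/measurable_EFinP; exact: (L2_measurable Lf).
have f0' x : setT x -> (0 <= (EFin \o f) x)%E by rewrite lee_fin.
pose h := nnsfun_approx measurableT mf.
have cvE x := cvg_nnsfun_approx measurableT mf f0' (x := x) Logic.I.
have cv x : h n x @[n --> \oo] --> f x by exact: (fine_cvg (cvE x)).
have hf n x : h n x <= f x.
  have nd : nondecreasing_seq (fun n => h n x).
    by move=> a b ab; exact/lefP/nd_nnsfun_approx.
  have := nondecreasing_cvgn_le nd (cvgP _ (cv x)) n.
  by rewrite (cvg_lim _ (cv x)).
apply: (@approximable_cvg (fun n => h n) _ f) => //; last 3 first.
- exact: (L2_measurable Lf).
- by move=> n x; rewrite ger0_norm.
- by move=> x; rewrite ger0_norm.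
move=> n; set g := h n.
have -> : (g : _ -> _) = (fun x =>
    \sum_(r <- finmap.enum_fset (fset_set (range g))) r * \1_(g @^-1` [set r]) x).
  by apply/funext => x; rewrite fimfunE fsbig_finite.
move: (finmap.enum_fset _) => s; elim: s => [|r s ih].
  have := approximable_polynomial (@polynomial_cst R 0).
  by congr approximable; apply/funext => x; rewrite big_nil.
have mr : measurable (g @^-1` [set r]) by exact: measurable_sfunP.
have := approximable_lin r (approximable_indic mr) ih.
by congr approximable; apply/funext => x; rewrite big_cons.
Qed.

Theorem polynomials_dense f : L2 f -> approximable f.
Proof.
move=> Lf; have mf := L2_measurable Lf.
have L2max (g : sphere R -> R) : L2 g -> L2 (fun x => Num.max (g x) 0).
  move=> Lg; apply: L2_dominated (L2_normr Lg) _ => [|x].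
    by apply: measurable_maxr; [exact: L2_measurable Lg|exact: measurable_cst].
  by case: (leP (g x) 0) => _; rewrite ?normr0.
have p : approximable (fun x => Num.max (f x) 0).
  by apply: approximable_ge0 => [|x]; [exact: L2max|rewrite le_max lexx orbT].
have m : approximable (fun x => Num.max (- f x) 0).
  apply: approximable_ge0 => [|x]; last by rewrite le_max lexx orbT.
  apply: (L2max (fun x => - f x)).
  have -> : (fun x => - f x) = (fun x => -1 * f x) by apply/funext => x; rewrite mulN1r.
  exact: L2Z.
have := approximable_sub p m; congr approximable; apply/funext => x.
by case: (leP (f x) 0) => f0; case: (leP (- f x) 0) => f1; lra.
Qed.

Lemma L2_harmonic_proj L f : L2 (harmonic_proj L f).
Proof.
apply: L2_sum => l; apply: L2_sum => i.
have := L2Z (ip f (sph_harmonic l (order_of l i))) (L2_harmonic R (order_ofP i)).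
by under eq_fun do rewrite mulrC.
Qed.

Lemma Poly_harmonic_proj L f : Poly L (harmonic_proj L f).
Proof.
apply: lspan_sum => l; apply: lspan_sum => i.
have := lspan_scale (ip f (sph_harmonic l (order_of l i))) (Poly_harmonic R (order_ofP i)).
move=> h; apply: (@Poly_le _ l); first by rewrite -ltnS.
by apply: lspan_ext h => x; exact: mulrC.
Qed.

Lemma ip_harmonic_proj L f g : L2 f -> L2 g ->
  ip (harmonic_proj L f) g = \sum_(l < L.+1) \sum_(i < (2 * l).+1)
    ip f (sph_harmonic l (order_of l i)) * ip g (sph_harmonic l (order_of l i)).
Proof.
move=> Lf Lg; have LY l (i : 'I_(2 * l).+1) := L2_harmonic R (order_ofP i).
have LcY l (i : 'I_(2 * l).+1) : L2 (fun x => sph_harmonic l (order_of l i) x *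
    ip f (sph_harmonic l (order_of l i))).
  by under eq_fun do rewrite mulrC; exact: L2Z.
rewrite ip_suml//; last by move=> l; exact: L2_sum.
apply: eq_bigr => l _; rewrite ip_suml//; apply: eq_bigr => i _.
under eq_fun do rewrite mulrC.
by rewrite ipZl// [ip g _]ipC.
Qed.

Lemma harmonic_residual_orthogonal L f q : L2 f -> Poly L q ->
  ip (fun x => f x - harmonic_proj L f x) q = 0.
Proof.
move=> Lf Pq; have Lq := Poly_L2 Pq.
rewrite ipBl//; last exact: L2_harmonic_proj.
have qE : harmonic_proj L q = q by apply/funext => x; rewrite harmonic_proj_id.
rewrite -{1}qE ipC !ip_harmonic_proj// -sumrB big1// => l _.
by rewrite -sumrB big1// => i _; rewrite mulrC subrr.
Qed.

(** The difference [p - harmonic_proj L f] is orthogonal to the residual of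
    [f]. *)
Lemma harmonic_proj_best L f p : L2 f -> Poly L p ->
  ip (fun x => f x - harmonic_proj L f x) (fun x => f x - harmonic_proj L f x) <=
  ip (fun x => f x - p x) (fun x => f x - p x).
Proof.
move=> Lf Pp; pose S := harmonic_proj L f; pose e x := f x - S x.
have LS : L2 S := L2_harmonic_proj L f; have Lp := Poly_L2 Pp.
have Le : L2 e := L2B Lf LS.
have Pq : Poly L (fun x => p x - S x) := lspan_sub Pp (Poly_harmonic_proj L f).
have -> : (fun x => f x - p x) = (fun x => e x - (p x - S x)).
  by apply/funext => x; rewrite /e; ring.
rewrite (ipBB Le (Poly_L2 Pq)) (harmonic_residual_orthogonal Lf Pq : ip e _ = 0).
by rewrite mulr0 subr0 lerDl ip_ge0.
Qed.

(** Compare with the polynomial [0] in [harmonic_proj_best]. *)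
Lemma harmonic_bessel L f : L2 f ->
  ip (fun x => f x - harmonic_proj L f x) (fun x => f x - harmonic_proj L f x) <= ip f f.
Proof.
move=> Lf; have := harmonic_proj_best Lf (Poly_cst L 0).
by have -> : (fun x => f x - 0) = f by apply/funext => x; rewrite subr0.
Qed.

Theorem harmonics_complete f : L2 f ->
  ip (fun x => f x - harmonic_proj L f x) (fun x => f x - harmonic_proj L f x)
    @[L --> \oo] --> (0 : R).
Proof.
move=> Lf; apply/cvgrPdist_lt => e e0; have [_ /(_ _ e0)[p [[n Pp] pe]]] := polynomials_dense Lf.
exists n => // L /= nL; rewrite sub0r normrN ger0_norm ?ip_ge0//.
by apply: le_lt_trans pe; apply: harmonic_proj_best => //; exact: Poly_le nL Pp.
Qed.

End density.

(** * Simple functions and Bochner integrals *)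

Section finitely_valued.
Context d (X : measurableType d) (R : realType).
Variable mu : {finite_measure set X -> \bar R}.

(** Simplicity without reference to a measure; for a finite measure it is
    [is_simple], by [is_simpleP]. *)
Definition finitely_valued (Z : Type) (s : X -> Z) :=
  finite_set (range s) /\ forall z, measurable (s @^-1` [set z]).

Lemma finitely_valued_preimage (Z : choiceType) (s : X -> Z) (B : set Z) :
  finitely_valued s -> measurable (s @^-1` B).
Proof.
move=> [fs ms]; rewrite (_ : _ @^-1` B = \bigcup_(z in range s `&` B) s @^-1` [set z]).
  by apply: fin_bigcup_measurable => //; exact: finite_setIl.
apply/seteqP; split => x /=; first by move=> Bx; exists (s x) => //; split => //; exists x.
by move=> [z [_ Bz] /= ->].
Qed.

Lemma finitely_valued_comp (Z W : choiceType) (s : X -> Z) (phi : Z -> W) :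
  finitely_valued s -> finitely_valued (phi \o s).
Proof.
move=> vs; split.
  rewrite (_ : range (phi \o s) = phi @` range s); last by rewrite image_comp.
  by apply: finite_image; case: vs.
by move=> w; rewrite comp_preimage; exact: finitely_valued_preimage.
Qed.

Lemma finitely_valued_pair (Z W : choiceType) (s : X -> Z) (t : X -> W) :
  finitely_valued s -> finitely_valued t -> finitely_valued (fun x => (s x, t x)).
Proof.
move=> [fs ms] [ft mt]; split.
  apply: (@sub_finite_set _ _ (range s `*` range t)); last exact: finite_setX.
  by move=> _ [x _ <-]; split; exists x.
move=> [z w]; rewrite (_ : _ @^-1` _ = s @^-1` [set z] `&` t @^-1` [set w]).
  exact: measurableI.
by apply/seteqP; split => x /=; [case=> -> ->|move=> [-> ->]].
Qed.

Lemma finitely_valued_cst (Z : Type) (z : Z) : finitely_valued (fun _ : X => z).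
Proof.
split; first by apply: (sub_finite_set _ (finite_set1 z)) => _ [x _ <-].
by move=> z'; rewrite preimage_cst; case: ifP.
Qed.

Lemma finitely_valued_sum (V : zmodType) (I : Type) (r : seq I) (F : I -> X -> V) :
  (forall i, finitely_valued (F i)) -> finitely_valued (fun x => \sum_(i <- r) F i x).
Proof.
move=> vF; elim: r => [|i r ih].
  by under eq_fun do rewrite big_nil; exact: finitely_valued_cst.
under eq_fun do rewrite big_cons.
exact: (finitely_valued_comp (fun q : V * V => q.1 + q.2) (finitely_valued_pair (vF i) ih)).
Qed.

Lemma finitely_valued_measurable (s : X -> R) : finitely_valued s -> measurable_fun setT s.
Proof. by move=> vs _ B mB; rewrite setTI; exact: finitely_valued_preimage. Qed.

Definition values (Z : choiceType) (s : X -> Z) : seq Z :=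
  finmap.enum_fset (fset_set (range s)).

Lemma mem_values (Z : choiceType) (s : X -> Z) x : finitely_valued s -> s x \in values s.
Proof.
move=> [fs _]; have : s x \in range s by apply/mem_set; exists x.
by rewrite -in_fset_set.
Qed.

Lemma uniq_values (Z : choiceType) (s : X -> Z) : uniq (values s).
Proof. exact: finmap.fset_uniq. Qed.

Definition mass (A : set X) : R := fine (mu A).

Lemma sum_values (Z : choiceType) (V : lmodType R) (s : X -> Z) (phi : Z -> V) x :
  finitely_valued s ->
  \sum_(z <- values s) (\1_(s @^-1` [set z]) x : R) *: phi z = phi (s x).
Proof.
move=> vs; rewrite (bigD1_seq (s x)) ?uniq_values ?mem_values//=.
rewrite indicE mem_set// scale1r big1 ?addr0// => z zsx.
rewrite indicE memNset ?scale0r// => sz.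
by move/eqP: zsx; apply; rewrite -sz.
Qed.

Lemma integrable_indic (A : set X) (c : R) : measurable A ->
  mu.-integrable setT (EFin \o (fun x => \1_A x * c : R)).
Proof.
move=> mA; apply: (@bounded_integrable _ _ _ _ _ `|c|).
  by apply: measurable_funM => //; exact: measurable_indic.
move=> x; rewrite normrM ler_piMl// indicE.
by case: (_ \in _); rewrite ?normr1 ?normr0.
Qed.

Lemma Rintegral_indicM (A : set X) (c : R) : measurable A ->
  \int[mu]_x (\1_A x * c) = mass A * c.
Proof.
move=> mA; rewrite RintegralZr//; last first.
  by have := integrable_indic 1 mA; apply: eq_integrable => // x _ /=; rewrite mulr1.
by rewrite /Rintegral integral_indic// setIT.
Qed.

Lemma mass_comp (Z W : choiceType) (s : X -> Z) (phi : Z -> W) w : finitely_valued s ->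
  mass ((phi \o s) @^-1` [set w]) =
  \sum_(z <- values s) mass (s @^-1` [set z]) * (phi z == w)%:R.
Proof.
move=> vs; have [_ ms] := vs.
under eq_bigr do rewrite -Rintegral_indicM//.
rewrite -Rintegral_sum; last by move=> z; exact: integrable_indic.
rewrite -[LHS]mulr1 -Rintegral_indicM; last first.
  by rewrite comp_preimage; exact: finitely_valued_preimage.
apply: eq_Rintegral => x _; rewrite mulr1.
rewrite [RHS](@sum_values _ R^o s (fun z => (phi z == w)%:R) x vs).
by rewrite indicE; congr (_%:R); congr nat_of_bool; apply/idP/eqP => [/set_mem//|h]; apply/mem_set.
Qed.

Lemma values_comp (Z W : choiceType) (s : X -> Z) (phi : Z -> W) z :
  finitely_valued s -> z \in values s -> phi z \in values (phi \o s).
Proof.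
move=> vs; have [fs _] := vs; have [fps _] := finitely_valued_comp phi vs.
rewrite /values => zs; have : z \in range s by rewrite -in_fset_set.
move=> /set_mem[x _ <-].
have : (phi \o s) x \in range (phi \o s) by apply/mem_set; exists x.
by rewrite -in_fset_set.
Qed.

(** The simple integral may be computed along any refinement of the partition
    into fibres; this is what makes it additive. *)
Lemma simple_integral_comp (Z : choiceType) (V : normedModType R) (s : X -> Z) (phi : Z -> V) :
  finitely_valued s ->
  simple_integral mu (phi \o s) = \sum_(z <- values s) mass (s @^-1` [set z]) *: phi z.
Proof.
move=> vs; have vps := finitely_valued_comp phi vs; have [fps _] := vps.
rewrite /simple_integral fsbig_finite//.
transitivity (\sum_(v <- values (phi \o s)) \sum_(z <- values s)
    (mass (s @^-1` [set z]) * (phi z == v)%:R) *: v).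
  by apply: eq_bigr => v _; rewrite -scaler_suml -mass_comp.
rewrite exchange_big/=; apply: eq_big_seq => z zs.
under eq_bigr do rewrite -scalerA.
rewrite -scaler_sumr; congr (_ *: _).
rewrite (bigD1_seq (phi z)) ?uniq_values ?values_comp//= eqxx scale1r big1 ?addr0// => v.
by rewrite eq_sym => /negbTE ->; rewrite scale0r.
Qed.

Lemma is_simpleP (V : normedModType R) (s : X -> V) : is_simple mu s <-> finitely_valued s.
Proof.
split=> [[fs ms _]|[fs ms]]; first by split.
by split => // v _; rewrite -ge0_fin_numE//; exact: fin_num_measure.
Qed.

Lemma simple_integralB (V : normedModType R) (s t : X -> V) :
  finitely_valued s -> finitely_valued t ->
  simple_integral mu (fun x => s x - t x) = simple_integral mu s - simple_integral mu t.
Proof.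
move=> vs vt; have vst := finitely_valued_pair vs vt.
rewrite (simple_integral_comp (fun p : V * V => p.1 - p.2) vst).
rewrite (simple_integral_comp (fun p : V * V => p.1) vst).
rewrite (simple_integral_comp (fun p : V * V => p.2) vst).
by rewrite -sumrB; apply: eq_bigr => z _; rewrite scalerBr.
Qed.

Lemma simple_integral_functional (V : normedModType R) (s : X -> V) (l : V -> R) :
  linear_for *%R l -> finitely_valued s ->
  l (simple_integral mu s) = \int[mu]_x l (s x).
Proof.
move=> ll vs; have [_ ms] := vs.
have l0 : l 0 = 0.
  by have := ll (-1) 0 0; rewrite scaler0 addr0 mulN1r addNr.
rewrite (simple_integral_comp id vs).
transitivity (\sum_(z <- values s) mass (s @^-1` [set z]) * l z).
  elim: (values s) => [|z r ih]; first by rewrite !big_nil.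
  by rewrite !big_cons ll ih.
under eq_bigr do rewrite -Rintegral_indicM//.
rewrite -Rintegral_sum; last by move=> z; exact: integrable_indic.
by apply: eq_Rintegral => x _; exact: (@sum_values _ R^o s l x vs).
Qed.

Lemma measurable_simple_comp (V : normedModType R) (s : X -> V) (g : V -> R) :
  finitely_valued s -> measurable_fun setT (fun x => g (s x)).
Proof.
move=> vs; apply: finitely_valued_measurable.
exact: (finitely_valued_comp (g : V -> R) vs).
Qed.

Lemma integrable_simple_comp (V : normedModType R) (s : X -> V) (g : V -> R) :
  finitely_valued s -> mu.-integrable setT (EFin \o (fun x => g (s x))).
Proof.
move=> vs; have [_ ms] := vs.
have := @integrable_sumr _ _ _ mu _ (values s) (fun z x => \1_(s @^-1` [set z]) x * g z : R).
move=> /(_ (fun z => integrable_indic _ (ms z))).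
by apply: eq_integrable => // x _ /=; congr EFin; exact: (@sum_values _ R^o s g x vs).
Qed.

Lemma simple_integral_norm (V : normedModType R) (s : X -> V) : finitely_valued s ->
  `|simple_integral mu s| <= \int[mu]_x `|s x|.
Proof.
move=> vs; have [_ ms] := vs.
rewrite (simple_integral_comp id vs); apply: le_trans (ler_norm_sum _ _ _) _.
under [leRHS]eq_Rintegral => x _.
  rewrite -[`|s x|](@sum_values _ R^o s (fun v => `|v|) x vs); over.
rewrite Rintegral_sum; last by move=> z; exact: integrable_indic.
apply: ler_sum => z _; rewrite normrZ [X in _ <= X]Rintegral_indicM// ger0_norm//.
by apply: fine_ge0; exact: measure_ge0.
Qed.

End finitely_valued.

(** The integral of a nonnegative function is the supremum over the simple
    functions below it, measurable or not. *)
Lemma ge0_integral_mono d (X : measurableType d) (R : realType)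
    (mu : {measure set X -> \bar R}) (f g : X -> \bar R) :
  (forall x, (0 <= f x)%E) -> (forall x, (f x <= g x)%E) ->
  (\int[mu]_x f x <= \int[mu]_x g x)%E.
Proof.
move=> f0 fg; have g0 x : (0 <= g x)%E by exact: le_trans (f0 x) (fg x).
rewrite !ge0_integralTE//; apply: ge_ereal_sup => _ [h hf <-].
by apply: ereal_sup_ubound; exists h => // x; exact: le_trans (hf x) (fg x).
Qed.

Section bochner_integral.
Context d (X : measurableType d) (R : realType).
Variable mu : {finite_measure set X -> \bar R}.

(** Completeness as a plain property, to be used for operators as well as
    for vectors. *)
Definition cauchy_complete (V : normedModType R) : Prop := forall u : nat -> V,
  (forall e : R, 0 < e -> exists N, forall n m, (N <= n)%N -> (N <= m)%N -> `|u n - u m| < e) ->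
  exists l : V, u n @[n --> \oo] --> l.

(** The simple integrals form a Cauchy sequence because the bounds [b n] tend to
    zero in mean. Bounds stand for the errors, which may fail to be measurable. *)
Lemma bochner_exists (V : normedModType R) (F : X -> V) (s : nat -> X -> V)
    (b : nat -> X -> R) (G : X -> R) :
  cauchy_complete V -> (forall n, finitely_valued (s n)) ->
  (forall n, measurable_fun setT (b n)) ->
  (forall n x, `|F x - s n x| <= b n x) -> (forall n x, b n x <= G x) ->
  mu.-integrable setT (EFin \o G) -> (forall x, b n x @[n --> \oo] --> (0 : R)) ->
  exists I, is_bochner mu F I.
Proof.
move=> cV vs mb Fb bG iG b0.
have bp n x : 0 <= b n x by exact: le_trans (normr_ge0 _) (Fb n x).
have ib n : mu.-integrable setT (EFin \o b n).
  by apply: dominated_integrable (mb n) iG _ => x; rewrite ger0_norm.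
have E0 : (\int[mu]_x (b n x)%:E)%E @[n --> \oo] --> 0%E.
  have := @dominated_convergence _ _ _ mu setT measurableT
    (fun n => EFin \o b n) (cst 0%E) (EFin \o G).
  case.
  - by move=> n; apply/measurable_EFinP.
  - exact: measurable_cst.
  - by apply: aeW => x _; apply/cvg_EFin; [exact: nearW|exact: b0].
  - exact: iG.
  - by apply: aeW => x n _ /=; rewrite lee_fin ger0_norm.
  by move=> _ _; rewrite integral0.
have R0 : \int[mu]_x b n x @[n --> \oo] --> (0 : R) by exact: (fine_cvg E0).
have bound n m : `|simple_integral mu (s n) - simple_integral mu (s m)| <=
    \int[mu]_x b n x + \int[mu]_x b m x.
  rewrite -simple_integralB//.
  have vnm : finitely_valued (fun x => s n x - s m x).
    exact: (finitely_valued_comp (fun p : V * V => p.1 - p.2)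
      (finitely_valued_pair (vs n) (vs m))).
  apply: le_trans (simple_integral_norm mu vnm) _.
  rewrite -RintegralD//; apply: le_Rintegral => //.
  - exact: (integrable_simple_comp mu (fun v => `|v|) vnm).
  - exact: (integrableD _ (ib n) (ib m)).
  - move=> x _; have := ler_normD (F x - s m x) (s n x - F x).
    rewrite (addrC (F x - s m x)) addrA subrK (distrC (s n x) (F x)) => h.
    by rewrite (le_trans h)// addrC lerD.
have [I hI] : exists I : V, simple_integral mu (s n) @[n --> \oo] --> I.
  apply: cV => e e0; have e2 : 0 < e / 2 by rewrite divr_gt0.
  have /cvgrPdist_lt/(_ _ e2)[N _ hN] := R0; exists N => n m Nn Nm.
  have hn := hN n Nn; have hm := hN m Nm; rewrite /= !sub0r !normrN in hn hm.
  apply: le_lt_trans (bound n m) _.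
  by have := ler_norm (\int[mu]_x b n x); have := ler_norm (\int[mu]_x b m x); lra.
exists I; exists s; split => //.
- by move=> n; apply/is_simpleP.
- apply: aeW => x; apply/cvgrPdist_lt => e e0.
  have /cvgrPdist_lt/(_ _ e0)[N _ hN] := b0 x; exists N => // n Nn.
  have := hN n Nn; rewrite /= sub0r normrN ger0_norm// => h.
  exact: le_lt_trans (Fb n x) h.
- apply: squeeze_cvge (cvg_cst _) E0; apply: nearW => n; apply/andP; split.
    by apply: integral_ge0 => x _; rewrite lee_fin.
  by apply: ge0_integral_mono => x; rewrite lee_fin.
Qed.

(** The functional commutes with the integrals of the simple approximations,
    and the error passes to the limit on both sides. *)
Lemma bochner_functional (V : normedModType R) (F : X -> V) I (l : V -> R) (C : R) :
  is_bochner mu F I -> linear_for *%R l -> (forall v, `|l v| <= C * `|v|) ->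
  measurable_fun setT (fun x => l (F x)) ->
  mu.-integrable setT (EFin \o (fun x => l (F x))) /\ \int[mu]_x l (F x) = l I.
Proof.
move=> [s [ss _ cv0 cvI]] ll lC mlF.
have vs n : finitely_valued (s n) by apply/is_simpleP.
have lB u v : l (u - v) = l u - l v.
  by rewrite addrC -scaleN1r ll mulN1r addrC.
pose D := `|C| + 1; have D0 : 0 < D by rewrite ltr_wpDl.
have lD v : `|l v| <= D * `|v|.
  apply: le_trans (lC v) _; rewrite ler_wpM2r//.
  by rewrite (le_trans (ler_norm C))// lerDl.
have ms n : measurable_fun setT (fun x => l (s n x)) by exact: measurable_simple_comp.
have mB n : measurable_fun setT (fun x => l (F x) - l (s n x)) by exact: measurable_funB.
have is_ n : mu.-integrable setT (EFin \o (fun x => l (s n x))).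
  exact: integrable_simple_comp.
have le n : (\int[mu]_x (D^-1 * `|l (F x) - l (s n x)|)%:E <=
             \int[mu]_x (`|F x - s n x|)%:E)%E.
  apply: ge0_integral_mono => x; rewrite lee_fin.
    by rewrite mulr_ge0// invr_ge0 ltW.
  by rewrite -lB mulrC ler_pdivrMr// mulrC.
have cvl : (\int[mu]_x (D^-1 * `|l (F x) - l (s n x)|)%:E)%E @[n --> \oo] --> 0%E.
  apply: squeeze_cvge (cvg_cst _) cv0; apply: nearW => n; rewrite le andbT.
  by apply: integral_ge0 => x _; rewrite lee_fin mulr_ge0// invr_ge0 ltW.
have mD n : measurable_fun setT (fun x => D^-1 * `|l (F x) - l (s n x)|).
  by apply: measurable_funM => //; apply: measurableT_comp.
have p0 n x : 0 <= D^-1 * `|l (F x) - l (s n x)| by rewrite mulr_ge0// invr_ge0 ltW.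
have [N _ hN] : \forall n \near \oo, (\int[mu]_x (D^-1 * `|l (F x) - l (s n x)|)%:E < 1)%E.
  apply: (cvl [set y | (y < 1)%E]); apply: open_nbhs_nbhs.
  by split; [exact: open_ereal_lt_ereal|exact: lte01].
have iD n : (N <= n)%N -> mu.-integrable setT (EFin \o (fun x => D^-1 * `|l (F x) - l (s n x)|)).
  move=> Nn; apply: nonneg_integrable => //.
  by apply: lt_le_trans (hN n Nn) _; rewrite leey.
have iA n : (N <= n)%N -> mu.-integrable setT (EFin \o (fun x => l (F x) - l (s n x))).
  move=> Nn; have := integrableZl measurableT D (iD n Nn) => h.
  apply: (@dominated_integrable _ _ _ _ _ (fun x => D * (D^-1 * `|l (F x) - l (s n x)|))) => //.
  by move=> x; rewrite mulrA mulfV ?mul1r// gt_eqF.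
have iF : mu.-integrable setT (EFin \o (fun x => l (F x))).
  have := integrableD measurableT (iA N (leqnn N)) (is_ N).
  by apply: eq_integrable => // x _ /=; rewrite -EFinD subrK.
split => //.
have cv1 : l (simple_integral mu (s n)) @[n --> \oo] --> l I.
  apply/cvgrPdist_lt => e e0; have eD : 0 < e / D by rewrite divr_gt0.
  have /cvgrPdist_lt/(_ _ eD)[M _ hM] := cvI; exists M => // n Mn.
  rewrite /= -lB; apply: le_lt_trans (lD _) _.
  by rewrite mulrC -ltr_pdivlMr//; exact: hM.
have cv2 : l (simple_integral mu (s n)) @[n --> \oo] --> \int[mu]_x l (F x).
  have cvr : \int[mu]_x (D^-1 * `|l (F x) - l (s n x)|) @[n --> \oo] --> (0 : R).
    exact: (fine_cvg cvl).
  apply/cvgrPdist_lt => e e0; have eD : 0 < e / D by rewrite divr_gt0.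
  have /cvgrPdist_lt/(_ _ eD)[M _ hM] := cvr; exists (maxn N M) => // n /=.
  rewrite geq_max => /andP[Nn Mn].
  rewrite (simple_integral_functional mu ll (vs n)) -RintegralB//.
  apply: le_lt_trans (le_normr_Rintegral measurableT (iA n Nn)) _.
  have := hM n Mn; rewrite /= sub0r normrN RintegralZl//; last first.
    have := integrableZl measurableT D (iD n Nn).
    by apply: eq_integrable => // x _ /=; rewrite -EFinM mulrA mulfV ?mul1r// gt_eqF.
  rewrite normrM gtr0_norm ?invr_gt0// mulrC ltr_pdivrMr// divfK ?gt_eqF//.
  exact: le_lt_trans (ler_norm _).
exact: cvg_unique cv2 cv1.
Qed.

End bochner_integral.

(** * Hilbert spaces *)

Section hilbert.
Context (R : realType) (H : hilbertType R).
Implicit Types (u v w h : H).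

Lemma innerZr (c : R) u v : inner u (c *: v) = c * inner u v.
Proof. by rewrite innerC innerZl (innerC u). Qed.

Lemma innerBl u v w : inner (u - v) w = inner u w - inner v w.
Proof. by rewrite innerDl innerNl. Qed.

Lemma innerBr u v w : inner u (v - w) = inner u v - inner u w.
Proof. by rewrite innerC innerBl !(innerC u). Qed.

Lemma sqr_normB u v : `|u - v| ^+ 2 = `|u| ^+ 2 - 2 * inner u v + `|v| ^+ 2.
Proof. by rewrite -!innerxx !(innerBl, innerBr) (innerC v u); ring. Qed.

Lemma inner_ext u v : (forall w, inner u w = inner v w) -> u = v.
Proof.
move=> uv; apply/eqP; rewrite -subr_eq0 -normr_eq0 -sqrf_eq0 -innerxx.
by rewrite innerBl uv subrr.
Qed.

Lemma cauchy_schwarz u v : `|inner u v| <= `|u| * `|v|.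
Proof.
have [->|u0] := eqVneq u 0; first by rewrite inner0l !normr0 mul0r.
have nu : 0 < `|u| by rewrite normr_gt0.
have ee : inner (`|u|^-1 *: u) (`|u|^-1 *: u) = 1.
  by rewrite innerxx normrZ normfV normr_id mulVf ?expr1n// gt_eqF.
have /(bessel v) : orthonormal_seq [:: `|u|^-1 *: u] by case=> [|i] [|j].
rewrite big_seq1 innerZl exprMn exprVn mulrC ler_pdivrMr ?exprn_gt0//.
rewrite -exprMn -(ler_sqr (x := `|inner u v|)) ?nnegrE ?mulr_ge0//.
by rewrite real_normK ?num_real// mulrC.
Qed.

Lemma inner_cvg (F : nat -> H) u v : F n @[n --> \oo] --> u ->
  inner (F n) v @[n --> \oo] --> inner u v.
Proof.
move=> Fu; apply/cvgrPdist_lt => e e0.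
have d0 : 0 < e / (`|v| + 1) by rewrite divr_gt0// ltr_wpDl.
have /cvgrPdist_lt/(_ _ d0)[N _ hN] := Fu; exists N => // n /hN /= h.
rewrite -innerBl; apply: le_lt_trans (cauchy_schwarz _ _) _.
rewrite ltr_pdivlMr ?ltr_wpDl// in h; apply: le_lt_trans h.
by rewrite ler_wpM2l// lerDl.
Qed.

Lemma hilbert_complete : cauchy_complete H.
Proof.
move=> u uC; suff /cauchy_cvgP h : cauchy (u n @[n --> \oo]).
  by exists (lim (u n @[n --> \oo])).
apply/cauchy_exP => e e0; have [N hN] := uC e e0; exists (u N).
by exists N => // n Nn; rewrite /= -ball_normE /=; exact: hN.
Qed.

(** * Orthonormal systems padded with zeros *)

(** Vectors of a frame are pairwise orthogonal, of length one or zero: allowing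
    zeros covers finite and infinite dimension at once. *)
Definition frame (e : nat -> H) : Prop :=
  [/\ forall i j, i != j -> inner (e i) (e j) = 0,
      forall i, inner (e i) (e i) *: e i = e i &
      forall h, \sum_(k < n) inner h (e k) *: e k @[n --> \oo] --> h].

(** For a frame, the orthogonal projection onto the span of the first [n]
    vectors. *)
Definition truncate (e : nat -> H) n h := \sum_(k < n) inner h (e k) *: e k.

Section truncation.
Variable e : nat -> H.
Hypothesis eo : forall i j, i != j -> inner (e i) (e j) = 0.
Hypothesis e1 : forall i, inner (e i) (e i) *: e i = e i.

Lemma inner_unit h i : inner h (e i) * inner (e i) (e i) = inner h (e i).
Proof. by rewrite mulrC -innerZr e1. Qed.

Lemma inner_truncate n h i : inner (truncate e n h) (e i) = (i < n)%:R * inner h (e i).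
Proof.
rewrite inner_suml; have [ltin|lein] := ltnP i n; last first.
  rewrite mul0r big1// => k _; rewrite innerZl eo ?mulr0//.
  by rewrite neq_ltn (leq_trans (ltn_ord k) lein).
rewrite mul1r (bigD1 (Ordinal ltin))//= innerZl inner_unit big1 ?addr0// => k ki.
by rewrite innerZl eo ?mulr0.
Qed.

Lemma inner_truncateE n h u :
  inner (truncate e n h) u = \sum_(k < n) inner h (e k) * inner u (e k).
Proof. by rewrite inner_suml; apply: eq_bigr => k _; rewrite innerZl (innerC u). Qed.

Lemma truncate_sqr n h : `|truncate e n h| ^+ 2 = \sum_(k < n) inner h (e k) ^+ 2.
Proof.
rewrite -innerxx inner_truncateE; apply: eq_bigr => k _.
by rewrite inner_truncate ltn_ord mul1r expr2.
Qed.

Lemma truncate_residual_sqr n h :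
  `|h - truncate e n h| ^+ 2 = `|h| ^+ 2 - \sum_(k < n) inner h (e k) ^+ 2.
Proof.
rewrite sqr_normB truncate_sqr innerC inner_truncateE.
by under eq_bigr do rewrite -expr2; ring.
Qed.

Lemma frame_bessel n h : \sum_(k < n) inner h (e k) ^+ 2 <= `|h| ^+ 2.
Proof. by rewrite -subr_ge0 -truncate_residual_sqr sqr_ge0. Qed.

Lemma truncate_residual_le n h : `|h - truncate e n h| <= `|h|.
Proof.
rewrite -ler_sqr ?nnegrE// truncate_residual_sqr gerBl.
by apply: sumr_ge0 => k _; exact: sqr_ge0.
Qed.

Lemma truncate_le n h : `|truncate e n h| <= `|h|.
Proof. by rewrite -ler_sqr ?nnegrE// truncate_sqr frame_bessel. Qed.

Lemma truncateB n u v : truncate e n (u - v) = truncate e n u - truncate e n v.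
Proof.
by rewrite /truncate -sumrB; apply: eq_bigr => k _; rewrite innerBl scalerBl.
Qed.

Lemma norm_frame i : `|e i| <= 1.
Proof.
have [->|n0] := eqVneq (e i) 0; first by rewrite normr0.
have := congr1 (fun h => inner h (e i)) (e1 i); rewrite /= innerZl innerxx.
move=> h; have : `|e i| ^+ 2 = 1.
  by apply: (mulfI (x := `|e i| ^+ 2)); rewrite ?mulr1// expf_neq0// normr_eq0.
by move=> /eqP; rewrite sqrf_eq1 => /orP[/eqP->//|/eqP h1]; rewrite h1; lra.
Qed.

End truncation.

Lemma frame_parseval e u v : frame e ->
  \sum_(k < n) inner u (e k) * inner v (e k) @[n --> \oo] --> inner u v.
Proof.
move=> fe; have [_ _ /(_ u) eu] := fe; have := inner_cvg (v := v) eu.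
by under eq_fun do rewrite -/(truncate e _ u) inner_truncateE.
Qed.

(** * Gram-Schmidt *)

Definition dense_seq (V : normedModType R) (d : nat -> V) :=
  forall (h : V) (r : R), 0 < r -> exists n, `|h - d n| < r.

Lemma separable_dense_seq : separable_space H -> exists d, dense_seq (d : nat -> H).
Proof.
move=> [D cD dD]; have /countable_injP[f fi] := cD.
pose d n := xget (0 : H) (D `&` f @^-1` [set n]); exists d => h r r0.
have [x [hx Dx]] : ball h r `&` D !=set0.
  by apply: dD; [exists h; exact: ballxx|exact: ball_open].
exists (f x); rewrite (_ : d _ = x); first by rewrite -ball_normE in hx.
rewrite /d; case: xgetP => [y -> [Dy /= fy]|/(_ x)[]//].
by apply: fi; rewrite ?inE.
Qed.

Section gram_schmidt.
Variable d : nat -> H.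

(** When the residual [r] is zero so is [`|r|^-1 *: r]: dependent vectors
    are replaced by zeros. *)
Fixpoint gs_seq n : seq H := if n is n'.+1 then
  let r := d n' - \sum_(e <- gs_seq n') inner (d n') e *: e in
  rcons (gs_seq n') (`|r|^-1 *: r) else [::].

Definition gs n := nth 0 (gs_seq n.+1) n.

Lemma size_gs n : size (gs_seq n) = n.
Proof. by elim: n => //= n ih; rewrite size_rcons ih. Qed.

Lemma gs_seqE n : gs_seq n = [seq gs k | k <- iota 0 n].
Proof.
elim: n => // n ih; rewrite -addn1 iotaD map_cat -ih addn1 /= cats1 add0n.
by congr rcons; rewrite /gs /= nth_rcons size_gs ltnn eqxx.
Qed.

Definition gs_residual n := d n - truncate gs n (d n).

Lemma gsE n : gs n = `|gs_residual n|^-1 *: gs_residual n.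
Proof.
rewrite {1}/gs /= nth_rcons size_gs ltnn eqxx gs_seqE big_map.
by rewrite /gs_residual /truncate -(big_mkord xpredT (fun k => inner (d n) (gs k) *: gs k))
  /index_iota subn0.
Qed.

Lemma gs_unit i : inner (gs i) (gs i) *: gs i = gs i.
Proof.
have [r0|r0] := eqVneq (gs_residual i) 0; first by rewrite gsE r0 !scaler0.
rewrite {1 2}gsE.
by rewrite innerxx normrZ normfV normr_id mulVf ?normr_eq0// expr1n scale1r.
Qed.

Lemma gs_orthogonal_lt i j : (i < j)%N -> inner (gs j) (gs i) = 0.
Proof.
elim/ltn_ind: j i => j ih i ij; rewrite gsE innerZl /gs_residual innerBl.
rewrite inner_suml (bigD1 (Ordinal ij))//= innerZl inner_unit; last exact: gs_unit.
rewrite big1 ?addr0 ?subrr ?mulr0// => k ki; rewrite innerZl.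
have /negbTE {}ki : (k : nat) != i by [].
have [lt|gt|eq] := ltngtP k i.
- by rewrite (innerC (gs k)) (ih i ij)// mulr0.
- by rewrite (ih k (ltn_ord k))// mulr0.
- by rewrite eq eqxx in ki.
Qed.

Lemma gs_orthogonal i j : i != j -> inner (gs i) (gs j) = 0.
Proof.
by rewrite neq_ltn => /orP[/gs_orthogonal_lt|/gs_orthogonal_lt//]; rewrite innerC.
Qed.

Lemma truncate_gs n m : (n < m)%N -> truncate gs m (d n) = d n.
Proof.
move=> nm.
have base : truncate gs n.+1 (d n) = d n.
  rewrite /truncate big_ord_recr /= -/(truncate gs n (d n)).
  have rn : inner (d n) (gs n) = inner (gs_residual n) (gs n).
    rewrite /gs_residual innerBl inner_truncate ?ltnn ?mul0r ?subr0//.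
      exact: gs_orthogonal.
    exact: gs_unit.
  rewrite rn {2}gsE scalerA gsE innerZr innerxx.
  have [r0|r0] := eqVneq (gs_residual n) 0.
    by rewrite r0 scaler0 addr0; move/eqP: r0; rewrite subr_eq0 => /eqP.
  have nr0 : `|gs_residual n| != 0 by rewrite normr_eq0.
  have -> : `|gs_residual n|^-1 * `|gs_residual n| ^+ 2 / `|gs_residual n| = 1.
    by field.
  by rewrite scale1r /gs_residual addrC subrK.
apply/eqP; rewrite eq_sym -subr_eq0 -normr_eq0 -sqrf_eq0 eq_le sqr_ge0 andbT.
rewrite truncate_residual_sqr; [|exact: gs_orthogonal|exact: gs_unit].
have := truncate_residual_sqr gs_orthogonal gs_unit n.+1 (d n).
rewrite base subrr normr0 expr0n /= => h.
rewrite -(subnKC nm) big_split_ord /= -[_ + \sum_(_ < m - _) _]addrC opprD addrCA -h addr0.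
by rewrite oppr_le0 sumr_ge0// => k _; exact: sqr_ge0.
Qed.

(** Since [d n] is fixed by the later truncations, [h] and [h - d n] have
    the same residual. *)
Lemma gs_frame : dense_seq d -> frame gs.
Proof.
move=> dd; split; [exact: gs_orthogonal|exact: gs_unit|move=> h].
apply/cvgrPdist_lt => r r0; have [n hn] := dd h r r0; exists n.+1 => // m nm /=.
rewrite -/(truncate gs m h); apply: le_lt_trans hn.
have -> : h - truncate gs m h = (h - d n) - truncate gs m (h - d n).
  by rewrite truncateB truncate_gs// opprB addrA subrK.
by apply: truncate_residual_le; [exact: gs_orthogonal|exact: gs_unit].
Qed.

End gram_schmidt.

Lemma separable_frame : separable_space H -> exists e, frame e.
Proof.
by move=> /separable_dense_seq[d /gs_frame fe]; exists (gs d).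
Qed.

(** * Hilbert-Schmidt operators *)

Definition hs_linear (A : hs_op H) : linear A := proj1 (hs_predP _ (hs_funP A)).

Lemma hs_apply_le (A : hs_op H) v : `|A v| <= hs_norm A * `|v|.
Proof.
have AZ (c : R) (x : H) : A (c *: x) = c *: A x.
  have A00 : A 0 = 0 by have := hs_linear A (-1) 0 0; rewrite scaler0 addr0 scaleN1r addNr.
  by have := hs_linear A c x 0; rewrite addr0 A00 addr0.
have [->|v0] := eqVneq v 0.
  by have := AZ 0 0; rewrite !scale0r => ->; rewrite !normr0 mulr0.
have nv : 0 < `|v| by rewrite normr_gt0.
have ee : inner (`|v|^-1 *: v) (`|v|^-1 *: v) = 1.
  by rewrite innerxx normrZ normfV normr_id mulVf ?expr1n// gt_eqF.
have /(hs_norm_ub A) : orthonormal_seq [:: `|v|^-1 *: v] by case=> [|i] [|j].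
rewrite big_seq1 ler_sqr ?nnegrE ?hs_norm_ge0// AZ normrZ normfV normr_id.
by rewrite ler_pdivrMl// mulrC.
Qed.

Lemma hs_ext (A B : hs_op H) :
  (forall v u, inner (A v) u = inner (B v) u) -> A = B.
Proof.
move=> AB; apply: val_inj; apply/funext => v.
by apply: inner_ext => u; exact: AB.
Qed.

Lemma hs_coef_linear v u : linear_for *%R (fun A : hs_op H => inner (A v) u).
Proof. by move=> c A B; rewrite -innerZl -innerDl. Qed.

Lemma hs_coef_le v u (A : hs_op H) : `|inner (A v) u| <= (`|v| * `|u|) * `|A|.
Proof.
apply: le_trans (cauchy_schwarz _ _) _; rewrite mulrAC ler_wpM2r//.
by rewrite mulrC; exact: hs_apply_le.
Qed.

Lemma tensor_norm u v : `|tensor u v| <= `|u| * `|v|.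
Proof.
apply: hs_norm_le => [|s os]; first by rewrite mulr_ge0.
rewrite exprMn mulrC; apply: le_trans (ler_wpM2r (sqr_ge0 _) (bessel v os)).
rewrite mulr_suml; apply: ler_sum => f _.
by rewrite normrZ exprMn real_normK// num_real.
Qed.

Lemma tensor_coef u v f g : inner (tensor u v f) g = inner u g * inner v f.
Proof. by rewrite innerZl mulrC (innerC f). Qed.

(** The limit is taken at each vector; for each finite orthonormal system
    the Cauchy estimate passes to the limit. *)
Lemma hs_complete : cauchy_complete (hs_op H).
Proof.
move=> A AC.
have vC v : exists l : H, A n v @[n --> \oo] --> l.
  apply: hilbert_complete => e e0.
  have d0 : 0 < e / (`|v| + 1) by rewrite divr_gt0// ltr_wpDl.
  have [N hN] := AC _ d0; exists N => n m Nn Nm; have := hN n m Nn Nm.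
  rewrite ltr_pdivlMr ?ltr_wpDl// => h; apply: le_lt_trans h.
  apply: le_trans (hs_apply_le (A n - A m) v) _.
  by rewrite ler_wpM2l ?hs_norm_ge0// lerDl.
pose B v := xget 0 [set l | A n v @[n --> \oo] --> l].
have BP v : A n v @[n --> \oo] --> B v.
  rewrite /B; case: xgetP => // /(_ _) h.
  by have [l hl] := vC v; case: (h l).
have Bl : linear B.
  move=> c u v; apply: (cvg_unique _ (BP (c *: u + v))); first exact: norm_hausdorff.
  rewrite /=; under eq_fun do rewrite hs_linear.
  by apply: cvgD; [exact: cvgZl_tmp|exact: BP].
have key (e : R) N : 0 < e -> (forall n m, (N <= n)%N -> (N <= m)%N -> `|A n - A m| < e) ->
    forall n, (N <= n)%N -> forall s, orthonormal_seq s ->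
    \sum_(f <- s) `|B f - A n f| ^+ 2 <= e ^+ 2.
  move=> e0 hN n Nn s os.
  have cv : \sum_(f <- s) `|A m f - A n f| ^+ 2 @[m --> \oo] --> \sum_(f <- s) `|B f - A n f| ^+ 2.
    elim: s {os} => [|f s ih]; first by rewrite big_nil;
      under eq_fun do rewrite big_nil; exact: cvg_cst.
    rewrite big_cons; under eq_fun do rewrite big_cons.
    apply: cvgD => //; rewrite expr2; under eq_fun do rewrite expr2.
    have c1 : `|A m f - A n f| @[m --> \oo] --> `|B f - A n f|.
      by apply: cvg_norm; apply: cvgB; [exact: BP|exact: cvg_cst].
    exact: cvgM.
  apply: (cvgr_to_le cv); exists N => // m Nm /=.
  apply: le_trans (hs_norm_ub (A m - A n) os) _.
  by rewrite ler_sqr ?nnegrE ?hs_norm_ge0 ?(ltW e0)// ltW//; exact: hN.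
have [N1 hN1] := AC 1 ltr01.
have DP N : (N1 <= N)%N -> (fun v => B v - A N v) \in @hs_pred R H.
  move=> NN; apply/hs_predP; split.
    by move=> c u v; rewrite Bl hs_linear scalerBr opprD addrACA.
  apply: (@le_lt_trans _ _ (1 ^+ 2)%:E); last exact: ltry.
  apply: ge_ereal_sup => _ [s os <-]; rewrite lee_fin.
  exact: key ltr01 hN1 _ NN _ os.
pose L := A N1 + HSOp (DP N1 (leqnn N1)).
have LE v : L v = B v by rewrite -[RHS](subrK (A N1 v)) addrC.
exists L; apply/cvgrPdist_lt => e e0; have e2 : 0 < e / 2 by rewrite divr_gt0.
have [N hN] := AC _ e2; exists N => // n Nn /=.
apply: (@le_lt_trans _ _ (e / 2)); last by rewrite ltr_pdivrMr// ltr_pMr// ltr1n.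
apply: hs_norm_le; first exact: ltW.
move=> s os; apply: le_trans (key _ _ e2 hN n Nn s os).
by apply: ler_sum => f _; rewrite -LE.
Qed.

End hilbert.

(** * Bochner integrals of vectors and tensors *)

Section vector_measurability.
Context d (X : measurableType d) (R : realType) (H : hilbertType R).
Implicit Types f g : X -> H.

(** Measurability is tested through the inner products, where all real-valued
    closure properties are available; on a separable space this is Borel
    measurability (Pettis). *)
Definition weakly_measurable f :=
  forall u, measurable_fun setT (fun x => inner (f x) u).

Lemma borel_weakly_measurable f :
  measurable_fun setT (f : X -> borel H) -> weakly_measurable f.
Proof.
move=> mf u; apply: (measurability _ (RGenOInfty.measurableE R)).
move=> _ [_ [a ->] <-]; rewrite setTI.
pose U := [set h : H | a < inner h u].
rewrite (_ : _ @^-1` _ = (f : X -> borel H) @^-1` U); last first.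
  by apply/seteqP; split => x /=; rewrite in_itv/= andbT.
rewrite -[X in measurable X]setTI; apply: mf => //; apply: sub_sigma_algebra.
rewrite openE => h; rewrite /U /= => ah.
have u1 : 0 < `|u| + 1 by rewrite ltr_wpDl.
apply/nbhs_ballP; exists ((inner h u - a) / (`|u| + 1)).
  by rewrite /= divr_gt0 ?subr_gt0.
move=> v; rewrite -ball_normE /= (ltr_pdivlMr _ _ u1) => hv.
have : inner (h - v) u < inner h u - a.
  apply: le_lt_trans hv; apply: le_trans (ler_norm _) _.
  by apply: le_trans (cauchy_schwarz _ _) _; rewrite ler_wpM2l// lerDl.
by rewrite innerBl; lra.
Qed.

Lemma weakly_measurable_cst h : weakly_measurable (fun=> h).
Proof. by move=> u; exact: measurable_cst. Qed.

Lemma weakly_measurableZ (c : X -> R) f : measurable_fun setT c ->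
  weakly_measurable f -> weakly_measurable (fun x => c x *: f x).
Proof.
by move=> mc mf u; under eq_fun do rewrite innerZl; exact: measurable_funM.
Qed.

Lemma weakly_measurableB f g : weakly_measurable f -> weakly_measurable g ->
  weakly_measurable (fun x => f x - g x).
Proof.
by move=> mf mg u; under eq_fun do rewrite innerBl; exact: measurable_funB.
Qed.

Lemma weakly_measurable_sum (I : Type) (r : seq I) (F : I -> X -> H) :
  (forall i, weakly_measurable (F i)) -> weakly_measurable (fun x => \sum_(i <- r) F i x).
Proof.
move=> mF u; under eq_fun do rewrite inner_suml.
by apply: measurable_sum => i; exact: mF.
Qed.

Hypothesis sep : separable_space H.

Lemma weakly_measurable_inner f g : weakly_measurable f -> weakly_measurable g ->
  measurable_fun setT (fun x => inner (f x) (g x)).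
Proof.
move=> mf mg; have [e fe] := separable_frame sep.
apply: (@measurable_fun_cvg _ _ _ _ (fun n x =>
  \sum_(k < n) inner (f x) (e k) * inner (g x) (e k))).
  by move=> n; apply: measurable_sum => k; exact: measurable_funM.
by move=> x _; exact: frame_parseval.
Qed.

Lemma weakly_measurable_sqr f : weakly_measurable f ->
  measurable_fun setT (fun x => `|f x| ^+ 2).
Proof.
by move=> mf; under eq_fun do rewrite -innerxx; exact: weakly_measurable_inner.
Qed.

Lemma weakly_measurable_norm f : weakly_measurable f ->
  measurable_fun setT (fun x => `|f x|).
Proof.
move=> mf; rewrite (_ : (fun x => _) = Num.sqrt \o (fun x => `|f x| ^+ 2)).
  apply: measurableT_comp (weakly_measurable_sqr mf).
  exact: continuous_measurable_fun (@sqrt_continuous R).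
by apply/funext => x /=; rewrite sqrtr_sqr normr_id.
Qed.

Lemma weakly_measurable_dist f h : weakly_measurable f ->
  measurable_fun setT (fun x => `|f x - h|).
Proof.
move=> mf; apply: weakly_measurable_norm; apply: weakly_measurableB mf _.
exact: weakly_measurable_cst.
Qed.

(** An open set is a countable union of balls centred on a dense sequence,
    and the distance to a point is measurable by Parseval's identity. *)
Lemma weakly_measurable_borel f : weakly_measurable f ->
  measurable_fun setT (f : X -> borel H).
Proof.
move=> mf; have [q dq] := separable_dense_seq sep.
apply: (@measurability _ _ X (borel H) _ _ (@open H)) => // _ [U oU <-].
rewrite setTI.
pose small i (k : nat) := ball (q i) k.+1%:R^-1 `<=` U.
rewrite (_ : f @^-1` U = \bigcup_i \bigcup_(k in [set k | small i k])
    (fun x => `|f x - q i|) @^-1` `]-oo, k.+1%:R^-1[%classic).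
  apply: bigcup_measurable => i _; apply: bigcup_measurable => k _.
  by rewrite -[X in measurable X]setTI; exact: weakly_measurable_dist.
apply/seteqP; split => x /=; last first.
  by move=> [i _ [k sk]] /=; rewrite in_itv/= distrC => h; apply: sk; rewrite -ball_normE.
move=> Ux; move: oU; rewrite openE => /(_ _ Ux)/nbhs_ballP[r /= r0 rU].
have r2 : 0 < r / 2 by rewrite divr_gt0.
have [k _ hk] : \forall k \near \oo, k.+1%:R^-1 < r / 2.
  exact: near_infty_natSinv_lt (PosNum r2).
have k0 : 0 < k.+1%:R^-1 :> R by rewrite invr_gt0.
have [i hi] := dq (f x) k.+1%:R^-1 k0.
exists i => //; exists k => /=; last by rewrite in_itv.
move=> v; rewrite -ball_normE /= => hv; apply: rU; rewrite -ball_normE /=.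
have := ler_normD (f x - q i) (q i - v); rewrite addrA subrK => h.
have {}hk : k.+1%:R^-1 < r / 2 by exact: hk (leqnn k).
by apply: le_lt_trans h _; rewrite (splitr r) ltrD// (lt_trans _ hk).
Qed.

End vector_measurability.

Section nearest_point.
Context (R : realType) (H : hilbertType R) (q : nat -> H).

(** A closest point to [h] among [0, q 0, ..., q (n - 1)]. Composed with a
    measurable function it gives simple approximations; they are dominated
    because [0] is a candidate. *)
Fixpoint nearest n h : H := if n is n'.+1 then
  if `|h - q n'| < `|h - nearest n' h| then q n' else nearest n' h else 0.

Lemma nearest_min n h :
  `|h - nearest n.+1 h| = Num.min `|h - nearest n h| `|h - q n|.
Proof. by rewrite /= minC /Order.min; case: ifP. Qed.

Lemma nearest_le n h : `|h - nearest n h| <= `|h|.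
Proof.
elim: n => [|n ih]; first by rewrite subr0.
by rewrite nearest_min ge_min ih.
Qed.

Lemma nearest_norm n h : `|nearest n h| <= 2 * `|h|.
Proof.
have := ler_normB h (h - nearest n h); rewrite opprB addrC subrK.
by have := nearest_le n h; lra.
Qed.

Lemma nearest_cvg h : dense_seq q -> `|h - nearest n h| @[n --> \oo] --> (0 : R).
Proof.
move=> dq; apply/cvgrPdist_lt => r r0; have [m hm] := dq h r r0.
exists m.+1 => // n /= mn; rewrite sub0r normrN normr_id; apply: le_lt_trans hm.
rewrite -(subnKC mn); elim: (n - m.+1)%N => [|k ih].
  by rewrite addn0 nearest_min ge_min lexx orbT.
by rewrite addnS nearest_min ge_min ih.
Qed.

Lemma nearest_finitely_valued d (X : measurableType d) (f : X -> H) n :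
  separable_space H -> weakly_measurable f -> finitely_valued (fun x => nearest n (f x)).
Proof.
move=> sep mf; suff [] : finitely_valued (fun x => nearest n (f x)) /\
    measurable_fun setT (fun x => `|f x - nearest n (f x)|) by [].
elim: n => [|n [vn mn]].
  split; last by under eq_fun do rewrite /= subr0; exact: weakly_measurable_norm.
  split; first by apply: (sub_finite_set _ (finite_set1 (0 : H))) => _ [x _ <-].
  by move=> z; rewrite preimage_cst; case: ifP.
have md := weakly_measurable_dist sep (q n) mf.
split; last first.
  by under eq_fun do rewrite nearest_min; exact: measurable_minr.
pose b x := `|f x - q n| < `|f x - nearest n (f x)|.
have vb : finitely_valued b.
  split; first exact: finite_finset.
  move=> z; rewrite -[X in measurable X]setTI; have : measurable_fun setT b.
    exact: measurable_fun_ltr.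
  by apply.
exact: (finitely_valued_comp (fun p : bool * H => if p.1 then q n else p.2)
  (finitely_valued_pair vb vn)).
Qed.

End nearest_point.

Lemma bochnerP d (X : measurableType d) (R : realType) (V : normedModType R)
    (mu : {measure set X -> \bar R}) (f : X -> V) :
  (exists I, is_bochner mu f I) -> is_bochner mu f (bochner mu f).
Proof. by move=> [I hI]; rewrite /bochner; case: xgetP => // /(_ I). Qed.

Section bochner_vectors.
Context d (X : measurableType d) (R : realType) (H : hilbertType R).
Variable mu : {finite_measure set X -> \bar R}.
Hypothesis sep : separable_space H.
Implicit Types f g : X -> H.

Lemma bochner_vector_exists f (G : X -> R) : weakly_measurable f ->
  mu.-integrable setT (EFin \o G) -> (forall x, `|f x| <= G x) ->
  exists I, is_bochner mu f I.
Proof.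
move=> mf iG fG; have [q dq] := separable_dense_seq sep.
apply: (@bochner_exists _ _ _ mu _ f (fun n x => nearest q n (f x))
  (fun n x => `|f x - nearest q n (f x)|) G) => //.
- exact: hilbert_complete.
- by move=> n; exact: nearest_finitely_valued.
- move=> n; apply: weakly_measurable_norm => //; apply: weakly_measurableB => // u.
  by apply: finitely_valued_measurable; apply: (finitely_valued_comp (fun h => inner h u));
    exact: nearest_finitely_valued.
- by move=> n x; apply: le_trans (fG x); exact: nearest_le.
- by move=> x; exact: nearest_cvg.
Qed.

Lemma bochner_inner f I u : weakly_measurable f -> is_bochner mu f I ->
  mu.-integrable setT (EFin \o (fun x => inner (f x) u)) /\
  \int[mu]_x inner (f x) u = inner I u.
Proof.
move=> mf fI; apply: (@bochner_functional _ _ _ mu _ f I (fun h => inner h u) `|u|) => //.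
  by move=> c v w; rewrite -innerZl -innerDl.
by move=> v; rewrite mulrC; exact: cauchy_schwarz.
Qed.

Lemma tensorB (f g u v : H) : tensor f g - tensor u v = tensor f (g - v) + tensor (f - u) v.
Proof.
apply: hs_ext => w z.
rewrite -[LHS]/(inner (tensor f g w - tensor u v w) z).
rewrite -[RHS]/(inner (tensor f (g - v) w + tensor (f - u) v w) z).
by rewrite innerBl innerDl !tensor_coef !innerBl; ring.
Qed.

Lemma bochner_tensor_exists f g : weakly_measurable f -> weakly_measurable g ->
  mu.-integrable setT (EFin \o (fun x => `|f x| * `|g x|)) ->
  exists I, is_bochner mu (fun x => tensor (f x) (g x)) I.
Proof.
move=> mf mg ifg; have [q dq] := separable_dense_seq sep.
pose b n x := `|f x| * `|g x - nearest q n (g x)| + 2 * (`|f x - nearest q n (f x)| * `|g x|).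
have mn f' n : weakly_measurable f' ->
    measurable_fun setT (fun x => `|f' x - nearest q n (f' x)|).
  move=> mf'; apply: weakly_measurable_norm => //; apply: weakly_measurableB => // u.
  by apply: finitely_valued_measurable; apply: (finitely_valued_comp (fun h => inner h u));
    exact: nearest_finitely_valued.
apply: (@bochner_exists _ _ _ mu _ _
  (fun n x => tensor (nearest q n (f x)) (nearest q n (g x))) b
  (fun x => 3 * (`|f x| * `|g x|))).
- exact: hs_complete.
- move=> n; apply: (finitely_valued_comp (fun p : H * H => tensor p.1 p.2)
    (finitely_valued_pair (nearest_finitely_valued q n sep mf) (nearest_finitely_valued q n sep mg))).
- move=> n; apply: measurable_funD; first apply: measurable_funM (mn _ _ mg).
    exact: weakly_measurable_norm.
  apply: measurable_funM => //; apply: measurable_funM (mn _ _ mf) _.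
  exact: weakly_measurable_norm.
- move=> n x; rewrite tensorB; apply: le_trans (ler_normD _ _) _; apply: lerD.
    exact: tensor_norm.
  apply: le_trans (tensor_norm _ _) _; rewrite mulrCA ler_wpM2l//.
  exact: nearest_norm.
- move=> n x; rewrite /b; have h1 := nearest_le q n (f x); have h2 := nearest_le q n (g x).
  have := ler_wpM2l (normr_ge0 (f x)) h2; have := ler_wpM2r (normr_ge0 (g x)) h1; lra.
- exact: (integrableZl measurableT 3 ifg).
- move=> x; rewrite (_ : 0 = `|f x| * 0 + 2 * (0 * `|g x|)); last by ring.
  apply: cvgD; first by apply: cvgM (nearest_cvg _ dq); exact: cvg_cst.
  by apply: cvgM; [exact: cvg_cst|apply: cvgM (nearest_cvg _ dq) (cvg_cst _)].
Qed.

Lemma bochner_tensor_coef f g I u v : weakly_measurable f -> weakly_measurable g ->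
  is_bochner mu (fun x => tensor (f x) (g x)) I ->
  mu.-integrable setT (EFin \o (fun x => inner (f x) u * inner (g x) v)) /\
  inner (I v) u = \int[mu]_x (inner (f x) u * inner (g x) v).
Proof.
move=> mf mg fgI.
have [|h1 h2] := bochner_functional fgI (hs_coef_linear v u) (hs_coef_le v u).
  under eq_fun do rewrite tensor_coef; exact: measurable_funM.
by rewrite -h2; split; [apply: eq_integrable h1 => // x _ /=|apply: eq_Rintegral => x _];
  rewrite tensor_coef.
Qed.

End bochner_vectors.

Section bochner_bound.
Context d (X : measurableType d) (R : realType).
Variable mu : {finite_measure set X -> \bar R}.

(** The error functions [x |-> |F x - s n x|] need not be measurable, but the
    excess of [|s n|] over the bound is, and it is below the error. *)
Lemma bochner_norm_le (V : normedModType R) (F : X -> V) I (b : X -> R) :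
  is_bochner mu F I -> mu.-integrable setT (EFin \o b) ->
  (forall x, `|F x| <= b x) -> `|I| <= \int[mu]_x b x.
Proof.
move=> [s [ss _ cv0 cvI]] ib Fb.
have vs n : finitely_valued (s n) by apply/is_simpleP.
have mb : measurable_fun setT b by apply/measurable_EFinP; exact: measurable_int ib.
have is_ n : mu.-integrable setT (EFin \o (fun x => `|s n x|)).
  exact: (integrable_simple_comp mu (fun v => `|v|) (vs n)).
have isb n : mu.-integrable setT (EFin \o (fun x => `|s n x| - b x)).
  exact: (integrableB _ (is_ n) ib).
pose ex n x := Num.max (`|s n x| - b x) 0.
have iex n : mu.-integrable setT (EFin \o ex n).
  apply: (@dominated_integrable _ _ _ _ _ (fun x => `|s n x| + `|b x|)).
  - by apply: measurable_maxr; [apply/measurable_EFinP; exact: measurable_int (isb n)|].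
  - exact: (integrableD _ (is_ n) (integrable_norm ib)).
  - move=> x; rewrite ger0_norm ?le_max ?lexx ?orbT// ge_max addr_ge0// andbT.
    by rewrite lerD2l (le_trans (ler_norm _))// normrN.
have cvE : (\int[mu]_x (ex n x)%:E)%E @[n --> \oo] --> 0%E.
  apply: squeeze_cvge (cvg_cst _) cv0.
  apply: nearW => n; apply/andP; split.
    by apply: integral_ge0 => x _; rewrite lee_fin le_max lexx orbT.
  apply: ge0_integral_mono => x; rewrite lee_fin ?le_max ?lexx ?orbT//.
  rewrite ge_max normr_ge0 andbT lerBlDr; have := ler_normB (F x) (F x - s n x).
  by rewrite opprB addrC subrK; have := Fb x; lra.
have cvex : \int[mu]_x ex n x @[n --> \oo] --> (0 : R) by exact: (fine_cvg cvE).
have cv1 : \int[mu]_x b x + \int[mu]_x ex n x @[n --> \oo] --> \int[mu]_x b x.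
  by rewrite -[X in _ --> X]addr0; apply: cvgD => //; exact: cvg_cst.
have cv2 : `|simple_integral mu (s n)| @[n --> \oo] --> `|I| by exact: cvg_norm.
apply: ler_cvg_to cv2 cv1 _; apply: nearW => n.
apply: le_trans (simple_integral_norm mu (vs n)) _; rewrite -RintegralD//.
apply: le_Rintegral => //; first exact: (integrableD _ ib (iex n)).
by move=> x _; rewrite -lerBlDl le_max lexx.
Qed.

End bochner_bound.

(** * Integrals depending on a parameter *)

Section two_variables.
Context d1 d2 (X : measurableType d1) (Y : measurableType d2) (R : realType).
Implicit Types f g : X -> Y -> R.

Definition jointly_measurable f := measurable_fun setT (fun p : X * Y => f p.1 p.2).

Lemma jointly_measurable_section f x : jointly_measurable f -> measurable_fun setT (f x).
Proof. by move=> mf; exact: (measurableT_comp mf (measurable_pair1 x)). Qed.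

Lemma jointly_measurable_section2 f y : jointly_measurable f ->
  measurable_fun setT (fun x => f x y).
Proof. by move=> mf; exact: (measurableT_comp mf (measurable_pair2 y)). Qed.

Lemma jointly_measurableM f g : jointly_measurable f -> jointly_measurable g ->
  jointly_measurable (fun x y => f x y * g x y).
Proof. by move=> mf mg; exact: measurable_funM. Qed.

Lemma jointly_measurable_swap f : jointly_measurable f ->
  measurable_fun setT (fun q : Y * X => f q.2 q.1).
Proof.
move=> mf; exact: (measurableT_comp (f := fun p : X * Y => f p.1 p.2) mf
  (@measurable_swap _ _ Y X)).
Qed.

Lemma jointly_measurable_fst (g : X -> R) : measurable_fun setT g ->
  jointly_measurable (fun x _ => g x).
Proof. by move=> mg; exact: (measurableT_comp mg measurable_fst). Qed.

Lemma jointly_measurable_snd (h : Y -> R) : measurable_fun setT h ->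
  jointly_measurable (fun _ y => h y).
Proof. by move=> mh; exact: (measurableT_comp mh measurable_snd). Qed.

Variable nu : {finite_measure set Y -> \bar R}.

Lemma measurable_Rintegral_ge0 f : jointly_measurable f -> (forall x y, 0 <= f x y) ->
  measurable_fun setT (fun x => \int[nu]_y f x y).
Proof.
move=> mf f0; apply: measurableT_comp => //.
apply: (measurable_fun_fubini_tonelli_F (fun p : X * Y => (f p.1 p.2)%:E)).
  exact/measurable_EFinP.
by move=> p; rewrite lee_fin.
Qed.

(** By polarization it is enough to treat squares, to which Tonelli's
    theorem applies. *)
Lemma measurable_ip f g : jointly_measurable f -> jointly_measurable g ->
  (forall x, L2 nu (f x)) -> (forall x, L2 nu (g x)) ->
  measurable_fun setT (fun x => ip nu (f x) (g x)).
Proof.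
move=> mf mg Lf Lg.
have sq h : jointly_measurable h -> (forall x, L2 nu (h x)) ->
    measurable_fun setT (fun x => ip nu (h x) (h x)).
  move=> mh Lh; apply: measurable_Rintegral_ge0.
    exact: jointly_measurableM.
  by move=> x y; rewrite -expr2 sqr_ge0.
have -> : (fun x => ip nu (f x) (g x)) = fun x =>
    2^-1 * (ip nu (f x) (f x) + ip nu (g x) (g x) -
      ip nu (fun y => f x y - g x y) (fun y => f x y - g x y)).
  by apply/funext => x; rewrite ipBB//; field.
apply: measurable_funM => //; apply: measurable_funB.
  by apply: measurable_funD; exact: sq.
apply: sq; first exact: measurable_funB.
by move=> x; exact: L2B.
Qed.

Variable mu : {finite_measure set X -> \bar R}.
Variable f : X -> Y -> R.
Hypothesis mf : jointly_measurable f.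
Hypothesis Lf1 : forall x, L2 nu (f x).
Hypothesis Lf2 : forall y, L2 mu (fun x => f x y).
Hypothesis foo : (\int[mu]_x \int[nu]_y (f x y ^+ 2)%:E < +oo)%E.

Lemma L2_ip_section h : L2 nu h -> L2 mu (fun x => ip nu (f x) h).
Proof.
move=> Lh; have mh := L2_measurable Lh; split.
  apply: measurable_ip => //; exact: jointly_measurable_snd.
apply: (@le_lt_trans _ _ (\int[mu]_x ((ip nu h h)%:E * \int[nu]_y (f x y ^+ 2)%:E))%E).
  apply: ge0_integral_mono => x; rewrite ?lee_fin ?sqr_ge0//.
  have -> : (\int[nu]_y (f x y ^+ 2)%:E)%E = (ip nu (f x) (f x))%:E.
    by rewrite ip_EFin//; apply: eq_integral => y _; rewrite expr2.
  by rewrite -EFinM lee_fin mulrC; exact: ip_schwarz.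
rewrite ge0_integralZl//.
- by apply: lte_mul_pinfty => //; rewrite lee_fin ip_ge0.
- apply: (measurable_fun_fubini_tonelli_F (fun p : X * Y => (f p.1 p.2 ^+ 2)%:E)).
    by apply/measurable_EFinP; exact: measurable_funX.
  by move=> p; rewrite lee_fin sqr_ge0.
- by move=> x _; apply: integral_ge0 => y _; rewrite lee_fin sqr_ge0.
- by rewrite lee_fin ip_ge0.
Qed.

(** The double integrand is dominated by [f x y ^ 2 + (g x * h y) ^ 2]. *)
Lemma ip_fubini (g : X -> R) (h : Y -> R) : L2 mu g -> L2 nu h ->
  ip mu (fun x => ip nu (f x) h) g = ip nu (fun y => ip mu (fun x => f x y) g) h.
Proof.
move=> Lg Lh; have mg := L2_measurable Lg; have mh := L2_measurable Lh.
pose F (p : X * Y) := (f p.1 p.2 * (g p.1 * h p.2))%:E.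
have mF : measurable_fun setT F.
  apply/measurable_EFinP; apply: measurable_funM => //; apply: measurable_funM.
    exact: jointly_measurable_fst.
  exact: jointly_measurable_snd.
have iF : (mu \x nu)%E.-integrable setT F.
  apply/integrable12ltyP; first exact: mF.
  apply: (@le_lt_trans _ _ (\int[mu]_x (\int[nu]_y (f x y ^+ 2)%:E +
      (g x ^+ 2 * ip nu h h)%:E))%E).
    apply: ge0_integral_mono => x; first exact: integral_ge0.
    have -> : (g x ^+ 2 * ip nu h h)%:E = (\int[nu]_y ((g x * h y) ^+ 2)%:E)%E.
      rewrite EFinM ip_EFin// -ge0_integralZl//.
      - by apply: eq_integral => y _; rewrite -EFinM exprMn (expr2 (h y)).
      - by apply/measurable_EFinP; exact: measurable_funM.
      - by move=> y _; rewrite lee_fin -expr2 sqr_ge0.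
      - by rewrite lee_fin sqr_ge0.
    rewrite -ge0_integralD//.
    - apply: ge0_integral_mono => y //; rewrite /= lee_fin.
      rewrite ler_norml; apply/andP.
      have := sqr_ge0 (f x y - g x * h y); have := sqr_ge0 (f x y + g x * h y).
      have := sqr_ge0 (f x y); have := sqr_ge0 (g x * h y).
      by split; nra.
    - by move=> y _; rewrite lee_fin sqr_ge0.
    - by apply/measurable_EFinP/measurable_funX; exact: L2_measurable (Lf1 x).
    - by move=> y _; rewrite lee_fin sqr_ge0.
    - by apply/measurable_EFinP/measurable_funX/measurable_funM.
  rewrite ge0_integralD//.
  - apply: lte_add_pinfty => //.
    apply: (@le_lt_trans _ _ (\int[mu]_x ((ip nu h h)%:E * (g x ^+ 2)%:E))%E).
      by under eq_integral do rewrite mulrC EFinM.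
    rewrite ge0_integralZl//.
    + by apply: lte_mul_pinfty; rewrite ?lee_fin ?ip_ge0//; case: Lg.
    + by apply/measurable_EFinP/measurable_funX.
    + by move=> x _; rewrite lee_fin sqr_ge0.
    + by rewrite lee_fin ip_ge0.
  - by move=> x _; apply: integral_ge0 => y _; rewrite lee_fin sqr_ge0.
  - apply: (measurable_fun_fubini_tonelli_F (fun p : X * Y => (f p.1 p.2 ^+ 2)%:E)).
      by apply/measurable_EFinP; exact: measurable_funX.
    by move=> p; rewrite lee_fin sqr_ge0.
  - by move=> x _; rewrite lee_fin mulr_ge0 ?sqr_ge0 ?ip_ge0.
  - by apply/measurable_EFinP/measurable_funM => //; exact: measurable_funX.
have := Fubini iF; rewrite /F /= => E.
rewrite /ip /Rintegral; congr fine; transitivity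
    (\int[mu]_x \int[nu]_y (f x y * (g x * h y))%:E)%E.
  apply: eq_integral => x _; rewrite -[fine _]/(ip nu (f x) h) EFinM ip_EFin//.
  rewrite muleC -integralZl//; last exact: L2M_integrable.
  by apply: eq_integral => y _; rewrite -EFinM mulrCA.
rewrite E; apply: eq_integral => y _.
rewrite -[fine _]/(ip mu (fun x => f x y) g) EFinM ip_EFin// muleC -integralZl//.
  by apply: eq_integral => x _; rewrite -EFinM (mulrC (h y)) mulrA.
exact: L2M_integrable.
Qed.

End two_variables.

(** * Finite-valued approximation and finite product measures *)

Section rounding.
Context d (X : measurableType d) (R : realType).

Definition round_down (n : nat) (r : R) : R := (Num.floor (n.+1%:R * r))%:~R / n.+1%:R.

Lemma round_down_error n r : `|r - round_down n r| <= n.+1%:R^-1.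
Proof.
have n0 : 0 < n.+1%:R :> R by [].
have -> : r - round_down n r = (n.+1%:R * r - (Num.floor (n.+1%:R * r))%:~R) / n.+1%:R.
  by rewrite /round_down; field; rewrite nat1r pnatr_eq0.
rewrite normrM (gtr0_norm (x := n.+1%:R^-1)) ?invr_gt0// ler_piMl ?invr_ge0//.
have := floor_itv (n.+1%:R * r); rewrite intrD => /andP[h1 h2].
by rewrite ger0_norm ?subr_ge0//; lra.
Qed.

Lemma round_down_finitely_valued n (F : X -> R) (M : R) : measurable_fun setT F ->
  (forall x, `|F x| <= M) -> finitely_valued (fun x => round_down n (F x)).
Proof.
move=> mF FM; pose g x := Num.floor (n.+1%:R * F x).
suff vg : finitely_valued g.
  exact: (finitely_valued_comp (fun z : int => z%:~R / n.+1%:R : R) vg).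
split.
  (* The extra [1] is for the floors of negative numbers. *)
  pose K := `|Num.floor (n.+1%:R * M + 1)|%N.
  apply: (@sub_finite_set _ _ ((fun i : nat => i%:Z - K%:Z) @` `I_(K + K).+1)); last first.
    exact/finite_image/finite_II.
  move=> _ [x _ <-]; rewrite /g.
  have h : (`|Num.floor (n.+1%:R * F x)| <= K)%N.
    have [h1 h2] := (floor_itv (n.+1%:R * F x), floor_itv (n.+1%:R * M + 1)).
    have := FM x; rewrite ler_norml => /andP[FM1 FM2].
    have n0 : 0 <= n.+1%:R :> R by [].
    have q1 := ler_wpM2l n0 FM1; have q2 := ler_wpM2l n0 FM2.
    move: h1 h2; rewrite !intrD mulrN in q1 * => /andP[a1 a2] /andP[b1 b2].
    have c1 : (Num.floor (n.+1%:R * F x) <= Num.floor (n.+1%:R * M + 1)).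
      by rewrite -ltzD1 -(ltr_int R) intrD; lra.
    have c2 : (- Num.floor (n.+1%:R * M + 1) < Num.floor (n.+1%:R * F x) + 1).
      by rewrite -(ltr_int R) intrD mulrNz; lra.
    by rewrite /K; move: c1 c2; set a := Num.floor _; set b := Num.floor _; lia.
  move: h; set a := Num.floor _ => h.
  by exists `|(a + K%:Z)%R|%N => /=; lia.
move=> z; have mg : measurable_fun setT (fun x => n.+1%:R * F x) by exact: measurable_funM.
rewrite (_ : g @^-1` [set z] = (fun x => n.+1%:R * F x) @^-1` `[z%:~R, (z + 1)%:~R[%classic).
  by rewrite -[X in measurable X]setTI; exact: mg.
apply/seteqP; split => x; rewrite /g /= in_itv /=.
  by move=> <-; exact: floor_itv.
by move=> h; apply: floor_def.
Qed.

End rounding.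

Section finite_product.
Context d1 d2 (X : measurableType d1) (Y : measurableType d2) (R : realType).
Variables (mu : {finite_measure set X -> \bar R}) (nu : {finite_measure set Y -> \bar R}).

Let product_finite : fin_num_fun (mu \x nu)%E.
Proof.
move=> A mA; rewrite ge0_fin_numE//.
apply: (@le_lt_trans _ _ ((mu \x nu)%E (setT `*` setT))).
  by apply: le_measure; rewrite ?inE//; exact: measurableX.
rewrite product_measure1E//; apply: lte_mul_pinfty => //.
  exact: fin_num_measure.
by rewrite -ge0_fin_numE// fin_num_measure.
Qed.

Let finite_mixin := Measure_isFinite.Build _ _ _ (mu \x nu)%E product_finite.

(** Not declared as a canonical instance: product measures already have one,
    for factors that are probabilities. *)
Definition finite_product : {finite_measure set (X * Y)%type -> \bar R} :=
  HB.pack_for {finite_measure set (X * Y)%type -> \bar R} (mu \x nu)%E finite_mixin.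

Lemma Rintegral_product (f : X * Y -> R) : (mu \x nu)%E.-integrable setT (EFin \o f) ->
  (forall x, nu.-integrable setT (EFin \o (fun y => f (x, y)))) ->
  \int[(mu \x nu)%E]_p f p = \int[mu]_x \int[nu]_y f (x, y).
Proof.
move=> fi fs; rewrite /Rintegral -(integral12_prod_meas1 fi); congr fine.
by apply: eq_integral => x _; exact/esym/(EFin_Rintegral (fs x)).
Qed.

End finite_product.

(** * Regular isotropic fields *)

Section mean_parseval.
Context d (X : measurableType d) (R : realType) (H : hilbertType R).
Variable mu : {finite_measure set X -> \bar R}.

Lemma L2_inner (f : X -> H) u : weakly_measurable f -> L2 mu (fun x => `|f x|) ->
  L2 mu (fun x => inner (f x) u).
Proof.
move=> mf Lf; apply: L2_dominated (mf u) (L2Z `|u| Lf) _ => x.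
by rewrite mulrC; exact: cauchy_schwarz.
Qed.

Lemma mean_parseval (f : X -> H) e : weakly_measurable f -> L2 mu (fun x => `|f x|) ->
  frame e ->
  \sum_(k < n) ip mu (fun x => inner (f x) (e k)) (fun x => inner (f x) (e k))
    @[n --> \oo] --> ip mu (fun x => `|f x|) (fun x => `|f x|).
Proof.
move=> mf Lf fe; have [eo e1 _] := fe.
rewrite (_ : (fun n => _) = fun n => \int[mu]_x \sum_(k < n)
    (inner (f x) (e k) * inner (f x) (e k))); last first.
  apply/funext => n; rewrite Rintegral_sum// => k.
  exact: (L2M_integrable (L2_inner (e k) mf Lf) (L2_inner (e k) mf Lf)).
apply: (Rintegral_dominated_cvg _ (L2M_integrable Lf Lf)).
- by move=> n; apply: measurable_sum => k; apply: measurable_funM; exact: mf.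
- move=> n x; under eq_bigr do rewrite -expr2.
  rewrite -expr2 ger0_norm; first exact: frame_bessel.
  by apply: sumr_ge0 => k _; exact: sqr_ge0.
- by move=> x; rewrite -expr2 -innerxx; exact: frame_parseval.
Qed.

End mean_parseval.

(** All the paths are assumed square integrable, and isotropy is assumed for the
    scalar kernels only. *)
Section regular_field.
Context d (Omega : measurableType d) (R : realType) (P : probability Omega R).
Context (H : hilbertType R) (t : sphere R -> Omega -> H).
Local Notation sigma := (surface R).
Local Notation Y := (@sph_harmonic R).

Hypothesis sep : separable_space H.
Hypothesis t_measurable : forall u, jointly_measurable (fun w x => inner (t x w) u).
Hypothesis t_space : forall w, (\int[sigma]_x (`|t x w| ^+ 2)%:E < +oo)%E.
Hypothesis t_moment : forall x, (\int[P]_w (`|t x w| ^+ 2)%:E < +oo)%E.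
Hypothesis t_centered : forall x u, \int[P]_w inner (t x w) u = 0.

(** The scalar covariance kernels of the field. *)
Definition cross u v x y : R :=
  ip P (fun w => inner (t x w) u) (fun w => inner (t y w) v).

Hypothesis t_isotropic : forall u v x y rho, rho \in SO3 R ->
  cross u v x y = cross u v (rotate rho x) (rotate rho y).

Lemma field_weak x : weakly_measurable (t x).
Proof. by move=> u; exact: jointly_measurable_section2 (t_measurable u). Qed.

Lemma path_weak w : weakly_measurable (fun x => t x w).
Proof. by move=> u; exact: jointly_measurable_section (t_measurable u). Qed.

Lemma norm_measurable : jointly_measurable (fun w x => `|t x w|).
Proof.
exact: (@weakly_measurable_norm _ (Omega * sphere R)%type _ _ sep
  (fun p => t p.2 p.1) t_measurable).
Qed.

Lemma L2_field_norm x : L2 P (fun w => `|t x w|).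
Proof. by split; [apply: weakly_measurable_norm sep _ (field_weak x)|]. Qed.

Lemma L2_path_norm w : L2 sigma (fun x => `|t x w|).
Proof. by split; [apply: weakly_measurable_norm sep _ (path_weak w)|]. Qed.

Lemma L2_field x u : L2 P (fun w => inner (t x w) u).
Proof. by apply: L2_inner; [exact: field_weak|exact: L2_field_norm]. Qed.

Lemma L2_path w u : L2 sigma (fun x => inner (t x w) u).
Proof. by apply: L2_inner; [exact: path_weak|exact: L2_path_norm]. Qed.

(** * Second moments *)

Definition energy x := ip P (fun w => `|t x w|) (fun w => `|t x w|).

Lemma truncated_energy_cvg e x : frame e ->
  \sum_(k < n) cross (e k) (e k) x x @[n --> \oo] --> energy x.
Proof. exact: mean_parseval (field_weak x) (L2_field_norm x). Qed.

Lemma cross_diag u x : cross u u x x = cross u u (north R) (north R).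
Proof. by have [rho [hr _ <-]] := rotate_to_north x; exact: t_isotropic. Qed.

(** The energy is the sum over a frame of diagonal kernels, which are
    constant because rotations act transitively. *)
Lemma energyE x : energy x = energy (north R).
Proof.
have [e fe] := separable_frame sep.
have h := @truncated_energy_cvg e x fe.
rewrite (_ : (fun n => _) = fun n =>
    \sum_(k < n) cross (e k) (e k) (north R) (north R)) in h; last first.
  by apply/funext => n; apply: eq_bigr => k _; exact: cross_diag.
exact: cvg_unique h (@truncated_energy_cvg e (north R) fe).
Qed.

Lemma cross_le u v x y : `|cross u v x y| <= `|u| * `|v| * energy (north R).
Proof.
have e0 : 0 <= energy (north R) by exact: ip_ge0.
have hd u' x' : cross u' u' x' x' <= `|u'| ^+ 2 * energy (north R).
  have iN := L2M_integrable (L2_field_norm x') (L2_field_norm x').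
  rewrite -(energyE x') /energy /ip -RintegralZl//.
  apply: le_Rintegral => //.
  - exact: (L2M_integrable (L2_field x' u') (L2_field x' u')).
  - exact: (integrableZl measurableT (`|u'| ^+ 2) iN).
  - move=> w _; have h := cauchy_schwarz (t x' w) u'.
    rewrite -!expr2 -exprMn -(real_normK (num_real (inner _ _))).
    by rewrite ler_sqr ?nnegrE ?mulr_ge0// mulrC.
rewrite -ler_sqr ?nnegrE ?mulr_ge0// real_normK ?num_real//.
apply: le_trans (ip_schwarz (L2_field x u) (L2_field y v)) _.
have -> : (`|u| * `|v| * energy (north R)) ^+ 2 =
  (`|u| ^+ 2 * energy (north R)) * (`|v| ^+ 2 * energy (north R)) by ring.
by apply: ler_pM; rewrite ?ip_ge0//; exact: hd.
Qed.

Lemma measurable_cross u v :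
  measurable_fun setT (fun p : sphere R * sphere R => cross u v p.1 p.2).
Proof.
have mt u' : jointly_measurable (fun x w => inner (t x w) u').
  exact: jointly_measurable_swap (t_measurable u').
have lift (pr : sphere R * sphere R -> sphere R) u' : measurable_fun setT pr ->
    jointly_measurable (fun p w => inner (t (pr p) w) u').
  move=> mpr; apply: (measurableT_comp (mt u') (g := fun q => (pr q.1, q.2))).
  apply: measurable_fun_pair => //; exact: measurableT_comp.
apply: measurable_ip; [exact: lift|exact: lift|..] => p; exact: L2_field.
Qed.

Lemma measurable_cross_section u v x : measurable_fun setT (cross u v x).
Proof. exact: (measurableT_comp (measurable_cross u v) (measurable_pair1 x)). Qed.

Lemma cross_harmonic u v : exists lam : nat -> R, forall l m x, (`|m| <= l)%N ->
  ip sigma (cross u v x) (Y l m) = lam l * Y l m x.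
Proof.
suff h l : exists lam, forall m x, (`|m| <= l)%N ->
    ip sigma (cross u v x) (Y l m) = lam * Y l m x.
  by have [lam hlam] := choice h; exists lam => l m x; exact: hlam.
apply: (@funk_hecke R (cross u v) (`|u| * `|v| * energy (north R))).
- by move=> x; exact: measurable_cross_section.
- by move=> x y; exact: cross_le.
- by move=> rho x y hr; rewrite -t_isotropic.
Qed.

(** By [energyE] it is the energy at one point times the area of the sphere. *)
Lemma energy_integral : (\int[P]_w \int[sigma]_x (`|t x w| ^+ 2)%:E < +oo)%E.
Proof.
have mn2 : measurable_fun setT (fun p : Omega * sphere R => (`|t p.2 p.1| ^+ 2)%:E).
  by apply/measurable_EFinP; apply: measurable_funX; exact: norm_measurable.
have := @fubini_tonelli _ _ _ _ _ P sigma (fun p => (`|t p.2 p.1| ^+ 2)%:E) mn2.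
rewrite /fubini_F /fubini_G /= => ->; last by move=> p; rewrite lee_fin sqr_ge0.
rewrite (_ : (fun x => _) = cst (energy (north R))%:E); last first.
  apply/funext => x; rewrite /= -(energyE x) /energy ip_EFin; first last.
    exact: L2_field_norm.
    exact: L2_field_norm.
  by apply: eq_integral => w _; rewrite expr2.
by rewrite integral_cst// -ge0_fin_numE ?fin_numM// ?fin_num_measure// mule_ge0// lee_fin ip_ge0.
Qed.

Lemma coordinate_integral u :
  (\int[P]_w \int[sigma]_x (inner (t x w) u ^+ 2)%:E < +oo)%E.
Proof.
apply: (@le_lt_trans _ _ (\int[P]_w ((`|u| ^+ 2)%:E * \int[sigma]_x (`|t x w| ^+ 2)%:E))%E).
  apply: ge0_integral_mono => w; first by apply: integral_ge0 => x _; rewrite lee_fin sqr_ge0.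
  rewrite -ge0_integralZl//.
  - apply: ge0_integral_mono => x; rewrite -?EFinM lee_fin ?sqr_ge0// mulrC -exprMn.
    rewrite -(real_normK (num_real (inner _ _))).
    by rewrite ler_sqr ?nnegrE ?mulr_ge0// cauchy_schwarz.
  - by apply/measurable_EFinP; exact: measurable_funX (L2_measurable (L2_path_norm w)).
rewrite ge0_integralZl//.
- by apply: lte_mul_pinfty; rewrite ?lee_fin ?sqr_ge0//; exact: energy_integral.
- apply: (measurable_fun_fubini_tonelli_F (fun p => (`|t p.2 p.1| ^+ 2)%:E)).
    by apply/measurable_EFinP; apply: measurable_funX; exact: norm_measurable.
  by move=> p; rewrite lee_fin sqr_ge0.
- by move=> w _; apply: integral_ge0 => x _; rewrite lee_fin sqr_ge0.
Qed.

(** * Fourier coefficients *)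

Definition coefficient l m w : H := bochner sigma (fun x => Y l m x *: t x w).

Section coefficient.
Variables (l : nat) (m : int).
Hypothesis ml : (`|m| <= l)%N.

Let L2Y : L2 sigma (Y l m) := L2_harmonic R ml.

Let weakYt w : weakly_measurable (fun x => Y l m x *: t x w).
Proof. by apply: weakly_measurableZ (path_weak w); exact: L2_measurable L2Y. Qed.

Let integrableYt w :
  sigma.-integrable setT (EFin \o (fun x => `|Y l m x| * `|t x w|)).
Proof. exact: (L2M_integrable (L2_normr L2Y) (L2_path_norm w)). Qed.

Lemma coefficientP w : is_bochner sigma (fun x => Y l m x *: t x w) (coefficient l m w).
Proof.
apply: bochnerP; apply: (bochner_vector_exists sep (weakYt w) (integrableYt w)) => x.
by rewrite normrZ.
Qed.

Lemma coefficient_inner w u :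
  inner (coefficient l m w) u = ip sigma (fun x => inner (t x w) u) (Y l m).
Proof.
have [_ <-] := bochner_inner u (weakYt w) (coefficientP w).
by apply: eq_Rintegral => x _; rewrite innerZl mulrC.
Qed.

Lemma coefficient_norm w :
  `|coefficient l m w| ^+ 2 <= ip sigma (fun x => `|t x w|) (fun x => `|t x w|).
Proof.
have h : `|coefficient l m w| <= ip sigma (fun x => `|Y l m x|) (fun x => `|t x w|).
  apply: bochner_norm_le (coefficientP w) (integrableYt w) _ => x; by rewrite normrZ.
have := ip_schwarz (L2_normr L2Y) (L2_path_norm w).
rewrite ip_normr harmonic_orthonormal// !eqxx mul1r; apply: le_trans.
by rewrite ler_sqr ?nnegrE// (le_trans _ h).
Qed.

Lemma coefficient_weak : weakly_measurable (coefficient l m).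
Proof.
move=> u; under eq_fun do rewrite coefficient_inner.
apply: L2_measurable (L2_ip_section (t_measurable u) _ (coordinate_integral u) L2Y).
by move=> w; exact: L2_path.
Qed.

Lemma L2_coefficient_norm : L2 P (fun w => `|coefficient l m w|).
Proof.
split; first exact: weakly_measurable_norm coefficient_weak.
apply: le_lt_trans energy_integral; apply: ge0_integral_mono => w.
  by rewrite lee_fin sqr_ge0.
under eq_integral do rewrite expr2.
rewrite -ip_EFin; [|exact: L2_path_norm|exact: L2_path_norm].
by rewrite lee_fin coefficient_norm.
Qed.

Lemma L2_coefficient u : L2 P (fun w => inner (coefficient l m w) u).
Proof. by apply: L2_inner coefficient_weak _; exact: L2_coefficient_norm. Qed.

Lemma coefficient_fubini (g : Omega -> R) u : L2 P g ->
  ip P (fun w => inner (coefficient l m w) u) g =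
  ip sigma (fun x => ip P (fun w => inner (t x w) u) g) (Y l m).
Proof.
move=> Lg; under [in LHS]eq_fun do rewrite coefficient_inner.
apply: (ip_fubini (t_measurable u)) => //.
- by move=> w; exact: L2_path.
- by move=> x; exact: L2_field.
- exact: coordinate_integral.
Qed.

Lemma coefficient_centered : is_bochner P (coefficient l m) 0.
Proof.
have [I hI] : exists I, is_bochner P (coefficient l m) I.
  apply: (bochner_vector_exists sep coefficient_weak (L2_integrable L2_coefficient_norm)).
  by [].
suff -> : 0 = I by [].
apply: inner_ext => u; rewrite inner0l; have [_ <-] := bochner_inner u coefficient_weak hI.
transitivity (ip P (fun w => inner (coefficient l m w) u) (fun=> 1)); last first.
  by apply: eq_Rintegral => w _; rewrite mulr1.
rewrite coefficient_fubini; last exact: L2_cst.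
rewrite (_ : (fun x => _) = fun=> 0) ?ip0l//; apply/funext => x.
rewrite -[RHS](t_centered x u); by apply: eq_Rintegral => w _; rewrite mulr1.
Qed.

Lemma coefficient_field x u v :
  ip P (fun w => inner (coefficient l m w) v) (fun w => inner (t x w) u) =
  ip sigma (cross u v x) (Y l m).
Proof.
rewrite coefficient_fubini; last exact: L2_field.
by apply: eq_Rintegral => y _; rewrite ipC.
Qed.

End coefficient.

(** Expectation and surface integral are exchanged for each of the two
    coefficients in turn; the eigenvalue hypothesis is used in between. *)
Lemma coefficient_orthogonal l m l' m' u v lam : (`|m| <= l)%N -> (`|m'| <= l')%N ->
  (forall x, ip sigma (cross u v x) (Y l' m') = lam * Y l' m' x) ->
  ip P (fun w => inner (coefficient l m w) u) (fun w => inner (coefficient l' m' w) v) =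
  lam * ((l == l') && (m == m'))%:R.
Proof.
move=> ml ml' hlam; rewrite coefficient_fubini//; last exact: L2_coefficient.
rewrite (_ : (fun x => _) = fun x => lam * Y l' m' x); last first.
  by apply/funext => x; rewrite ipC coefficient_field.
rewrite ipZl; [|exact: L2_harmonic|exact: L2_harmonic].
by rewrite ipC harmonic_orthonormal.
Qed.

Lemma coefficient_tensor l m l' m' : (`|m| <= l)%N -> (`|m'| <= l')%N ->
  exists J, is_bochner P (fun w => tensor (coefficient l m w) (coefficient l' m' w)) J /\
  forall u v, inner (J v) u = ip P (fun w => inner (coefficient l m w) u)
    (fun w => inner (coefficient l' m' w) v).
Proof.
move=> ml ml'.
have [J hJ] := bochner_tensor_exists sep (coefficient_weak ml) (coefficient_weak ml')
  (L2M_integrable (L2_coefficient_norm ml) (L2_coefficient_norm ml')).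
exists J; split => // u v.
by have [_ ->] := bochner_tensor_coef u v (coefficient_weak ml) (coefficient_weak ml') hJ.
Qed.

Lemma coefficient_uncorrelated l m l' m' : (`|m| <= l)%N -> (`|m'| <= l')%N ->
  (l, m) <> (l', m') ->
  is_bochner P (fun w => tensor (coefficient l m w) (coefficient l' m' w)) 0.
Proof.
move=> ml ml' ne; have [J [hJ Jc]] := coefficient_tensor ml ml'.
suff -> : 0 = J by []; apply: hs_ext => v u; rewrite Jc.
have [lam hlam] := cross_harmonic u v.
rewrite (coefficient_orthogonal ml ml' (lam := lam l')); last by move=> x; exact: hlam.
have -> : (l == l') && (m == m') = false.
  by apply/negbTE/negP => /andP[/eqP ll /eqP mm]; apply: ne; rewrite ll mm.
by rewrite mulr0; exact: inner0l.
Qed.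

(** * Convergence *)

Local Notation S := (harmonic_partial_sum coefficient).

Lemma partial_sum_inner L x w u :
  inner (S L x w) u = harmonic_proj L (fun y => inner (t y w) u) x.
Proof.
rewrite inner_suml; apply: eq_bigr => l _; rewrite inner_suml; apply: eq_bigr => i _.
by rewrite innerZl coefficient_inner//; exact: order_ofP.
Qed.

Definition residual L x w := t x w - S L x w.

Lemma residual_inner L x w u : inner (residual L x w) u =
  inner (t x w) u - harmonic_proj L (fun y => inner (t y w) u) x.
Proof. by rewrite innerBl partial_sum_inner. Qed.

Definition error u L x := ip P (fun w => inner (residual L x w) u)
  (fun w => inner (residual L x w) u).

Section error.
Variables (u : H) (lam : nat -> R).
Hypothesis hlam : forall l m x, (`|m| <= l)%N ->
  ip sigma (cross u u x) (Y l m) = lam l * Y l m x.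

Let level l x w := \sum_(i < (2 * l).+1)
  Y l (order_of l i) x * inner (coefficient l (order_of l i) w) u.

Let L2_term l (i : 'I_(2 * l).+1) x :
  L2 P (fun w => Y l (order_of l i) x * inner (coefficient l (order_of l i) w) u).
Proof. by apply: L2Z; apply: L2_coefficient; exact: order_ofP. Qed.

Let L2_level l x : L2 P (level l x).
Proof. by apply: L2_sum => i; exact: L2_term. Qed.

Let ip_level l l' x : ip P (level l x) (level l' x) = (l == l')%:R * (lam l * zonal l x x).
Proof.
rewrite ip_sum_sum; [|by move=> i; exact: L2_term|by move=> i; exact: L2_term].
have term (i : 'I_(2 * l).+1) (j : 'I_(2 * l').+1) :
    ip P (fun w => Y l (order_of l i) x * inner (coefficient l (order_of l i) w) u)
      (fun w => Y l' (order_of l' j) x * inner (coefficient l' (order_of l' j) w) u) =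
    Y l (order_of l i) x * Y l' (order_of l' j) x *
      (lam l' * ((l == l') && (order_of l i == order_of l' j))%:R).
  have ml := order_ofP i; have ml' := order_ofP j.
  rewrite ipZl; [|exact: L2_coefficient|exact: L2_term].
  rewrite ipC ipZl; [|exact: L2_coefficient|exact: L2_coefficient].
  rewrite ipC (coefficient_orthogonal ml ml' (lam := lam l')); first by ring.
  by move=> z; exact: hlam.
under eq_bigr do under eq_bigr do rewrite term.
have [<-|ne] := eqVneq l l'; last first.
  by rewrite mul0r big1// => i _; rewrite big1// => j _; rewrite !mulr0.
rewrite mul1r /zonal mulr_sumr; apply: eq_bigr => i _; rewrite (bigD1 i)//= eqxx.
rewrite big1 ?addr0 ?mulr1; first by ring.
move=> j ji; rewrite (_ : _ == _ = false) ?mulr0//; apply: contraNF ji => /eqP h.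
by apply/eqP/val_inj => /=; move: h; rewrite /order_of; lia.
Qed.

Let ip_level_field l x : ip P (level l x) (fun w => inner (t x w) u) = lam l * zonal l x x.
Proof.
rewrite ip_suml; [|by move=> i; exact: L2_term|exact: L2_field].
rewrite /zonal mulr_sumr; apply: eq_bigr => i _; have ml := order_ofP i.
rewrite ipZl; [|exact: L2_coefficient|exact: L2_field].
by rewrite coefficient_field// hlam//; ring.
Qed.

(** Pythagoras over the degrees, whose contributions are uncorrelated. *)
Lemma errorE L x : error u L x = cross u u x x - \sum_(l < L.+1) lam l * zonal l x x.
Proof.
have -> : error u L x = ip P (fun w => inner (t x w) u - \sum_(l < L.+1) level l x w)
    (fun w => inner (t x w) u - \sum_(l < L.+1) level l x w).
  have h w : inner (residual L x w) u = inner (t x w) u - \sum_(l < L.+1) level l x w.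
    rewrite residual_inner; congr (_ - _); apply: eq_bigr => l _; apply: eq_bigr => i _.
    by rewrite coefficient_inner//; exact: order_ofP.
  by apply: eq_Rintegral => w _; rewrite h.
rewrite (ip_residual (F := fun l : 'I_L.+1 => level l x)).
- congr (_ - _); apply: eq_bigr => l _.
  by rewrite ip_level eqxx mul1r.
- exact: L2_field.
- by move=> l; exact: L2_level.
- by move=> i j ij; rewrite ip_level (_ : _ == _ = false) ?mul0r//; exact/negbTE.
- by move=> i; rewrite ip_level_field ip_level eqxx mul1r.
Qed.

Lemma error_const L x : error u L x = error u L (north R).
Proof.
rewrite (errorE L (north R)) (errorE L x) (cross_diag u x).
apply: (congr1 (fun s => _ - s)); apply: eq_bigr => l _; apply: (congr1 (fun s => _ * s)).
exact: zonal_diag.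
Qed.

Lemma error_le L x : error u L x <= cross u u x x.
Proof.
rewrite errorE gerBl; apply: sumr_ge0 => l _.
by have := ip_ge0 P (level l x); rewrite ip_level eqxx mul1r.
Qed.

End error.

Lemma surface_mass_gt0 : 0 < \int[sigma]_x (1 : R).
Proof.
have ml : (`|0%:Z| <= 0)%N by [].
have [mY [M YM]] := Poly_bounded_measurable (Poly_harmonic R ml).
have LY := L2_harmonic R ml; have L1 := L2_cst sigma (1 : R).
have : ip sigma (Y 0 0) (Y 0 0) <= M ^+ 2 * \int[sigma]_x (1 : R).
  have i1 := L2_integrable L1; rewrite -RintegralZl//; apply: le_Rintegral => //.
  - exact: (L2M_integrable LY LY).
  - exact: (integrableZl measurableT (M ^+ 2) i1).
  - move=> x _; rewrite mulr1 -expr2 -(real_normK (num_real (Y 0 0 x))).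
    by rewrite ler_sqr ?nnegrE// (le_trans _ (YM x)).
rewrite harmonic_orthonormal// !eqxx /= => h.
have m0 : 0 <= \int[sigma]_x (1 : R) by apply: Rintegral_ge0.
rewrite lt_neqAle m0 andbT eq_sym; apply/eqP => z; rewrite z mulr0 in h.
by have := lt_le_trans ltr01 h; rewrite ltxx.
Qed.

Lemma residual_measurable u L : jointly_measurable (fun w x => inner (residual L x w) u).
Proof.
rewrite /jointly_measurable; under eq_fun do rewrite residual_inner.
apply: measurable_funB; first exact: t_measurable.
apply: measurable_sum => l; apply: measurable_sum => i; have ml := order_ofP i.
apply: measurable_funM.
  exact: jointly_measurable_snd (L2_measurable (L2_harmonic R ml)).
under eq_fun do rewrite -coefficient_inner//.
exact: jointly_measurable_fst (coefficient_weak ml u).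
Qed.

Lemma residual_weak L x : weakly_measurable (residual L x).
Proof. by move=> u; exact: jointly_measurable_section2 (residual_measurable u L). Qed.

Lemma L2_residual L x : L2 P (fun w => `|residual L x w|).
Proof.
pose G w := `|t x w| + \sum_(l < L.+1) \sum_(i < (2 * l).+1)
  `|Y l (order_of l i) x| * `|coefficient l (order_of l i) w|.
have LG : L2 P G.
  apply: L2D; first exact: L2_field_norm.
  apply: L2_sum => l; apply: L2_sum => i; apply: L2Z.
  by apply: L2_coefficient_norm; exact: order_ofP.
have rG w : `|residual L x w| <= G w.
  apply: le_trans (ler_normB _ _) _; rewrite lerD2l.
  apply: le_trans (ler_norm_sum _ _ _) _; apply: ler_sum => l _.
  apply: le_trans (ler_norm_sum _ _ _) _; apply: ler_sum => i _.
  by rewrite normrZ.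
apply: L2_dominated LG _ => [|w].
  exact: weakly_measurable_norm sep _ (residual_weak L x).
by rewrite normr_id.
Qed.

Lemma residual_path u L w : (fun x => inner (residual L x w) u) =
  fun x => inner (t x w) u - harmonic_proj L (fun y => inner (t y w) u) x.
Proof. by apply/funext => x; exact: residual_inner. Qed.

Lemma L2_residual_path u L w : L2 sigma (fun x => inner (residual L x w) u).
Proof.
by rewrite residual_path; apply: L2B; [exact: L2_path|exact: L2_harmonic_proj].
Qed.

(** The error is constant over the sphere, so it is proportional to the mean
    of the L2 errors of the paths. These tend to zero by completeness and
    are dominated by Bessel's inequality. *)
Lemma error_cvg u : error u L (north R) @[L --> \oo] --> (0 : R).
Proof.
pose E L := \int[P]_w ip sigma (fun x => inner (residual L x w) u)
  (fun x => inner (residual L x w) u).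
have [lam hlam] := cross_harmonic u u.
have mE L : measurable_fun setT (fun w => ip sigma (fun x => inner (residual L x w) u)
    (fun x => inner (residual L x w) u)).
  apply: measurable_ip; [exact: residual_measurable|exact: residual_measurable|..] => w;
  exact: L2_residual_path.
have ig : P.-integrable setT (EFin \o (fun w => ip sigma (fun x => inner (t x w) u)
    (fun x => inner (t x w) u))).
  apply: nonneg_integrable.
  - by apply: measurable_ip (t_measurable u) (t_measurable u) _ _ => w; exact: L2_path.
  - by move=> w; exact: ip_ge0.
  - apply: le_lt_trans (coordinate_integral u); apply: ge0_integral_mono => w.
      by rewrite lee_fin ip_ge0.
    by rewrite (ip_EFin (L2_path w u) (L2_path w u)).
have E0 : E L @[L --> \oo] --> (0 : R).
  have -> : (0 : R) = \int[P]_w (0 : R) by rewrite /Rintegral integral0.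
  apply: (Rintegral_dominated_cvg mE ig).
  - move=> L w; rewrite ger0_norm ?ip_ge0// residual_path.
    exact: harmonic_bessel (L2_path w u).
  - move=> w; under eq_fun do rewrite residual_path.
    exact: harmonics_complete (L2_path w u).
have EE L : E L = error u L (north R) * \int[sigma]_x (1 : R).
  have mr := residual_measurable u L.
  have ie : P.-integrable setT (EFin \o (fun w => ip sigma
      (fun x => inner (residual L x w) u) (fun x => inner (residual L x w) u))).
    apply: (dominated_integrable (mE L) ig) => w; rewrite ger0_norm ?ip_ge0// residual_path.
    exact: harmonic_bessel (L2_path w u).
  have i1 := L2_integrable (L2_cst sigma (1 : R)).
  apply: EFin_inj; rewrite EFinM (EFin_Rintegral i1) /E (EFin_Rintegral ie).
  have Lr x : L2 P (fun w => inner (residual L x w) u).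
    exact: L2_inner (residual_weak L x) (L2_residual L x).
  have := @fubini_tonelli _ _ _ _ _ P sigma
    (fun p => (inner (residual L p.2 p.1) u * inner (residual L p.2 p.1) u)%:E).
  rewrite /fubini_F /fubini_G /= => h.
  transitivity (\int[P]_w \int[sigma]_x
      (inner (residual L x w) u * inner (residual L x w) u)%:E)%E.
    apply: eq_integral => w _.
    by rewrite (ip_EFin (L2_residual_path u L w) (L2_residual_path u L w)).
  rewrite h; first last.
  - by move=> p; rewrite lee_fin -expr2 sqr_ge0.
  - by apply/measurable_EFinP; exact: measurable_funM.
  transitivity (\int[sigma]_x (cst (error u L (north R))%:E x))%E.
    apply: eq_integral => x _; rewrite /= -(error_const hlam L x).
    by rewrite (ip_EFin (Lr x) (Lr x)).
  by rewrite !integral_cst// mul1e.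
have m0 := surface_mass_gt0.
rewrite (_ : (fun L => _) = fun L => E L * (\int[sigma]_x (1 : R))^-1); last first.
  by apply/funext => L; rewrite EE mulfK// gt_eqF.
rewrite -(mul0r (\int[sigma]_x (1 : R))^-1); apply: cvgM => //; exact: cvg_cst.
Qed.

(** In the first [n] directions the error is [error]; in the others it is at
    most the energy of the field. The bound does not depend on [x]. *)
Lemma mean_residual_le e n L x : frame e ->
  ip P (fun w => `|residual L x w|) (fun w => `|residual L x w|) <=
  \sum_(k < n) error (e k) L (north R) +
  (energy (north R) - \sum_(k < n) cross (e k) (e k) (north R) (north R)).
Proof.
move=> fe; have cv := mean_parseval (residual_weak L x) (L2_residual L x) fe.
have cvE := @truncated_energy_cvg e (north R) fe.
have cross_ge0 k : 0 <= cross (e k) (e k) (north R) (north R) by exact: ip_ge0.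
apply: (cvgr_to_le cv); exists n => // p /= np.
have eS p' : \sum_(k < p') ip P (fun w => inner (residual L x w) (e k))
    (fun w => inner (residual L x w) (e k)) = \sum_(k < p') error (e k) L (north R).
  apply: eq_bigr => k _; have [lam hlam] := cross_harmonic (e k) (e k).
  exact: (error_const hlam L x).
rewrite eS -(subnKC np) big_split_ord /= lerD2l.
have le_energy : \sum_(k < p) cross (e k) (e k) (north R) (north R) <= energy (north R).
  apply: (cvgr_to_ge cvE); exists p => // q /= pq.
  rewrite -(subnKC pq) big_split_ord /= lerDl sumr_ge0// => k _; exact: cross_ge0.
rewrite -(subnKC np) big_split_ord /= in le_energy.
rewrite lerBrDr; apply: le_trans le_energy; rewrite [leLHS]addrC lerD2l.
apply: ler_sum => k _; have [lam hlam] := cross_harmonic (e (n + k)%N) (e (n + k)%N).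
exact: (error_le hlam).
Qed.

Lemma mean_residual_cvg r : 0 < r -> exists L0, forall L x, (L0 <= L)%N ->
  ip P (fun w => `|residual L x w|) (fun w => `|residual L x w|) < r.
Proof.
move=> r0; have [e fe] := separable_frame sep; have r2 : 0 < r / 2 by rewrite divr_gt0.
have /cvgrPdist_lt/(_ _ r2)[n _ hn] := @truncated_energy_cvg e (north R) fe.
have {}hn := hn n (leqnn n); rewrite /= in hn.
have : \sum_(k < n) error (e k) L (north R) @[L --> \oo] --> (0 : R).
  elim: n {hn} => [|n ih].
    by rewrite (_ : (fun L => _) = cst 0); [exact: cvg_cst|apply/funext => L; rewrite big_ord0].
  under eq_fun do rewrite big_ord_recr /=.
  have := cvgD ih (@error_cvg (e n)); rewrite addr0; exact.
move=> /cvgrPdist_lt/(_ _ r2)[L0 _ hL]; exists L0 => L x LL.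
have {}hL := hL L LL; rewrite /= sub0r normrN in hL.
apply: le_lt_trans (mean_residual_le n L x fe) _; rewrite (splitr r).
by apply: ltrD; [exact: le_lt_trans (ler_norm _) hL|exact: le_lt_trans (ler_norm _) hn].
Qed.

(** * The power spectrum *)

Section covariance.
Variable A : sphere R -> sphere R -> hs_op H.
Hypothesis A_coef : forall x y u v, inner (A x y v) u = cross u v x y.

Let weak_truncate e n x : weakly_measurable (fun w => truncate e n (t x w)).
Proof.
by apply: weakly_measurable_sum => k; apply: weakly_measurableZ (weakly_measurable_cst _);
  exact: field_weak.
Qed.

Let L2_truncate e n x : frame e -> L2 P (fun w => `|truncate e n (t x w)|).
Proof.
move=> [eo e1 _]; apply: L2_dominated (L2_field_norm x) _ => [|w].
  exact: weakly_measurable_norm sep _ (weak_truncate e n x).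
by rewrite normr_id; exact: truncate_le.
Qed.

Let weak_rest e n x : weakly_measurable (fun w => t x w - truncate e n (t x w)).
Proof. by apply: weakly_measurableB; [exact: field_weak|exact: weak_truncate]. Qed.

Let L2_rest e n x : frame e -> L2 P (fun w => `|t x w - truncate e n (t x w)|).
Proof.
move=> [eo e1 _]; apply: L2_dominated (L2_field_norm x) _ => [|w].
  exact: weakly_measurable_norm sep _ (weak_rest e n x).
by rewrite normr_id; exact: truncate_residual_le.
Qed.

Definition tail_energy (e : nat -> H) n : R :=
  energy (north R) - \sum_(k < n) cross (e k) (e k) (north R) (north R).

Let rest_energy e n x : frame e ->
  ip P (fun w => `|t x w - truncate e n (t x w)|) (fun w => `|t x w - truncate e n (t x w)|) =
  tail_energy e n.
Proof.
move=> [eo e1 _]; rewrite /tail_energy -(energyE x).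
have -> : \sum_(k < n) cross (e k) (e k) (north R) (north R) =
    \int[P]_w \sum_(k < n) (inner (t x w) (e k) * inner (t x w) (e k)).
  rewrite Rintegral_sum; last by move=> k; exact: (L2M_integrable (L2_field x _) (L2_field x _)).
  by apply: eq_bigr => k _; rewrite -(cross_diag (e k) x).
rewrite /energy /ip -RintegralB//.
- by apply: eq_Rintegral => w _; rewrite -!expr2 truncate_residual_sqr.
- exact: (L2M_integrable (L2_field_norm x) (L2_field_norm x)).
- apply: (@integrable_sumr _ _ _ P _ _
    (fun (k : 'I_n) w => inner (t x w) (e k) * inner (t x w) (e k))).
  by move=> k; exact: (L2M_integrable (L2_field x _) (L2_field x _)).
Qed.

Lemma tail_energy_ge0 e n : frame e -> 0 <= tail_energy e n.
Proof. by move=> fe; rewrite -(rest_energy n (north R) fe) ip_ge0. Qed.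

Lemma tail_energy_le (e : nat -> H) n : tail_energy e n <= energy (north R).
Proof. by rewrite gerBl sumr_ge0// => k _; exact: ip_ge0. Qed.

Definition finite_rank (e : nat -> H) n x y : hs_op H :=
  \sum_(i < n) \sum_(j < n) cross (e i) (e j) x y *: tensor (e i) (e j).

Lemma inner_hs_sum (I : Type) (r : seq I) (B : I -> hs_op H) v u :
  inner ((\sum_(i <- r) B i : hs_op H) v) u = \sum_(i <- r) inner (B i v) u.
Proof.
elim: r => [|i r ih]; first by rewrite !big_nil; exact: inner0l.
by rewrite !big_cons -ih; exact: innerDl.
Qed.

Lemma finite_rank_coef e n x y u v : frame e -> inner (finite_rank e n x y v) u =
  ip P (fun w => inner (truncate e n (t x w)) u) (fun w => inner (truncate e n (t y w)) v).
Proof.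
move=> [eo e1 _].
transitivity (ip P (fun w => \sum_(k < n) inner u (e k) * inner (t x w) (e k))
    (fun w => \sum_(k < n) inner v (e k) * inner (t y w) (e k))); last first.
  apply: eq_Rintegral => w _; rewrite !inner_truncateE.
  by congr (_ * _); apply: eq_bigr => k _; rewrite mulrC.
have L z (k : 'I_n) u' : L2 P (fun w => inner u' (e k) * inner (t z w) (e k)).
  by apply: L2Z; exact: L2_field.
rewrite ip_sum_sum; [|by move=> i; exact: L|by move=> i; exact: L].
rewrite inner_hs_sum; apply: eq_bigr => i _; rewrite inner_hs_sum; apply: eq_bigr => j _.
rewrite ipZl; [|exact: L2_field|exact: L].
rewrite ipC ipZl; [|exact: L2_field|exact: L2_field].
rewrite ipC -[LHS]/(inner (cross (e i) (e j) x y *: tensor (e i) (e j) v) u).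
by rewrite innerZl tensor_coef (innerC (e i)) (innerC (e j)) /cross; ring.
Qed.

(** Truncating both arguments of the tensor product costs at most the energy of
    the two tails, which by isotropy does not depend on the points. *)
Lemma finite_rank_error e n x y : frame e -> `|A x y - finite_rank e n x y| <=
  2 * Num.sqrt (energy (north R) * tail_energy e n).
Proof.
move=> fe; have [eo e1 _] := fe.
have i1 := L2M_integrable (L2_field_norm x) (L2_rest n y fe).
have i2 := L2M_integrable (L2_rest n x fe) (L2_truncate n y fe).
have [I1 hI1] := bochner_tensor_exists sep (field_weak x) (weak_rest e n y) i1.
have [I2 hI2] := bochner_tensor_exists sep (weak_rest e n x) (weak_truncate e n y) i2.
have -> : A x y - finite_rank e n x y = I1 + I2.
  apply: hs_ext => v u.
  rewrite -[LHS]/(inner (A x y v - finite_rank e n x y v) u).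
  rewrite -[RHS]/(inner (I1 v + I2 v) u) innerBl innerDl A_coef finite_rank_coef//.
  have [_ ->] := bochner_tensor_coef u v (field_weak x) (weak_rest e n y) hI1.
  have [_ ->] := bochner_tensor_coef u v (weak_rest e n x) (weak_truncate e n y) hI2.
  have Lx := L2_field x u; have Ly := L2_field y v.
  have Lx' := L2_inner u (weak_truncate e n x) (L2_truncate n x fe).
  have Ly' := L2_inner v (weak_truncate e n y) (L2_truncate n y fe).
  rewrite -[X in _ = X + _]/(ip P _ _) -[X in _ = _ + X]/(ip P _ _).
  have -> : (fun w => inner (t y w - truncate e n (t y w)) v) =
      fun w => inner (t y w) v - inner (truncate e n (t y w)) v.
    by apply/funext => w; rewrite innerBl.
  have -> : (fun w => inner (t x w - truncate e n (t x w)) u) =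
      fun w => inner (t x w) u - inner (truncate e n (t x w)) u.
    by apply/funext => w; rewrite innerBl.
  rewrite (ipBl Lx Lx' Ly') (ipC P (fun w => inner (t x w) u)) (ipBl Ly Ly' Lx).
  by rewrite /cross (ipC P (fun w => inner (t y w) v))
    (ipC P (fun w => inner (truncate e n (t y w)) v) (fun w => inner (t x w) u)); ring.
have e0 : 0 <= energy (north R) by exact: ip_ge0.
have bound (a b : R) : 0 <= a -> a ^+ 2 <= b -> a <= Num.sqrt b.
  by move=> a0 ab; rewrite -(ger0_norm a0) -sqrtr_sqr ler_wsqrtr.
have n1 : `|I1| <= Num.sqrt (energy (north R) * tail_energy e n).
  apply: le_trans (bochner_norm_le hI1 i1 _) _; first by move=> w; exact: tensor_norm.
  apply: bound; first by apply: Rintegral_ge0 => w _; rewrite mulr_ge0.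
  apply: le_trans (ip_schwarz (L2_field_norm x) (L2_rest n y fe)) _.
  by rewrite (rest_energy n y fe) -[X in X * _]/(energy x) energyE.
have n2 : `|I2| <= Num.sqrt (energy (north R) * tail_energy e n).
  apply: le_trans (bochner_norm_le hI2 i2 _) _; first by move=> w; exact: tensor_norm.
  apply: bound; first by apply: Rintegral_ge0 => w _; rewrite mulr_ge0.
  apply: le_trans (ip_schwarz (L2_rest n x fe) (L2_truncate n y fe)) _.
  rewrite (rest_energy n x fe) mulrC ler_wpM2r ?tail_energy_ge0// -(energyE y).
  apply: le_Rintegral => //.
  - exact: (L2M_integrable (L2_truncate n y fe) (L2_truncate n y fe)).
  - exact: (L2M_integrable (L2_field_norm y) (L2_field_norm y)).
  - by move=> w _; rewrite ler_pM//; exact: truncate_le.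
by apply: le_trans (ler_normD _ _) _; lra.
Qed.

Variable l : nat.

Let weight (p : sphere R * sphere R) := Y l 0 p.1 * Y l 0 p.2.

Let weight_measurable : measurable_fun setT weight.
Proof.
have mY : measurable_fun setT (Y l 0) by exact: L2_measurable (L2_harmonic R (m := 0) (leq0n l)).
by apply: measurable_funM; [exact: jointly_measurable_fst|exact: jointly_measurable_snd].
Qed.

Let weight_bounded : exists2 M, 0 <= M & forall p, `|weight p| <= M.
Proof.
have [_ [M YM]] := Poly_bounded_measurable (Poly_harmonic R (m := 0) (leq0n l)).
exists (M * M); first by rewrite mulr_ge0// (le_trans _ (YM (north R))).
by move=> p; rewrite normrM ler_pM.
Qed.

Let weighted_cross u v p := weight p * cross u v p.1 p.2.

Let weighted_measurable u v : measurable_fun setT (weighted_cross u v).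
Proof. by apply: measurable_funM => //; exact: measurable_cross. Qed.

Let weighted_bounded u v : exists M, forall p, `|weighted_cross u v p| <= M.
Proof.
have [M M0 wM] := weight_bounded; exists (M * (`|u| * `|v| * energy (north R))) => p.
by rewrite normrM ler_pM// cross_le.
Qed.

(** The truncations to finite rank converge uniformly; rounding their
    finitely many bounded coefficients makes them simple. *)
Lemma spectrum_exists :
  exists J, is_bochner (sigma \x sigma)%E (fun p => weight p *: A p.1 p.2) J.
Proof.
have [e fe] := separable_frame sep; have [eo e1 _] := fe.
have [M M0 wM] := weight_bounded.
pose K := energy (north R); have K0 : 0 <= K by exact: ip_ge0.
(* There are [n ^ 2] coefficients, each rounded within [1 / (N n + 1)]. *)
pose N n := (n.+1 * (n.+1 * n.+1))%N.
pose b n : R := M * (2 * Num.sqrt (K * tail_energy e n)) + n.+1%:R^-1.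
pose s n p : hs_op H := \sum_(i < n) \sum_(j < n)
  round_down (N n) (weighted_cross (e i) (e j) p) *: tensor (e i) (e j).
apply: (@bochner_exists _ _ _ (finite_product sigma sigma) (hs_op H : normedModType R)
  _ s (fun n _ => b n)
  (fun _ => M * (2 * Num.sqrt (K * K)) + 1)).
- exact: hs_complete.
- move=> n.
  apply: finitely_valued_sum => i; apply: finitely_valued_sum => j.
  have [M' wM'] := weighted_bounded (e i) (e j).
  exact: (finitely_valued_comp (fun r => r *: tensor (e i) (e j))
    (round_down_finitely_valued (N n) (weighted_measurable (e i) (e j)) wM')).
- by move=> n; exact: measurable_cst.
- move=> n p.
  have -> : weight p *: A p.1 p.2 - s n p = weight p *: (A p.1 p.2 - finite_rank e n p.1 p.2) +
      \sum_(i < n) \sum_(j < n) (weighted_cross (e i) (e j) p -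
        round_down (N n) (weighted_cross (e i) (e j) p)) *: tensor (e i) (e j).
    have -> : \sum_(i < n) \sum_(j < n) (weighted_cross (e i) (e j) p -
        round_down (N n) (weighted_cross (e i) (e j) p)) *: tensor (e i) (e j) =
        weight p *: finite_rank e n p.1 p.2 - s n p.
      rewrite scaler_sumr -sumrB; apply: eq_bigr => i _.
      rewrite scaler_sumr -sumrB; apply: eq_bigr => j _.
      by rewrite scalerBl scalerA.
    by rewrite scalerBr addrA subrK.
  apply: le_trans (ler_normD _ _) _; apply: lerD.
    by rewrite normrZ ler_pM// finite_rank_error.
  apply: (@le_trans _ _ (\sum_(i < n) \sum_(j < n) (N n).+1%:R^-1)).
    apply: le_trans (ler_norm_sum _ _ _) _; apply: ler_sum => i _.
    apply: le_trans (ler_norm_sum _ _ _) _; apply: ler_sum => j _.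
    rewrite normrZ -[leRHS]mulr1; apply: ler_pM => //; first exact: round_down_error.
    apply: le_trans (tensor_norm _ _) _.
    by rewrite -[leRHS]mulr1 ler_pM//; exact: norm_frame.
  rewrite !sumr_const !card_ord -mulrnA -[_ *+ _]mulr_natr ler_pdivrMl ?ltr0n//.
  rewrite ler_pdivlMr ?ltr0n// -natrM ler_nat /N; nia.
- move=> n _; apply: lerD; last by rewrite invf_le1 ?ler1n ?ltr0n.
  by rewrite ler_wpM2l// ler_wpM2l// ler_wsqrtr// ler_wpM2l//; exact: tail_energy_le.
- exact: L2_integrable (L2_cst _ _).
- move=> _; have cvT : tail_energy e n @[n --> \oo] --> (0 : R).
    rewrite -(subrr K); apply: cvgB; first exact: cvg_cst.
    exact: truncated_energy_cvg.
  have cvS : Num.sqrt (K * tail_energy e n) @[n --> \oo] --> (0 : R).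
    rewrite -(sqrtr0 R) -(mulr0 K); apply: continuous_cvg; first exact: sqrt_continuous.
    by apply: cvgM cvT; exact: cvg_cst.
  rewrite -(addr0 0) -{1}(mulr0 M) -{1}(mulr0 2); apply: cvgD; last exact: cvg_harmonic.
  by apply: cvgM (cvg_cst _) _; apply: cvgM (cvg_cst _) cvS.
Qed.

Lemma spectrum_coef J u v lam :
  is_bochner (sigma \x sigma)%E (fun p => weight p *: A p.1 p.2) J ->
  (forall x, ip sigma (cross u v x) (Y l 0) = lam * Y l 0 x) -> inner (J v) u = lam.
Proof.
move=> hJ hlam; have l0 : (`|0%:Z| <= l)%N by [].
have coefE p : inner ((weight p *: A p.1 p.2) v) u = weighted_cross u v p.
  by rewrite -[LHS]/(inner (weight p *: A p.1 p.2 v) u) innerZl A_coef.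
have [|_ <-] := bochner_functional (mu := finite_product sigma sigma) hJ
  (hs_coef_linear v u) (hs_coef_le v u).
  by rewrite (funext coefE); exact: weighted_measurable.
under eq_Rintegral do rewrite coefE.
have [M wM] := weighted_bounded u v.
have LY := L2_harmonic R l0.
rewrite Rintegral_product.
- transitivity (ip sigma (fun x => lam * Y l 0 x) (Y l 0)).
    apply: eq_Rintegral => x _; rewrite -hlam mulrC -ipZl//.
      by apply: eq_Rintegral => y _; rewrite /weighted_cross /weight /=; ring.
    apply: (@bounded_L2 _ _ _ sigma _ (`|u| * `|v| * energy (north R))).
      exact: measurable_cross_section.
    by move=> y; exact: cross_le.
  by rewrite ipZl// harmonic_orthonormal// !eqxx mulr1.
- exact: (bounded_integrable (finite_product sigma sigma) (weighted_measurable u v) wM).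
- move=> x; apply: (@bounded_integrable _ _ _ sigma _ M) => [|y]; last exact: wM.
  exact: (measurableT_comp (weighted_measurable u v) (measurable_pair1 x)).
Qed.

(** Both operators have the Funk-Hecke eigenvalues as matrix coefficients. *)
Lemma coefficient_spectrum m J : (`|m| <= l)%N ->
  is_bochner (sigma \x sigma)%E (fun p => weight p *: A p.1 p.2) J ->
  is_bochner P (fun w => tensor (coefficient l m w) (coefficient l m w)) J.
Proof.
move=> ml hJ; have [J' [hJ' Jc]] := coefficient_tensor ml ml.
suff -> : J = J' by []; apply: hs_ext => v u; rewrite Jc.
have [lam hlam] := cross_harmonic u v.
rewrite (coefficient_orthogonal ml ml (lam := lam l)); last by move=> x; exact: hlam.
by rewrite !eqxx mulr1; apply: spectrum_coef hJ _ => x; exact: hlam.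
Qed.

End covariance.

End regular_field.

(** * Isotropic fields *)

Section isotropic_field.
Context d (Omega : measurableType d) (R : realType) (P : probability Omega R).
Context (H : hilbertType R) (T : sphere R -> Omega -> H).
Local Notation sigma := (surface R).
Hypothesis sep : separable_space H.
Hypothesis Tfield : spherical_field P T.
Hypothesis Tiso : isotropic P T.

Lemma field_jointly_measurable u : jointly_measurable (fun w x => inner (T x w) u).
Proof.
exact: (borel_weakly_measurable (f := fun p : Omega * sphere R => T p.2 p.1)
  (field_measurable Tfield) u).
Qed.

Let mT := field_jointly_measurable.
Let qT := field_sqintegrable Tfield.

(** This turns isotropy of the operators into invariance of the scalar
    kernels. *)
Lemma autocov_coef x y u v : inner (autocov P T x y v) u = cross P T u v x y.
Proof.
have h := bochner_tensor_exists sep (field_weak mT x) (field_weak mT y)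
  (L2M_integrable (L2_field_norm sep mT qT x) (L2_field_norm sep mT qT y)).
by have [_ ->] := bochner_tensor_coef u v (field_weak mT x) (field_weak mT y) (bochnerP h).
Qed.

Lemma cross_isotropic u v x y rho : rho \in SO3 R ->
  cross P T u v x y = cross P T u v (rotate rho x) (rotate rho y).
Proof. by move=> hr; rewrite -!autocov_coef -Tiso. Qed.

Definition path_energy w : \bar R := (\int[sigma]_x (`|T x w| ^+ 2)%:E)%E.

Lemma path_energy_measurable : measurable_fun setT path_energy.
Proof.
apply: (measurable_fun_fubini_tonelli_F (fun p => (`|T p.2 p.1| ^+ 2)%:E)).
  by apply/measurable_EFinP; apply: measurable_funX; exact: norm_measurable.
by move=> p; rewrite lee_fin sqr_ge0.
Qed.

Definition good : set Omega := [set w | (path_energy w < +oo)%E].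

Lemma good_measurable : measurable good.
Proof.
rewrite /good -[X in measurable X]setTI.
by apply: emeasurable_fun_infty_o => //; exact: path_energy_measurable.
Qed.

(** The expectation of the energy of a path is finite. *)
Lemma good_ae : {ae P, forall w, good w}.
Proof.
have i : P.-integrable setT path_energy.
  apply/integrableP; split; first exact: path_energy_measurable.
  under eq_integral do rewrite gee0_abs ?integral_ge0//.
  exact: energy_integral sep mT qT cross_isotropic.
apply: filterS (integrable_ae measurableT i) => w /(_ I) h.
by rewrite /good /= ltey_eq h.
Qed.

(** The field with the null set of paths of infinite energy removed. *)
Definition regularized x w : H := (\1_good w : R) *: T x w.
Local Notation t := regularized.

Lemma regularized_good w x : good w -> t x w = T x w.
Proof. by move=> gw; rewrite /t indicE mem_set// scale1r. Qed.

Lemma regularized_le x w : `|t x w| <= `|T x w|.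
Proof.
rewrite normrZ ler_piMl// indicE; case: (_ \in _); rewrite ?normr1 ?normr0//.
Qed.

Lemma regularized_measurable u : jointly_measurable (fun w x => inner (t x w) u).
Proof.
rewrite /jointly_measurable; under eq_fun do rewrite innerZl.
apply: measurable_funM; last exact: mT.
by apply: jointly_measurable_fst; exact: measurable_indic good_measurable.
Qed.

Lemma regularized_space w : (\int[sigma]_x (`|t x w| ^+ 2)%:E < +oo)%E.
Proof.
have [gw|gw] := pselect (good w).
  by under eq_integral do rewrite regularized_good//.
under eq_integral do rewrite /t indicE memNset// scale0r normr0 expr0n.
by rewrite integral0 ltry.
Qed.

Lemma regularized_moment x : (\int[P]_w (`|t x w| ^+ 2)%:E < +oo)%E.
Proof.
apply: le_lt_trans (qT x); apply: ge0_integral_mono => w; rewrite lee_fin ?sqr_ge0//.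
by rewrite ler_sqr ?nnegrE//; exact: regularized_le.
Qed.

Lemma Rintegral_ae (f g : Omega -> R) : measurable_fun setT f -> measurable_fun setT g ->
  (forall w, good w -> f w = g w) -> \int[P]_w f w = \int[P]_w g w.
Proof.
move=> mf mg fg; congr fine; apply: ae_eq_integral => //; try exact/measurable_EFinP.
by apply: filterS good_ae => w gw _; rewrite /= fg.
Qed.

Lemma regularized_centered x u : \int[P]_w inner (t x w) u = 0.
Proof.
have [_] := bochner_inner u (field_weak mT x) (field_centered Tfield x).
rewrite inner0l => <-; apply: Rintegral_ae.
- exact: field_weak regularized_measurable _ _.
- exact: field_weak.
- by move=> w gw; rewrite regularized_good.
Qed.

Lemma cross_regularized u v x y : cross P t u v x y = cross P T u v x y.
Proof.
apply: Rintegral_ae.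
- by apply: measurable_funM; exact: (field_weak regularized_measurable).
- by apply: measurable_funM; exact: (field_weak mT).
- by move=> w gw; rewrite !regularized_good.
Qed.

Lemma regularized_isotropic u v x y rho : rho \in SO3 R ->
  cross P t u v x y = cross P t u v (rotate rho x) (rotate rho y).
Proof. by move=> hr; rewrite !cross_regularized; exact: cross_isotropic. Qed.

Let mt := regularized_measurable.
Let st := regularized_space.
Let qt := regularized_moment.
Let it := regularized_isotropic.

Local Notation a := (coefficient t).

Lemma power_spectrum_coefficient l m : (`|m| <= l)%N ->
  is_bochner P (fun w => tensor (a l m w) (a l m w)) (power_spectrum P T l).
Proof.
move=> ml; have Ac x y u v : inner (autocov P T x y v) u = cross P t u v x y.
  by rewrite autocov_coef cross_regularized.
apply: (coefficient_spectrum sep mt st qt it Ac ml).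
exact: bochnerP (spectrum_exists sep mt qt it Ac l).
Qed.

Lemma difference_measurable L u :
  jointly_measurable (fun w x => inner (T x w - harmonic_partial_sum a L x w) u).
Proof.
rewrite /jointly_measurable (_ : (fun p => _) = fun p => inner (T p.2 p.1) u -
    (inner (t p.2 p.1) u - inner (residual t L p.2 p.1) u)).
  apply: measurable_funB; first exact: mT.
  by apply: measurable_funB; [exact: mt|exact: residual_measurable].
by apply/funext => p; rewrite !innerBl; ring.
Qed.

Lemma mean_difference L x :
  (\int[P]_w (`|T x w - harmonic_partial_sum a L x w| ^+ 2)%:E)%E =
  (ip P (fun w => `|residual t L x w|) (fun w => `|residual t L x w|))%:E.
Proof.
have Lr := L2_residual sep mt st qt it L x.
rewrite ip_EFin//; apply: ge0_ae_eq_integral => //.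
- apply/measurable_EFinP; apply: (weakly_measurable_sqr sep) => u.
  exact: jointly_measurable_section2 (difference_measurable L u).
- by apply/measurable_EFinP/measurable_funM; exact: L2_measurable Lr.
- by apply: filterS good_ae => w gw _; rewrite /residual regularized_good// expr2.
Qed.

Lemma mean_difference_cvg (r : R) : 0 < r -> exists L0, forall L x, (L0 <= L)%N ->
  (\int[P]_w (`|T x w - harmonic_partial_sum a L x w| ^+ 2)%:E < r%:E)%E.
Proof.
move=> r0; have [L0 hL] := mean_residual_cvg sep mt st qt it r0.
by exists L0 => L x LL; rewrite mean_difference lte_fin hL.
Qed.

Lemma mean_integral_difference L :
  (\int[P]_w \int[sigma]_x (`|T x w - harmonic_partial_sum a L x w| ^+ 2)%:E =
   \int[sigma]_x \int[P]_w (`|T x w - harmonic_partial_sum a L x w| ^+ 2)%:E)%E.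
Proof.
apply: (@fubini_tonelli _ _ _ _ _ P sigma
  (fun p => (`|T p.2 p.1 - harmonic_partial_sum a L p.2 p.1| ^+ 2)%:E)).
  apply/measurable_EFinP; apply: (weakly_measurable_sqr sep); exact: difference_measurable.
by move=> p; rewrite lee_fin sqr_ge0.
Qed.

Lemma cvg_ge0_0 (f : nat -> \bar R) : (forall n, 0 <= f n)%E ->
  (forall r : R, 0 < r -> exists N, forall n, (N <= n)%N -> (f n <= r%:E)%E) ->
  f n @[n --> \oo] --> 0%E.
Proof.
move=> f0 fr; apply/fine_cvgP; split.
  have [N hN] := fr 1 ltr01; exists N => // n Nn.
  by rewrite /= ge0_fin_numE// (le_lt_trans (hN n Nn))// ltry.
apply/cvgrPdist_le => r r0; have [N hN] := fr r r0; exists N => // n /hN /=.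
by rewrite sub0r normrN ger0_norm ?fine_ge0//; case: (f n) (f0 n) => //= s _; rewrite lee_fin.
Qed.

End isotropic_field.

Theorem theorem1 (R : realType) (H : hilbertType R)
    (d : measure_display) (Omega : measurableType d) (P : probability Omega R)
    (T : sphere R -> Omega -> H) :
  separable_space H -> spherical_field P T -> isotropic P T ->
  exists a : nat -> int -> Omega -> H,
    [/\ forall (l : nat) (m : int), (`|m| <= l)%N ->
          [/\ measurable_fun setT (a l m : Omega -> borel H),
              is_bochner P (a l m) 0 &
              is_bochner P (fun w => tensor (a l m w) (a l m w))
                (power_spectrum P T l)],
        forall (l l' : nat) (m m' : int), (`|m| <= l)%N -> (`|m'| <= l')%N ->
          (l, m) <> (l', m') ->
          is_bochner P (fun w => tensor (a l m w) (a l' m' w)) 0,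
        (\int[P]_w \int[surface R]_x
            (`|T x w - harmonic_partial_sum a L x w| ^+ 2)%:E)%E
          @[L --> \oo] --> 0%E &
        forall x : sphere R,
          (\int[P]_w (`|T x w - harmonic_partial_sum a L x w| ^+ 2)%:E)%E
            @[L --> \oo] --> 0%E].
Proof.
move=> sep Tf Ti.
have mt := regularized_measurable sep Tf; have st := @regularized_space _ _ _ H T.
have qt := regularized_moment Tf; have it := regularized_isotropic sep Tf Ti.
exists (coefficient (regularized T)); split.
- move=> l m ml; split.
  + exact: weakly_measurable_borel sep _ (coefficient_weak sep mt st qt it ml).
  + exact: coefficient_centered sep mt st qt (regularized_centered sep Tf Ti) it l m ml.
  + exact: power_spectrum_coefficient.
- by move=> l l' m m' ml ml' ne; have h := coefficient_uncorrelated sep mt st qt it ml ml' ne; exact: h.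
- apply: cvg_ge0_0 => [L|r r0].
    by apply: integral_ge0 => w _; apply: integral_ge0 => x _; rewrite lee_fin sqr_ge0.
  have m0 := surface_mass_gt0 R.
  have [L0 hL] := mean_difference_cvg sep Tf Ti (divr_gt0 r0 m0).
  exists L0 => L LL; rewrite mean_integral_difference//.
  apply: (@le_trans _ _ (\int[surface R]_x (r / \int[surface R]_y (1 : R))%:E)%E).
    apply: ge0_integral_mono => x; last exact/ltW/hL.
    by apply: integral_ge0 => w _; rewrite lee_fin sqr_ge0.
  rewrite -(EFin_Rintegral (L2_integrable (L2_cst (surface R) (r / \int[surface R]_y (1 : R))))).
  have -> : \int[surface R]_x (r / \int[surface R]_y (1 : R)) =
      r / \int[surface R]_y (1 : R) * \int[surface R]_y (1 : R).
    rewrite -RintegralZl//; last exact: L2_integrable (L2_cst (surface R) (1 : R)).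
    by under [RHS]eq_Rintegral do rewrite mulr1.
  by rewrite divfK// gt_eqF.
- move=> x; apply: cvg_ge0_0 => [L|r r0].
    by apply: integral_ge0 => w _; rewrite lee_fin sqr_ge0.
  have [L0 hL] := mean_difference_cvg sep Tf Ti r0.
  by exists L0 => L LL; exact/ltW/hL.
Qed.
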